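(* Let $(X_n)_{n\ge 0}$ be a Harris recurrent strongly aperiodic Markov chain on $(\mathcal{X},\mathcal{B})$ with transition kernel $P$, admitting a unique stationary probability measure $\pi$. Assume that there are $C\in\mathcal{B}$ with $\pi(C)>0$, a probability measure $\nu$ on $\mathcal{B}$ with $\nu(C)>0$, and $\delta>0$ such that $$P(x,B)\ge \delta\,\nu(B)\qquad (x\in C,\ B\in\mathcal{B}),$$ and that for some measurable $V\colon\mathcal{X}\to[1,\infty)$ with $\sup_{x\in C}V(x)<\infty$ and constants $\lambda\in(0,1)$, $b\ge 0$, $$(PV)(x)-V(x)\le -\lambda V(x)+b1_C(x)\qquad (x\in\mathcal{X}).$$ Let $s>0$ and let $g\colon\mathcal{X}\to\mathbb{R}$ be an arbitrary measurable function such that $|g(x)|\le\kappa(\log V(x))^s$ for some $\kappa\ge 0$ and all $x\in\mathcal{X}$. Set $\alpha=1/(s+1)$. Then for every $x\in\mathcal{X}$, $\eta\in(0,1]$ and $t>0$, $$\begin{aligned}\mathbf{P}_x\Big(\Big|\sum_{i=0}^{n-1}g(X_i)-n\pi g\Big|>t\Big)\le{}& 2\exp\Big(-\frac{(t\eta)^\alpha}{A_1^\alpha}\Big)+C_0\exp\Big(-\frac{(t\eta)^\alpha}{A_2^\alpha}\Big)+e^{8}\exp\Big(-\frac{(\eta t)^\alpha}{A_3^\alpha}\Big)\\&+2^{1+\eta/(2+\eta)}\exp\Big(-\frac{t^2}{2\big((1+\eta)\sigma^2n+A_4(\eta)(\log n)^{1/\alpha}t\big)}\Big),\end{aligned}$$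 where $$\sigma^2=\lim_{n\to\infty}\frac{\mathrm{Var}\big(\sum_{i=0}^{n-1}g(X_i)\big)}{n}=\mathrm{Var}_\pi\, g(X_0)+2\sum_{i=1}^\infty \mathrm{Cov}_\pi\big(g(X_0),g(X_i)\big),$$ the constants $C_0,A_1,A_2,A_3$ depend only on $\delta,V,\alpha,\lambda,b,\kappa$, and the constant $A_4(\eta)$ depends only on $\delta,V,\alpha,\lambda,b,\kappa,\eta$ (in all cases the dependence is explicit, and $A_4(\eta)\simeq 1/\eta$ for $\eta\simeq 0$).
   Context: The $\sigma$-field $\mathcal{B}$ is countably generated. $\mathbf{P}_x$ is the law of the chain started at $x$, $(Ph)(x)=\int h(y)P(x,dy)$, $\pi g=\int g\,d\pi$, and $n\ge 1$ is an integer. $\mathrm{Var}_\pi,\mathrm{Cov}_\pi$ refer to the chain started from $\pi$; the variance in the limit is also taken for the stationary chain. ''Strongly aperiodic'' means that the displayed one-step minorization condition holds. Convention: $\log n$ means $\log(\max(n,e))$.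
   Formalization: The constant A_1 is allowed to depend also on the value V(x) at the starting point: with constants free of x the bound fails for n=1 and unbounded g. The remark that the dependence of the constants is explicit is rendered as mere existence of constants. *)

(* Defs.v *)
From HB Require Import structures.
From mathcomp Require Export all_boot all_order all_algebra.
From mathcomp Require Export all_classical all_reals all_analysis.

Set Implicit Arguments.
Unset Strict Implicit.
Unset Printing Implicit Defensive.

Export Order.TTheory GRing.Theory Num.Theory.
Export numFieldNormedType.Exports.

Global Open Scope classical_set_scope.
Global Open Scope ring_scope.

Section markov_chains.
Context {d dO : measure_display} {T : measurableType d}
  {Omega : measurableType dO} {R : realType}.

Definition countably_generated : Prop :=
  exists G : set (set T), countable G /\ @measurable d T = <<s G >>.

(* Under [Q], [X] is a Markov chain with respect to its own filtration, with
   initial law [mu] and transition kernel [P].  The conditional law of the next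
   state is tested on the cylinders, a pi-system generating the past. *)
Definition markov_chain (P : R.-pker T ~> T) (mu : probability T R)
    (Q : probability Omega R) (X : nat -> Omega -> T) : Prop :=
  [/\ forall n, measurable_fun [set: Omega] (X n),
      forall A, measurable A -> Q (X 0%N @^-1` A) = mu A
    & forall (n : nat) (A : nat -> set T) (B : set T),
        (forall i, measurable (A i)) -> measurable B ->
        let past := \bigcap_(i in `I_n.+1) X i @^-1` A i in
        Q (past `&` X n.+1 @^-1` B) = (\int[Q]_(w in past) P (X n w) B)%E].

(* One process together with the laws it may follow: [Pr mu] is the law of the
   chain started from [mu], so that the law started at a point [x] is
   [Pr \d_x] and the law of the stationary chain is [Pr pi].  The Ionescu-Tulcea
   theorem provides such a family on the path space for every kernel [P]. *)
Definition markov_family (P : R.-pker T ~> T) (X : nat -> Omega -> T)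
    (Pr : probability T R -> probability Omega R) : Prop :=
  forall mu, markov_chain P mu (Pr mu) X.

(* Some nontrivial sigma-finite measure [phi] is such that the chain, started
   anywhere, a.s. visits infinitely often every set charged by [phi]. *)
Definition harris_recurrent (X : nat -> Omega -> T)
    (Pr : probability T R -> probability Omega R) : Prop :=
  exists phi : {sigma_finite_measure set T -> \bar R},
    (0 < phi [set: T])%E /\
    forall A, measurable A -> (0 < phi A)%E ->
      forall x : T, Pr \d_x (lim_sup_set (fun n => X n @^-1` A)) = 1%E.

Definition stationary (P : R.-pker T ~> T) (mu : probability T R) : Prop :=
  forall A, measurable A -> (\int[mu]_x P x A)%E = mu A.

Definition unique_stationary (P : R.-pker T ~> T) (pi : probability T R) :
    Prop :=
  stationary P pi /\
  forall mu : probability T R, stationary P mu ->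
    forall A, measurable A -> mu A = pi A.

Definition small_set (P : R.-pker T ~> T) (C : set T) (nu : probability T R)
    (delta : R) : Prop :=
  forall x, C x -> forall B, measurable B -> (delta%:E * nu B <= P x B)%E.

Definition geometric_drift (P : R.-pker T ~> T) (V : T -> R) (C : set T)
    (lambda b : R) : Prop :=
  forall x, (\int[P x]_y (V y)%:E - (V x)%:E
             <= (- lambda * V x + b * \1_C x)%:E)%E.

Definition additive_functional (g : T -> R) (X : nat -> Omega -> T) (n : nat)
    (w : Omega) : R :=
  \sum_(0 <= i < n) g (X i w).

(* [sigma2] is both the limit of the normalized variances under [Q] and the sum
   of the (convergent) series of covariances.  Variances and covariances are
   extended reals, so convergence to the real [sigma2] is part of the claim. *)
Definition asymptotic_variance (Q : probability Omega R) (g : T -> R)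
    (X : nat -> Omega -> T) (sigma2 : R) : Prop :=
  (('V_Q[additive_functional g X n] * (n%:R^-1)%:E)%E @[n --> \oo]
     --> sigma2%:E) /\
  (('V_Q[g \o X 0%N] +
      2%:E * \sum_(1 <= i < n) covariance Q (g \o X 0%N) (g \o X i))%E
     @[n --> \oo] --> sigma2%:E).

End markov_chains.
Arguments countably_generated {d} T.

Definition logn_e {R : realType} (n : nat) : R := ln (Num.max n%:R (expR 1)).

(* Main.v *)
From HB Require Import structures.
Require Import Defs.
From mathcomp Require Import measurable_realfun ring lra.

Set Implicit Arguments.
Unset Strict Implicit.
Unset Printing Implicit Defensive.

(** The split chain is never built on [Omega]; the argument works with functions of the state. The
    minorization writes [P] as a residual kernel [Q] plus the regeneration [delta 1_C(x) nu], and
    regenerations cut a path into blocks. [block_law] is the joint law of the sum of [g] over a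
    block and of the block length. For a small power [u = V ^ q], and with [C] cut down to a
    sublevel set, the drift becomes [Q u <= gam u] with [gam < 1] and no additive constant
    ([residual_drift_weight]). Hence [Q] contracts the [u]-weighted supremum norm: blocks end almost
    surely, block expectations solve first-step equations with unique solutions, and blocks of
    bounded functions have exponential moments.

    For a bounded centred function let [U x] be the expectation of [exp (theta S - a tau)] over the
    block started at [x], with sum [S] and length [tau]. By the first-step equation, [exp (sum of
    (theta g (X i) - a)) * U (X n)] is a supermartingale of the original chain as soon as
    [nu U <= 1] ([block_exp_supermartingale]). A second-order expansion under [nu] decides this
    ([expR_block_bound], [block_exp_nu_le1]): the block sum has mean zero, and its second moment is
    the asymptotic variance times the mean block length, by Kac's formula. So it is enough that [a]
    slightly exceeds [theta ^ 2 * sigma2 / 2]. Since [U] lies between small powers of [u], Markov's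
    inequality yields Bernstein's bound with the factor [1 + eta] on the variance.

    An unbounded [g] is truncated where [ln u <= 4 log n]. The truncated function is of size
    [(log n) ^ s], and one more [log n] is lost in tuning the parameters ([tuning]). The removed
    values can sum to more than [v ^ (s + 1)] only if [u] is somewhere of order [exp v] or if there
    are more than [v] of them; both are exponentially unlikely in [v] ([remainder_tail]), which
    produces the exponent [alpha = 1 / (s + 1)]. [one_sided_large] combines these events; for [t]
    too small for the tuning the Bernstein term alone exceeds 1 ([two_sided_bound]).

    The block sum [h] of the centred [g] also solves the Poisson equation [h = g + P h]. The
    covariances therefore telescope, and a Hairer-Mattingly contraction ([weak_contraction]) makes
    the last term vanish, which identifies the limit variance with the constant found from the
    blocks ([asymptotic_variance_limit]). *)

(** * Elementary inequalities for the exponential *)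

Section exponential_bounds.
Context (R : realType).
Implicit Types (x y z : R).

(** From the third term on, the series is dominated by [|z| ^+ 3] times the whole exponential series
    at [|z|], because (3 + k)! is at least k!. *)
Lemma expR_le_taylor2 z :
  expR z <= 1 + z + z ^+ 2 / 2 + `|z| ^+ 3 * expR `|z|.
Proof.
rewrite {1}/expR; apply: limr_le; first exact: is_cvg_series_exp_coeff.
near=> n; have n3 : (3 <= n)%N by near: n; exact: nbhs_infty_ge.
rewrite /series/= (big_cat_nat (n := 3))//=.
apply: lerD.
  rewrite !big_nat_recr// big_nil/= /exp_coeff/=.
  by rewrite !factS fact0 !expr0 expr1; lra.
have h : series (exp_coeff `|z|) (n - 3)%N <= expR `|z|.
  rewrite /expR; apply: nondecreasing_cvgn_le.
    by apply: nondecreasing_series => k _ _; exact: exp_coeff_ge0.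
  exact: is_cvg_series_exp_coeff.
apply: le_trans (ler_wpM2l (exprn_ge0 3 (normr_ge0 z)) h).
rewrite /series/= mulr_sumr -{1}(add0n 3%N) big_addn.
apply: ler_sum_nat => k _ /=; rewrite /exp_coeff/=.
rewrite (le_trans (ler_norm _))// normrM normrX normfV normr_nat mulrA -exprD addnC.
rewrite ler_wpM2l ?exprn_ge0// lef_pV2 ?posrE ?ltr0n ?fact_gt0// ler_nat.
have : (k`! <= (3 + k)`!)%N by rewrite !factS !mulnA leq_pmull.
by [].
Unshelve. all: by end_near.
Qed.

Lemma sqr_le_expR y : 0 <= y -> y ^+ 2 <= 2 * expR y.
Proof.
move=> y0; have := expR_ge1Dxn 1 y0; rewrite !factS fact0; lra.
Qed.

Lemma cube_le_expR y : 0 <= y -> y ^+ 3 <= 6 * expR y.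
Proof.
move=> y0; have := expR_ge1Dxn 2 y0; rewrite !factS fact0; lra.
Qed.

(** Convexity on the segment from 0 to [y], read off from the tangent at [p * y] evaluated at both
    ends. *)
Lemma expRM_le_convex p y : 0 <= p <= 1 -> expR (p * y) <= 1 - p + p * expR y.
Proof.
move=> /andP[p0 p1].
have a0 := expR_ge0 (p * y).
have e1 := expR_ge1Dx (- (p * y)); have e2 := expR_ge1Dx (y - p * y).
have h1 : expR (p * y) * expR (- (p * y)) = 1 by rewrite -expRD subrr expR0.
have h2 : expR (p * y) * expR (y - p * y) = expR y.
  by rewrite -expRD addrC subrK.
have k1 : expR (p * y) * (1 - p * y) <= 1 by rewrite -[leRHS]h1 ler_wpM2l.
have k2 : expR (p * y) * (1 + (y - p * y)) <= expR y.
  by rewrite -[leRHS]h2 ler_wpM2l.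
have q1 : (1 - p) * (expR (p * y) * (1 - p * y)) <= 1 - p.
  by rewrite -[leRHS]mulr1 ler_wpM2l// subr_ge0.
have q2 : p * (expR (p * y) * (1 + (y - p * y))) <= p * expR y.
  by rewrite ler_wpM2l.
lra.
Qed.

Lemma scaled_sqr_le_expR c y : 0 < c -> 0 <= y ->
  y ^+ 2 <= 2 / c ^+ 2 * expR (c * y).
Proof.
move=> c0 y0; have := sqr_le_expR (mulr_ge0 (ltW c0) y0).
rewrite exprMn -ler_pdivlMl ?exprn_gt0// => /le_trans; apply.
by rewrite mulrC mulrAC.
Qed.

Lemma scaled_cube_le_expR c y : 0 < c -> 0 <= y ->
  y ^+ 3 <= 6 / c ^+ 3 * expR (c * y).
Proof.
move=> c0 y0; have := cube_le_expR (mulr_ge0 (ltW c0) y0).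
rewrite exprMn -ler_pdivlMl ?exprn_gt0// => /le_trans; apply.
by rewrite mulrC mulrAC.
Qed.

(** The one-block estimate behind Bernstein's inequality: [f] stands for the block sum, [t] for the
    block length and [tau] for a common size of both. The level [B] keeps the coefficient of
    [f ^+ 2] close to 1/2: for [tau <= B] the cubic Taylor remainder is a small multiple of the
    square, and for [tau > B] it is paid by the factor [expR (- (c * B / 2))] spared from
    [expR (c * tau)]. *)
Lemma expR_block_bound (theta a m c eps B tau f t : R) :
  0 < m -> 0 < c -> 0 <= theta -> theta * m <= eps -> 0 <= a -> a <= eps ->
  8 * eps <= c -> 0 <= t -> t <= tau -> `|f| <= m * tau -> 0 <= B ->
  expR (theta * f - a * t) <= 1 + theta * f - a * t +
    theta ^+ 2 * f ^+ 2 * (2^-1 + 4 * eps * B * expR (2 * eps * B)) +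
    (3 * a * eps / c ^+ 2 + 4 * (6 / (c / 4) ^+ 3) *
      (a * eps ^+ 2 + (theta * m) ^+ 2 * eps * expR (- (c * B / 2)))) *
    expR (c * tau).
Proof.
move=> m0 c0 th0 thm a0 ae epsc t0 ttau ftau B0.
have tau0 : 0 <= tau := le_trans t0 ttau.
have eps0 : 0 <= eps := le_trans a0 ae.
set z := theta * f - a * t.
have thf : `|theta * f| <= theta * m * tau.
  by rewrite normrM (ger0_norm th0) -mulrA ler_wpM2l.
have at_ : a * t <= a * tau by rewrite ler_wpM2l.
have at0 : 0 <= a * t by rewrite mulr_ge0.
have thf' : `|theta * f| <= eps * tau by rewrite (le_trans thf)// ler_wpM2r.
have atau : a * tau <= eps * tau by rewrite ler_wpM2r.
have z_le : `|z| <= 2 * eps * tau.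
  by rewrite (le_trans (ler_normB _ _))// (ger0_norm at0); lra.
have E0 := expR_ge0 (c * tau).
have tau2 := scaled_sqr_le_expR c0 tau0.
have tau3 : tau ^+ 3 <= 6 / (c / 4) ^+ 3 * expR (c / 4 * tau).
  by apply: scaled_cube_le_expR => //; rewrite divr_gt0.
have : 0 <= 6 / (c / 4) ^+ 3 by rewrite divr_ge0// exprn_ge0// divr_ge0// ltW.
move: (6 / (c / 4) ^+ 3) tau3 => k3 tau3 k3_ge0.
(* [tau ^+ 3 * expR (2 * eps * tau)] keeps a spare factor [expR (- c * tau / 2)] *)
have cube : tau ^+ 3 * expR (2 * eps * tau) <=
    k3 * expR (c * tau) * expR (- (c * tau / 2)).
  rewrite -[leRHS]mulrA -expRD.
  have -> : c * tau - c * tau / 2 = c / 4 * tau + c / 4 * tau by field.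
  rewrite expRD mulrA; apply: ler_pM => //; rewrite ?exprn_ge0// ?expR_ge0//.
  by rewrite ler_expR ler_wpM2r//; lra.
have cube1 : tau ^+ 3 * expR (2 * eps * tau) <= k3 * expR (c * tau).
  rewrite (le_trans cube)// ler_piMr//; last first.
    by rewrite expR_le1 oppr_le0 divr_ge0// mulr_ge0// ltW.
  by rewrite mulr_ge0.
pose X := theta * f; pose Y := a * t.
have X2 : theta ^+ 2 * f ^+ 2 = X ^+ 2 by rewrite /X; ring.
have XY : `|X * Y| <= eps * tau * (a * tau).
  by rewrite normrM (ger0_norm at0) ler_pM.
have YY : Y * Y <= eps * tau * (a * tau) by rewrite ler_pM// (le_trans at_).
(* The cross terms carry a factor [a], later of order [theta ^+ 2], so the coefficient 1 of [X ^+ 2]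
   is kept here. The cruder [z2'] is good enough inside the cubic term. *)
have z2 : z ^+ 2 <= X ^+ 2 + 3 * (a * eps * tau ^+ 2).
  have -> : z ^+ 2 = X ^+ 2 - 2 * (X * Y) + Y * Y by rewrite /z/X/Y; ring.
  have : a * eps * tau ^+ 2 = eps * tau * (a * tau) by ring.
  by move: XY; rewrite ler_norml; lra.
have z2' : z ^+ 2 <= 2 * X ^+ 2 + 2 * (a * eps * tau ^+ 2).
  have -> : z ^+ 2 = X ^+ 2 - 2 * (X * Y) + Y * Y by rewrite /z/X/Y; ring.
  have : a * eps * tau ^+ 2 = eps * tau * (a * tau) by ring.
  have : 0 <= (X + Y) ^+ 2 by rewrite sqr_ge0.
  by rewrite sqrrD; lra.
have G0 : 0 <= 2 * eps * tau * expR (2 * eps * tau).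
  by rewrite !mulr_ge0// expR_ge0.
have z3 : `|z| ^+ 3 * expR `|z| <= z ^+ 2 * (2 * eps * tau * expR (2 * eps * tau)).
  rewrite exprSr -normrX ger0_norm ?sqr_ge0// -mulrA ler_wpM2l ?sqr_ge0//.
  by rewrite ler_pM ?expR_ge0// ler_expR.
have z3' : `|z| ^+ 3 * expR `|z| <=
    (2 * X ^+ 2 + 2 * (a * eps * tau ^+ 2)) * (2 * eps * tau * expR (2 * eps * tau)).
  by rewrite (le_trans z3)// ler_wpM2r.
have ae2 : 4 * (a * eps ^+ 2) * (tau ^+ 3 * expR (2 * eps * tau)) <=
    4 * (a * eps ^+ 2) * (k3 * expR (c * tau)).
  by rewrite ler_wpM2l// !mulr_ge0// exprn_ge0.
have ae1 : 3 / 2 * (a * eps) * tau ^+ 2 <=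
    3 / 2 * (a * eps) * (2 / c ^+ 2 * expR (c * tau)).
  by rewrite ler_wpM2l// !mulr_ge0.
have e4 : 0 <= 4 * eps by rewrite mulr_ge0.
have X3 : X ^+ 2 * (4 * eps * tau * expR (2 * eps * tau)) <=
    X ^+ 2 * (4 * eps * B * expR (2 * eps * B)) +
    4 * eps * (theta * m) ^+ 2 *
    (k3 * expR (c * tau) * expR (- (c * B / 2))).
  have r0 : 0 <= 4 * eps * (theta * m) ^+ 2 *
    (k3 * expR (c * tau) * expR (- (c * B / 2))).
    exact: mulr_ge0 (mulr_ge0 e4 (sqr_ge0 _)) (mulr_ge0 (mulr_ge0 k3_ge0 E0) (expR_ge0 _)).
  have [tauB|/ltW Btau] := leP tau B.
    apply: ler_wpDr => //; rewrite ler_wpM2l ?sqr_ge0//.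
    apply: ler_pM; rewrite ?mulr_ge0 ?expR_ge0//.
      by rewrite ler_wpM2l// mulr_ge0.
    by rewrite ler_expR ler_wpM2l// mulr_ge0.
  apply: ler_wpDl; first exact: mulr_ge0 (sqr_ge0 _) (mulr_ge0 (mulr_ge0 e4 B0) (expR_ge0 _)).
  have X2t : X ^+ 2 <= (theta * m) ^+ 2 * tau ^+ 2.
    rewrite -exprMn -[leLHS]ger0_norm ?sqr_ge0// normrX ler_pXn2r// nnegrE//.
    by rewrite !mulr_ge0// ltW.
  apply: (@le_trans _ _ ((theta * m) ^+ 2 * tau ^+ 2 *
      (4 * eps * tau * expR (2 * eps * tau)))).
    by rewrite ler_wpM2r// !mulr_ge0// expR_ge0.
  have -> : (theta * m) ^+ 2 * tau ^+ 2 * (4 * eps * tau * expR (2 * eps * tau)) =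
    4 * eps * (theta * m) ^+ 2 * (tau ^+ 3 * expR (2 * eps * tau)) by ring.
  apply: ler_wpM2l; first exact: mulr_ge0 e4 (sqr_ge0 _).
  apply: le_trans cube _; apply: ler_wpM2l; first exact: mulr_ge0 k3_ge0 E0.
  by rewrite ler_expR lerN2 ler_wpM2r// ?ler_wpM2l// ltW.
apply: le_trans (expR_le_taylor2 z) _.
rewrite X2.
have -> : 1 + theta * f - a * t = 1 + z by rewrite /z addrA.
move: z2 z3' ae2 ae1 X3.
set E := expR (c * tau); set G := expR (2 * eps * tau).
set H := expR (2 * eps * B); set J := expR (- (c * B / 2)).
set c2 := (c ^+ 2)^-1; set c3 := (c ^+ 3)^-1; set N := `|z| ^+ 3 * _.
move=> z2 z3' ae2 ae1 X3.
lra.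
Qed.

End exponential_bounds.

(** * Integration of functions dominated by a weight *)

Section dominated_integration.
Context d (T : measurableType d) (R : realType).
Variable w : T -> R.
Hypothesis mw : measurable_fun [set: T] w.
Hypothesis w_ge1 : forall x, 1 <= w x.
Implicit Types (mu : {measure set T -> \bar R}) (f g : T -> R).

(** Against a measure that integrates [w] every such function is integrable, so that linearity and
    monotonicity of real-valued integrals come without further side conditions. *)
Definition dominated f :=
  measurable_fun [set: T] f /\ exists c, forall x, `|f x| <= c * w x.

Definition weighted mu := (\int[mu]_x (w x)%:E < +oo)%E.

Let w_ge0 x : 0 <= w x. Proof. exact: le_trans (w_ge1 x). Qed.

Lemma dominated_measurable f : dominated f -> measurable_fun [set: T] f.
Proof. by case. Qed.

Lemma dominated_bound f : dominated f ->
  exists2 c, 0 <= c & forall x, `|f x| <= c * w x.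
Proof.
move=> [_ [c hc]]; exists `|c| => // x.
by rewrite (le_trans (hc x))// ler_wpM2r// ler_norm.
Qed.

Lemma dominated_cst c : dominated (fun=> c).
Proof.
by split=> //; exists `|c| => x; rewrite ler_peMr.
Qed.

Lemma dominated_self : dominated w.
Proof. by split=> //; exists 1 => x; rewrite mul1r ger0_norm. Qed.

Lemma dominatedD f g : dominated f -> dominated g ->
  dominated (fun x => f x + g x).
Proof.
move=> [mf [a ha]] [mg [b hb]]; split; first exact: measurable_funD.
by exists (a + b) => x; rewrite mulrDl (le_trans (ler_normD _ _))// lerD.
Qed.

Lemma dominatedN f : dominated f -> dominated (fun x => - f x).
Proof.
move=> [mf [a ha]]; split; first exact: measurableT_comp.
by exists a => x; rewrite normrN.
Qed.

Lemma dominatedB f g : dominated f -> dominated g ->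
  dominated (fun x => f x - g x).
Proof. by move=> df dg; apply: dominatedD => //; exact: dominatedN. Qed.

Lemma dominatedZ c f : dominated f -> dominated (fun x => c * f x).
Proof.
move=> [mf [a ha]]; split; first exact: measurable_funM.
by exists (`|c| * a) => x; rewrite normrM -mulrA ler_wpM2l.
Qed.

Lemma le_dominated f g c : measurable_fun [set: T] f ->
  (forall x, `|f x| <= c * `|g x|) -> dominated g -> dominated f.
Proof.
move=> mf fg /[dup] /dominated_bound[a a0 ha] _; split=> //.
exists (`|c| * a) => x; rewrite (le_trans (fg x))// -mulrA.
by rewrite (le_trans (ler_wpM2r _ (ler_norm c)))// ler_wpM2l.
Qed.

Lemma dominated_norm f : dominated f -> dominated (fun x => `|f x|).
Proof.
move=> df; apply: (@le_dominated _ f 1) => //.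
  by apply: measurableT_comp => //; case: df.
by move=> x; rewrite mul1r normr_id.
Qed.

Lemma dominated_integrable mu f : weighted mu -> dominated f ->
  mu.-integrable [set: T] (EFin \o f).
Proof.
move=> wmu [mf [c hc]].
have iw : mu.-integrable [set: T] (EFin \o (fun x => c * w x)).
  have := @integrableZl _ _ _ mu _ measurableT c (EFin \o w).
  apply; apply/integrableP; split; first exact/measurable_EFinP.
  by under eq_integral => x _ do rewrite /= ger0_norm ?w_ge0//.
apply: le_integrable iw => //; first exact/measurable_EFinP.
by move=> x _ /=; rewrite lee_fin (le_trans (hc x))// ler_norm.
Qed.

Lemma dominated_EFin mu f : weighted mu -> dominated f ->
  (\int[mu]_x (f x)%:E = (\int[mu]_x f x)%:E)%E.
Proof.
by move=> wmu df; rewrite /Rintegral fineK// integrable_fin_num//;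
  exact: dominated_integrable.
Qed.

Lemma le_dominated_Rintegral mu f g : weighted mu -> dominated f ->
  dominated g -> (forall x, f x <= g x) -> \int[mu]_x f x <= \int[mu]_x g x.
Proof. by move=> wmu df dg fg; apply: le_Rintegral => //; exact: dominated_integrable. Qed.

Lemma dominated_RintegralD mu f g : weighted mu -> dominated f ->
  dominated g -> \int[mu]_x (f x + g x) = \int[mu]_x f x + \int[mu]_x g x.
Proof. by move=> wmu df dg; apply: RintegralD => //; exact: dominated_integrable. Qed.

Lemma dominated_RintegralB mu f g : weighted mu -> dominated f ->
  dominated g -> \int[mu]_x (f x - g x) = \int[mu]_x f x - \int[mu]_x g x.
Proof. by move=> wmu df dg; apply: RintegralB => //; exact: dominated_integrable. Qed.

Lemma dominated_RintegralZ mu c f : weighted mu -> dominated f ->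
  \int[mu]_x (c * f x) = c * \int[mu]_x f x.
Proof. by move=> wmu df; apply: RintegralZl => //; exact: dominated_integrable. Qed.

Lemma dominated_RintegralN mu f : weighted mu -> dominated f ->
  \int[mu]_x (- f x) = - \int[mu]_x f x.
Proof.
move=> wmu df; rewrite -[RHS]mulN1r -dominated_RintegralZ//.
by apply: eq_Rintegral => x _; rewrite mulN1r.
Qed.

Lemma dominated_Rintegral_norm mu f : weighted mu -> dominated f ->
  `|\int[mu]_x f x| <= \int[mu]_x `|f x|.
Proof. by move=> wmu df; apply: le_normr_Rintegral => //; exact: dominated_integrable. Qed.

Lemma dominated_Rintegral_le mu f c : weighted mu -> measurable_fun [set: T] f ->
  (forall x, `|f x| <= c * w x) -> `|\int[mu]_x f x| <= c * \int[mu]_x w x.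
Proof.
move=> wmu mf fc; have df : dominated f by split=> //; exists c.
rewrite (le_trans (dominated_Rintegral_norm wmu df))//.
rewrite -dominated_RintegralZ//; last exact: dominated_self.
apply: le_dominated_Rintegral => //; first exact: dominated_norm.
by apply: dominatedZ; exact: dominated_self.
Qed.

End dominated_integration.

(** * Mixtures of kernels: from sets to functions *)

Section kernel_mixture.
Context d d' (T : measurableType d) (Omega : measurableType d') (R : realType).
Implicit Types (m : {measure set Omega -> \bar R}) (F : Omega -> R).
Import HBNNSimple.

Lemma ge0_mixture_nnsfun m (k : Omega -> {measure set T -> \bar R}) F
    (f : {nnsfun T >-> R}) :
  (forall A, measurable A -> measurable_fun [set: Omega] (k ^~ A)) ->
  measurable_fun [set: Omega] F -> (forall w, 0 <= F w) ->
  (\int[m]_w ((F w)%:E * \int[k w]_y (f y)%:E) =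
   \sum_(r \in range f) r%:E * \int[m]_w ((F w)%:E * k w (f @^-1` [set r])))%E.
Proof.
move=> mk mF F0.
transitivity (\int[m]_w (\sum_(r \in range f)
    (r%:E * ((F w)%:E * k w (f @^-1` [set r])))))%E.
  apply: eq_integral => w _.
  rewrite integralT_nnsfun sintegralE ge0_mule_fsumr//; last first.
    by move=> r; exact: nnsfun_mulemu_ge0.
  by apply: eq_fsbigr => r _; rewrite muleCA.
rewrite ge0_integral_fsum//.
- apply: eq_fsbigr => r /[!inE] -[x _ <-].
  rewrite ge0_integralZl//.
  + by apply: emeasurable_funM; [exact/measurable_EFinP|exact: mk].
  + by move=> w _; apply: mule_ge0; rewrite ?lee_fin.
  + by rewrite lee_fin.
- by move=> r; apply: emeasurable_funM => //; apply: emeasurable_funM; [exact/measurable_EFinP|exact: mk].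
- move=> r w _; rewrite muleCA; apply: mule_ge0; rewrite ?lee_fin//.
  exact: nnsfun_mulemu_ge0.
Qed.

(** Equality on sets passes to simple functions by linearity and to nonnegative functions by
    monotone convergence. Applied to Dirac kernels, it replaces an indicator of one coordinate by a
    function of that coordinate. *)
Lemma ge0_mixture_eq m (k1 k2 : Omega -> {measure set T -> \bar R})
    (F1 F2 : Omega -> R) :
  (forall A, measurable A -> measurable_fun [set: Omega] (k1 ^~ A)) ->
  (forall A, measurable A -> measurable_fun [set: Omega] (k2 ^~ A)) ->
  measurable_fun [set: Omega] F1 -> (forall w, 0 <= F1 w) ->
  measurable_fun [set: Omega] F2 -> (forall w, 0 <= F2 w) ->
  (forall A, measurable A ->
    \int[m]_w ((F1 w)%:E * k1 w A) = \int[m]_w ((F2 w)%:E * k2 w A))%E ->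
  forall h : T -> R, measurable_fun [set: T] h -> (forall x, 0 <= h x) ->
  (\int[m]_w ((F1 w)%:E * \int[k1 w]_y (h y)%:E) =
   \int[m]_w ((F2 w)%:E * \int[k2 w]_y (h y)%:E))%E.
Proof.
move=> mk1 mk2 mF1 F10 mF2 F20 e h mh h0.
have mEh : measurable_fun [set: T] (EFin \o h) by exact/measurable_EFinP.
pose f_ := nnsfun_approx measurableT mEh.
have approx (k : Omega -> {measure set T -> \bar R}) (F : Omega -> R) :
  (forall A, measurable A -> measurable_fun [set: Omega] (k ^~ A)) ->
  measurable_fun [set: Omega] F -> (forall w, 0 <= F w) ->
  (\int[m]_w ((F w)%:E * \int[k w]_y (h y)%:E) =
   limn (fun n => \int[m]_w ((F w)%:E * \int[k w]_y (f_ n y)%:E)))%E.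
  move=> mk mF F0.
  have mI n : measurable_fun [set: Omega] (fun w => \int[k w]_y (f_ n y)%:E)%E.
    apply: measurable_fun_integral_kernel => //.
      by move=> z; rewrite lee_fin.
    exact/measurable_EFinP.
  have ndI w : nondecreasing_seq (fun n => (\int[k w]_y (f_ n y)%:E)%E).
    move=> a b ab; apply: ge0_le_integral => //.
    - by move=> z _; rewrite lee_fin.
    - exact/measurable_EFinP.
    - exact/measurable_EFinP.
    - by move=> z _; rewrite lee_fin; exact/lefP/nd_nnsfun_approx.
  have I0 n w : (0 <= \int[k w]_y (f_ n y)%:E)%E.
    by apply: integral_ge0 => z _; rewrite lee_fin.
  rewrite -monotone_convergence//.
  - apply: eq_integral => w _; apply/esym/cvg_lim => //.
    apply: cvgeZl => //.
    have -> : (\int[k w]_y (h y)%:E = \int[k w]_y (limn (fun n => (f_ n y)%:E)))%E.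
      apply: eq_integral => y _; apply/esym/cvg_lim => //.
      by apply: cvg_nnsfun_approx => // x _; rewrite lee_fin.
    apply: cvg_monotone_convergence => //.
    - by move=> n; exact/measurable_EFinP.
    - by move=> n z _; rewrite lee_fin.
    - by move=> z _ a b ab; rewrite lee_fin; exact/lefP/nd_nnsfun_approx.
  - by move=> n; apply: emeasurable_funM => //; exact/measurable_EFinP.
  - by move=> n w _; apply: mule_ge0; rewrite ?lee_fin.
  - by move=> w _ a b ab; apply: lee_wpmul2l; rewrite ?lee_fin//; exact: ndI.
have e_ n : (\int[m]_w ((F1 w)%:E * \int[k1 w]_y (f_ n y)%:E) =
    \int[m]_w ((F2 w)%:E * \int[k2 w]_y (f_ n y)%:E))%E.
  rewrite !ge0_mixture_nnsfun//.
  by apply: eq_fsbigr => r _; rewrite e.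
have E := funext e_.
have a1 := approx k1 F1 mk1 mF1 F10; have a2 := approx k2 F2 mk2 mF2 F20.
by etransitivity; [exact: a1|rewrite E; exact: esym a2].
Qed.

End kernel_mixture.

(** * Expectations along a Markov chain *)

Section chain_expectations.
Context d dO (T : measurableType d) (Omega : measurableType dO) (R : realType).
Variables (P : R.-pker T ~> T) (mu : probability T R)
  (Q : probability Omega R) (X : nat -> Omega -> T).
Hypothesis chain : markov_chain P mu Q X.

Let mX n : measurable_fun [set: Omega] (X n).
Proof. by case: chain. Qed.

Lemma chain_initial (h : T -> R) : measurable_fun [set: T] h ->
  (forall x, 0 <= h x) ->
  (\int[Q]_w (h (X 0%N w))%:E = \int[mu]_x (h x)%:E)%E.
Proof.
move=> mh h0; have [_ X0 _] := chain.
transitivity (\int[pushforward Q (X 0%N)]_x (h x)%:E)%E.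
  rewrite ge0_integral_pushforward//; first exact/measurable_EFinP.
  by move=> x _; rewrite lee_fin.
by apply: eq_measure_integral => A mA _; exact: X0.
Qed.

Definition path_product (f : nat -> T -> R) n (w : Omega) : R :=
  \prod_(i < n) f i (X i w).

Lemma path_product_ge0 f n w : (forall i x, 0 <= f i x) ->
  0 <= path_product f n w.
Proof. by move=> f0; apply: prodr_ge0. Qed.

Lemma measurable_path_product f n : (forall i, measurable_fun [set: T] (f i)) ->
  measurable_fun [set: Omega] (path_product f n).
Proof.
by move=> mf; apply: measurable_prod => i _; apply: measurableT_comp.
Qed.

(** The Markov property is postulated on cylinders only. [ge0_mixture_eq] first reduces [h] to an
    indicator; the factors [f i] are then freed one at a time, the induction on [j] assuming that
    those with index at least [j] are indicators. *)
Lemma chain_step (f : nat -> T -> R) (h : T -> R) n :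
  (forall i, measurable_fun [set: T] (f i)) -> (forall i x, 0 <= f i x) ->
  measurable_fun [set: T] h -> (forall x, 0 <= h x) ->
  (\int[Q]_w (path_product f n.+1 w * h (X n.+1 w))%:E =
   \int[Q]_w ((path_product f n.+1 w)%:E * \int[P (X n w)]_y (h y)%:E))%E.
Proof.
have [_ _ step] := chain.
have mk i A : measurable A ->
    measurable_fun [set: Omega] (fun w => \d_(X i w) A : \bar R).
  move=> mA; have := measurable_kernel (kdirac (R := R) (mX i)) A mA.
  exact.
have mP A : measurable A -> measurable_fun [set: Omega] (fun w => P (X n w) A).
  by move=> mA; exact: (measurableT_comp (measurable_kernel P A mA)).
move=> mf f0 mh h0.
suff main j : (j <= n.+1)%N -> forall f : nat -> T -> R,
    (forall i, measurable_fun [set: T] (f i)) -> (forall i x, 0 <= f i x) ->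
    (forall i, (j <= i < n.+1)%N -> exists2 A, measurable A & f i = \1_A) ->
    forall B, measurable B ->
    (\int[Q]_w ((path_product f n.+1 w)%:E * \d_(X n.+1 w) B) =
     \int[Q]_w ((path_product f n.+1 w)%:E * P (X n w) B))%E.
  rewrite -(@ge0_mixture_eq _ _ T Omega R Q (fun w => \d_(X n.+1 w))
    (fun w => P (X n w)) (path_product f n.+1) (path_product f n.+1) (mk _) mP
    (measurable_path_product _ mf) (fun w => path_product_ge0 _ w f0)
    (measurable_path_product _ mf) (fun w => path_product_ge0 _ w f0))//.
    apply: eq_integral => w _; rewrite EFinM integral_dirac//; last first.
      exact/measurable_EFinP.
    by rewrite diracT mul1e.
  apply: (main n.+1) => // i.
  by rewrite ltnS leqNgt andNb.
elim: j => [_|j IH jn] {mf f0} {}f mf f0 fj B mB.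
  have /choice[A hA] : forall i, exists A,
      measurable A /\ ((i < n.+1)%N -> f i = \1_A).
    move=> i; have [i_n|i_n] := boolP (i < n.+1)%N; last by exists setT.
    by have [|A mA fA] := fj i; [rewrite i_n|exists A].
  have pE w : path_product f n.+1 w =
      \1_(\bigcap_(i in `I_n.+1) X i @^-1` A i) w.
    rewrite indicE; case: (boolP (w \in _)) => [|]; rewrite ?inE ?notin_setE/=.
      move=> wA; apply: big1 => i _; have [_ ->//] := hA i.
      by rewrite indicE mem_set//; apply: wA => /=.
    move=> nwA; have [i i_n iA] : exists2 i, (i < n.+1)%N & ~ A i (X i w).
      apply: contrapT => k; apply: nwA => i /= i_n; apply: contrapT => iA.
      by apply: k; exists i.
    rewrite /path_product (bigD1 (Ordinal i_n))//=.
    by have [_ ->//] := hA i; rewrite indicE memNset// mul0r.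
  have mpast : measurable (\bigcap_(i in `I_n.+1) X i @^-1` A i).
    apply: bigcap_measurable; first by exists 0%N.
    move=> i _; rewrite -[X in measurable X]setTI; apply: mX => //.
    by case: (hA i).
  have mAi i : measurable (A i) by case: (hA i).
  have := step n A B mAi mB => /= stepB.
  under eq_integral do rewrite pE.
  under [RHS]eq_integral do rewrite pE.
  rewrite [RHS](_ : _ = \int[Q]_(w in \bigcap_(i in `I_n.+1) X i @^-1` A i)
      P (X n w) B)%E; last first.
    rewrite [RHS]integral_mkcond; apply: eq_integral => w _.
    rewrite epatch_indic/=.
    by rewrite muleC.
  set past := \bigcap_(i in _) _ in mpast stepB *.
  have mE : measurable (past `&` X n.+1 @^-1` B).
    by apply: measurableI => //; rewrite -[X in measurable X]setTI; apply: mX.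
  rewrite -stepB -(setIT (past `&` X n.+1 @^-1` B)) -integral_indic//.
  apply: eq_integral => w _.
  by rewrite indicI EFinM /dirac/= !indicE.
(* [g] collects all factors but the one of index [j], which is integrated against the Dirac mass at
   [X j]. Testing this identity on a set [A] in place of [f j] falls under the induction
   hypothesis. *)
pose g w := \prod_(i < n.+1 | i != Ordinal jn) f i (X i w).
have gE w : path_product f n.+1 w = g w * f j (X j w).
  by rewrite /path_product (bigD1 (Ordinal jn))//= mulrC.
have g0 w : 0 <= g w by apply: prodr_ge0.
have mg : measurable_fun [set: Omega] g.
  rewrite /g; under eq_fun do rewrite big_mkcond/=.
  apply: measurable_prod => i _; case: (i != _) => //=.
  exact: (measurableT_comp (mf i) (mX i)).
have PB x : P x B \is a fin_num.
  rewrite ge0_fin_numE//; apply: (@le_lt_trans _ _ (P x setT)).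
    by apply: le_measure; rewrite ?inE.
  by rewrite prob_kernel ltry.
pose G1 w : R := g w * \1_B (X n.+1 w).
pose G2 w : R := g w * fine (P (X n w) B).
have mG1 : measurable_fun [set: Omega] G1.
  by apply: measurable_funM => //; exact: (measurableT_comp _ (mX _)).
have mG2 : measurable_fun [set: Omega] G2.
  by apply: measurable_funM => //; apply: measurableT_comp => //; exact: mP.
have G10 w : 0 <= G1 w by rewrite mulr_ge0.
have G20 w : 0 <= G2 w by rewrite mulr_ge0// fine_ge0.
have dE (Y : Omega -> T) F w : measurable_fun [set: Omega] Y ->
   ((F w)%:E * \int[\d_(Y w)]_y (f j y)%:E = (F w * f j (Y w))%:E)%E.
  move=> mY; rewrite integral_dirac//; last exact/measurable_EFinP.
  by rewrite diracT mul1e.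
have := @ge0_mixture_eq _ _ T Omega R Q (fun w => \d_(X j w))
    (fun w => \d_(X j w)) G1 G2 (mk _) (mk _) mG1 G10 mG2 G20.
move=> /(_ _ (f j) (mf j) (f0 j)) key.
transitivity (\int[Q]_w ((G1 w)%:E * \int[\d_(X j w)]_y (f j y)%:E))%E.
  apply: eq_integral => w _.
  by rewrite dE// gE /dirac -EFinM; congr EFin; rewrite /G1 mulrAC.
rewrite key.
  apply: eq_integral => w _.
  by rewrite dE// gE -(fineK (PB (X n w))) -EFinM; congr EFin; rewrite /G2 mulrAC.
move=> A mA.
pose f' i := if i == j then \1_A else f i.
have := IH (ltnW jn) f' => /(_ _ _ _ B mB).
have f'E w : path_product f' n.+1 w = g w * \1_A (X j w).
  rewrite /path_product (bigD1 (Ordinal jn))//= mulrC /f' eqxx; congr (_ * _).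
  by apply: eq_bigr => i /negPf; rewrite -val_eqE/= => ->.
have f'1 i : measurable_fun [set: T] (f' i) by rewrite /f'; case: ifP.
have f'2 i x : 0 <= f' i x by rewrite /f'; case: ifP.
have f'3 i : (j <= i < n.+1)%N -> exists2 A, measurable A & f' i = \1_A.
  rewrite /f' leq_eqVlt eq_sym; case: eqP => /= [_ _|_ ij]; first by exists A.
  exact: fj.
move=> /(_ f'1 f'2 f'3) e.
transitivity (\int[Q]_w ((path_product f' n.+1 w)%:E * \d_(X n.+1 w) B))%E.
  apply: eq_integral => w _; rewrite f'E /dirac -!EFinM; congr EFin.
  by rewrite /G1 mulrAC.
rewrite e; apply: eq_integral => w _.
rewrite f'E -(fineK (PB (X n w))) /dirac -!EFinM; congr EFin.
by rewrite /G2 mulrAC.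
Qed.

(** Each step replaces [W (X n.+1)] by its conditional mean, which the hypothesis absorbs.
    Everything is a nonnegative extended real, so the right-hand side may be infinite. *)
Lemma chain_supermartingale (f W : T -> R) :
  measurable_fun [set: T] f -> measurable_fun [set: T] W ->
  (forall x, 0 <= W x) ->
  (forall x, (expR (f x))%:E * \int[P x]_y (W y)%:E <= (W x)%:E)%E ->
  forall n, (\int[Q]_w (expR (\sum_(0 <= i < n) f (X i w)) * W (X n w))%:E
    <= \int[mu]_x (W x)%:E)%E.
Proof.
move=> mf mW W0 fW; elim=> [|n IH].
  rewrite -chain_initial//.
  by under eq_integral do rewrite big_nil expR0 mul1r.
have mef : measurable_fun [set: T] (expR \o f) by exact: measurableT_comp.
have prodE m w : expR (\sum_(0 <= i < m) f (X i w)) =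
    path_product (fun=> expR \o f) m w.
  by rewrite /path_product big_mkord expR_sum.
under eq_integral do rewrite prodE.
rewrite chain_step//; last by move=> _ x; exact: expR_ge0.
apply: le_trans IH; apply: ge0_le_integral => //.
- move=> w _; apply: mule_ge0; first by rewrite lee_fin path_product_ge0// => *; exact: expR_ge0.
  by apply: integral_ge0 => y _; rewrite lee_fin.
- apply: emeasurable_funM; first by apply/measurable_EFinP; exact: measurable_path_product.
  pose k (w : Omega) : {measure set T -> \bar R} := P (X n w).
  apply: (@measurable_fun_integral_kernel _ _ Omega T R k _ (EFin \o W)).
  + by move=> A mA; exact: (measurableT_comp (measurable_kernel P A mA)).
  + by move=> z; rewrite lee_fin.
  + exact/measurable_EFinP.
- apply/measurable_EFinP; apply: measurable_funM; last exact: measurableT_comp.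
  by under eq_fun do rewrite prodE; exact: measurable_path_product.
- move=> w _; rewrite -prodE big_nat_recr//= expRD EFinM -muleA.
  by rewrite EFinM; apply: lee_wpmul2l; rewrite ?lee_fin ?expR_ge0.
Qed.

End chain_expectations.

(** * Precomposition of kernels with a measurable map *)

(** The measurability proof is an argument so that the kernel structure can be inferred from the
    term alone. *)
Definition kprecomp d d' d'' (X : measurableType d) (Y : measurableType d')
  (Z : measurableType d'') (R : realType) (f : X -> Y)
  (_ : measurable_fun [set: X] f)
  (k : Y -> {measure set Z -> \bar R}) (x : X) : {measure set Z -> \bar R} :=
  k (f x).

Section kernel_precomposition.
Context d d' d'' (X : measurableType d) (Y : measurableType d')
  (Z : measurableType d'') (R : realType) (f : X -> Y).
Hypothesis mf : measurable_fun [set: X] f.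
Variable k : R.-ker Y ~> Z.

Let measurable_kprecomp A : measurable A ->
  measurable_fun [set: X] (kprecomp mf k ^~ A).
Proof. by move=> mA; exact: (measurableT_comp (measurable_kernel k A mA) mf). Qed.

HB.instance Definition _ :=
  isKernel.Build _ _ _ _ _ (kprecomp mf k) measurable_kprecomp.
End kernel_precomposition.

(* Kept apart because the canonical instance for finite kernels would shadow
   the one for s-finite kernels. *)
Module PrecompFinite.
Section kernel_precomposition_finite.
Context d d' d'' (X : measurableType d) (Y : measurableType d')
  (Z : measurableType d'') (R : realType) (f : X -> Y).
Hypothesis mf : measurable_fun [set: X] f.
Variable k : R.-fker Y ~> Z.

Let kprecomp_uub : measure_fam_uub (kprecomp mf k).
Proof. by have [r kr] := measure_uub k; exists r => x; exact: kr. Qed.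

HB.instance Definition _ :=
  Kernel_isFinite.Build _ _ _ _ R (kprecomp mf k) kprecomp_uub.

Definition fkprecomp : R.-fker X ~> Z := kprecomp mf k.
End kernel_precomposition_finite.
End PrecompFinite.

Section kernel_precomposition_sfinite.
Context d d' d'' (X : measurableType d) (Y : measurableType d')
  (Z : measurableType d'') (R : realType) (f : X -> Y).
Hypothesis mf : measurable_fun [set: X] f.
Variable k : R.-sfker Y ~> Z.

Let kprecomp_sfinite : exists s : (R.-fker X ~> Z)^nat,
  forall x A, measurable A -> kprecomp mf k x A = kseries s x A.
Proof.
have [s ks] := sfinite_kernel k.
by exists (fun n => PrecompFinite.fkprecomp mf (s n)) => x A mA;
  rewrite /kprecomp ks.
Qed.

HB.instance Definition _ :=
  Kernel_isSFinite.Build _ _ _ _ R (kprecomp mf k) kprecomp_sfinite.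
End kernel_precomposition_sfinite.

Lemma nneseries_S (R : realType) (u : (\bar R)^nat) : (forall n, 0 <= u n)%E ->
  (\sum_(1 <= n <oo) u n = \sum_(n <oo) u n.+1)%E.
Proof.
move=> u0; apply/cvg_lim => //.
rewrite -(cvg_shiftS (fun n => \sum_(1 <= k < n) u k)%E).
under eq_fun do rewrite big_add1.
exact: is_cvg_nneseries.
Qed.

(** * Splitting of the kernel and law of a regeneration block *)

Section splitting.
Context d (T : measurableType d) (R : realType).
Variables (P : R.-pker T ~> T) (nu : probability T R) (C : set T) (delta : R).
Hypotheses (mC : measurable C) (delta_ge0 : 0 <= delta)
  (small : small_set P C nu delta).

Let c x : R := delta * \1_C x.

Let c_ge0 x : 0 <= c x. Proof. by rewrite mulr_ge0. Qed.

Let mc : measurable_fun [set: T] c.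
Proof. by apply: measurable_funM. Qed.

(** The part of a transition after which the chain has forgotten its past. The proof that [C] is
    measurable belongs to the term so that the kernel structure can be inferred. *)
Definition regeneration (_ : measurable C) (x : T) : {measure set T -> \bar R} :=
  mscale (NngNum (c_ge0 x)) nu.

Let regenerationE x A : regeneration mC x A = ((c x)%:E * nu A)%E.
Proof. by []. Qed.

Let measurable_regeneration A : measurable A ->
  measurable_fun [set: T] (regeneration mC ^~ A).
Proof.
move=> mA; change (measurable_fun [set: T] (fun x => (c x)%:E * nu A)%E).
by apply: emeasurable_funM => //; exact/measurable_EFinP.
Qed.

HB.instance Definition _ :=
  isKernel.Build _ _ _ _ _ (regeneration mC) measurable_regeneration.

Let regeneration_uub : measure_fam_uub (regeneration mC).
Proof.
exists (delta + 1) => x; rewrite regenerationE probability_setT mule1 lte_fin.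
rewrite (@le_lt_trans _ _ delta)// ?ltrDl//.
by rewrite /c ler_piMr// indicE; case: (_ \in _).
Qed.

HB.instance Definition _ :=
  Kernel_isFinite.Build _ _ _ _ R (regeneration mC) regeneration_uub.

(* A measure has to be nonnegative on all sets, measurable or not, whereas the
   minorization is only available on measurable ones. *)
Definition residual_fun (x : T) (A : set T) : \bar R :=
  if pselect (measurable A) then (P x A - regeneration mC x A)%E else 0%E.

Let residual_funE x A : measurable A ->
  residual_fun x A = (P x A - regeneration mC x A)%E.
Proof. by rewrite /residual_fun; case: pselect. Qed.

Let le_regeneration x A : measurable A -> (regeneration mC x A <= P x A)%E.
Proof.
move=> mA; rewrite regenerationE /c indicE.
case: (boolP (x \in C)) => xC; last by rewrite mulr0 mul0e.
by rewrite mulr1; apply: small => //; rewrite inE in xC.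
Qed.

Let regeneration_fin x A : measurable A -> regeneration mC x A \is a fin_num.
Proof. by move=> mA; rewrite regenerationE fin_numM// fin_num_measure. Qed.

Let residual_fun0 x : residual_fun x set0 = 0%E.
Proof. by rewrite residual_funE// !measure0 sube0. Qed.

Let residual_fun_ge0 x A : (0 <= residual_fun x A)%E.
Proof.
rewrite /residual_fun; case: pselect => // mA.
by rewrite sube_ge0 ?le_regeneration// regeneration_fin.
Qed.

Let residual_fun_sigma_additive x : semi_sigma_additive (residual_fun x).
Proof.
move=> F mF tF mUF; rewrite residual_funE//.
rewrite (_ : (fun n => _) = (fun n => \sum_(0 <= i < n) P x (F i) -
   \sum_(0 <= i < n) regeneration mC x (F i)))%E; last first.
  apply/funext => n; under eq_bigr do rewrite residual_funE//.
  elim: n => [|n IH]; first by rewrite !big_nil sube0.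
  rewrite !big_nat_recr//= IH fin_num_oppeD ?regeneration_fin// addeACA//.
apply: cvgeB.
- by rewrite fin_num_adde_defl// fin_numN regeneration_fin.
- exact: measure_semi_sigma_additive.
- exact: measure_semi_sigma_additive.
Qed.

HB.instance Definition _ x := isMeasure.Build _ _ _
  (residual_fun x) (residual_fun0 x) (residual_fun_ge0 x)
  (@residual_fun_sigma_additive x).

Definition residual (x : T) : {measure set T -> \bar R} := residual_fun x.

Let measurable_residual A : measurable A ->
  measurable_fun [set: T] (residual ^~ A).
Proof.
move=> mA.
have -> : residual ^~ A = (fun x => P x A - regeneration mC x A)%E.
  by apply/funext => x; exact: residual_funE.
apply: emeasurable_funB; first exact: measurable_kernel.
exact: (measurable_kernel (regeneration mC)).
Qed.

HB.instance Definition _ :=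
  isKernel.Build _ _ _ _ _ residual measurable_residual.

Lemma residualT x : residual x [set: T] = (1 - c x)%:E.
Proof.
rewrite /residual/= residual_funE// prob_kernel regenerationE.
by rewrite probability_setT mule1 EFinB.
Qed.

Let residual_uub : measure_fam_uub residual.
Proof.
exists 2 => x; rewrite residualT lte_fin.
by rewrite (@le_lt_trans _ _ 1)// ?gerBl ?ltr1n.
Qed.

HB.instance Definition _ :=
  Kernel_isFinite.Build _ _ _ _ R residual residual_uub.

(** Nummelin's splitting at the level of kernels: a transition either regenerates from [nu] or
    follows the residual kernel. *)
Lemma ge0_integral_splitting (f : T -> \bar R) x :
  measurable_fun [set: T] f -> (forall y, 0 <= f y)%E ->
  (\int[P x]_y f y = \int[residual x]_y f y + (delta * \1_C x)%:E * \int[nu]_y f y)%E.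
Proof.
move=> mf f0.
transitivity (\int[measure_add (residual x) (regeneration mC x)]_y f y)%E.
  apply: eq_measure_integral => A mA _.
  transitivity (measure_add (residual x) (regeneration mC x) A); last by [].
  rewrite measure_addE/= residual_funE// subeK//.
  exact: regeneration_fin.
rewrite ge0_integral_measure_add//; congr (_ + _)%E.
by rewrite ge0_integral_mscale.
Qed.

Lemma ge0_integral_regeneration (f : T -> \bar R) x :
  measurable_fun [set: T] f -> (forall y, 0 <= f y)%E ->
  (\int[regeneration mC x]_y f y = (delta * \1_C x)%:E * \int[nu]_y f y)%E.
Proof. by move=> mf f0; rewrite ge0_integral_mscale. Qed.

Section block_law.
Variable g : T -> R.
Hypothesis mg : measurable_fun [set: T] g.

Let block_start (xy : T * T) : R * nat := (g xy.1, 1%N).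

Let measurable_block_start : measurable_fun [set: T * T] block_start.
Proof.
by apply: measurable_fun_pair => //; exact: (measurableT_comp mg measurable_fst).
Qed.

Let block_shift (z : (T * T) * (R * nat)) : R * nat :=
  (z.2.1 + g z.1.1, z.2.2.+1).

Let measurable_block_shift : measurable_fun [set: (T * T) * (R * nat)] block_shift.
Proof.
have m11 : measurable_fun [set: (T * T) * (R * nat)] (fun z => z.1.1).
  exact: (measurableT_comp measurable_fst measurable_fst).
have m21 : measurable_fun [set: (T * T) * (R * nat)] (fun z => z.2.1).
  exact: (measurableT_comp measurable_fst measurable_snd).
have m22 : measurable_fun [set: (T * T) * (R * nat)] (fun z => z.2.2).
  exact: (measurableT_comp measurable_snd measurable_snd).
apply: measurable_fun_pair.
  by apply: measurable_funD => //; exact: (measurableT_comp mg m11).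
have mS : measurable_fun [set: nat] S by [].
exact: (measurableT_comp mS m22).
Qed.

Definition block_first : R.-sfker T ~> (R * nat)%type :=
  (regeneration mC \; kdirac measurable_block_start)%E.

Definition block_shifted (L : R.-sfker T ~> (R * nat)%type) :
    R.-sfker (T * T)%type ~> (R * nat)%type :=
  (kprecomp measurable_snd L \; kdirac measurable_block_shift)%E.

Definition block_next (L : R.-sfker T ~> (R * nat)%type) :
    R.-sfker T ~> (R * nat)%type :=
  (residual \; block_shifted L)%E.

(** The part of the law carried by blocks of length [n.+1]: [n] residual steps followed by a
    regeneration. *)
Fixpoint block_law_rec n : R.-sfker T ~> (R * nat)%type :=
  if n is n'.+1 then block_next (block_law_rec n') else block_first.

(* [block_law x] is the joint law of the sum of [g] over the first regeneration
   block of the split chain started at [x], and of the length of this block. *)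
Definition block_law : R.-sfker T ~> (R * nat)%type := kseries block_law_rec.

Implicit Types (f : R * nat -> \bar R).

Lemma ge0_integral_block_first f x :
  measurable_fun [set: R * nat] f -> (forall z, 0 <= f z)%E ->
  (\int[block_first x]_z f z = (delta * \1_C x)%:E * f (g x, 1%N))%E.
Proof.
move=> mf f0; rewrite integral_kcomp//.
transitivity (\int[regeneration mC x]_y cst (f (g x, 1%N)) y)%E.
  by apply: eq_integral => y _; rewrite integral_dirac// diracT mul1e.
rewrite ge0_integral_regeneration//; last by move=> y; exact: f0.
rewrite integral_cst//.
rewrite -[in RHS](mule1 (f _)); congr (_ * (_ * _))%E.
exact: (probability_setT nu).
Qed.

Lemma ge0_integral_block_next L f x :
  measurable_fun [set: R * nat] f -> (forall z, 0 <= f z)%E ->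
  (\int[block_next L x]_z f z =
   \int[residual x]_y \int[L y]_z f (z.1 + g x, z.2.+1)%R)%E.
Proof.
move=> mf f0; rewrite integral_kcomp//; apply: eq_integral => y _.
rewrite integral_kcomp//; apply: eq_integral => z _.
by rewrite integral_dirac// diracT mul1e.
Qed.


Lemma measurable_block_shifted f x : measurable_fun [set: R * nat] f ->
  measurable_fun [set: R * nat] (fun z => f (z.1 + g x, z.2.+1)).
Proof.
move=> mf; apply: (measurableT_comp mf); apply: measurable_fun_pair.
  by apply: measurable_funD => //; exact: measurable_fst.
by apply: (measurableT_comp (_ : measurable_fun [set: nat] S)) => //; exact: measurable_snd.
Qed.

Lemma measurable_integral_sfinite (K : R.-sfker T ~> (R * nat)%type) f :
  measurable_fun [set: R * nat] f -> (forall z, 0 <= f z)%E ->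
  measurable_fun [set: T] (fun y => \int[K y]_z f z)%E.
Proof.
move=> mf f0; apply: measurable_fun_integral_kernel => //.
exact: measurable_kernel.
Qed.

(** First-step analysis: a regeneration closes the block after one step, and otherwise this step is
    prefixed to a block started at the next state. *)
Lemma ge0_integral_block_law f x :
  measurable_fun [set: R * nat] f -> (forall z, 0 <= f z)%E ->
  (\int[block_law x]_z f z = (delta * \1_C x)%:E * f (g x, 1%N) +
   \int[residual x]_y \int[block_law y]_z f (z.1 + g x, z.2.+1)%R)%E.
Proof.
move=> mf f0; have mf' := measurable_block_shifted x mf.
rewrite integral_kseries// nneseries_recl//; last first.
  by move=> n _; exact: integral_ge0.
congr (_ + _)%E; first exact: ge0_integral_block_first.
transitivity (\sum_(0 <= n <oo)
    \int[residual x]_y \int[block_law_rec n y]_z f (z.1 + g x, z.2.+1)%R)%E.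
  rewrite nneseries_S//; last by move=> n; exact: integral_ge0.
  by apply: eq_eseriesr => n _; rewrite -ge0_integral_block_next.
rewrite -integral_nneseries//.
- by apply: eq_integral => y _; rewrite integral_kseries.
- by move=> n; exact: measurable_integral_sfinite.
- by move=> n y _; exact: integral_ge0.
Qed.

(* [block_law] is the least solution of its first-step equation. *)
Lemma ge0_integral_block_law_le f (F : T -> R -> nat -> \bar R) :
  measurable_fun [set: R * nat] f -> (forall z, 0 <= f z)%E ->
  (forall x r k, 0 <= F x r k)%E ->
  (forall r k, measurable_fun [set: T] (fun x => F x r k)) ->
  (forall x r k, (delta * \1_C x)%:E * f (g x + r, k.+1)%R +
    \int[residual x]_y F y (g x + r)%R k.+1 <= F x r k)%E ->
  forall x, (\int[block_law x]_z f z <= F x 0%R 0%N)%E.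
Proof.
move=> mf f0 F0 mF hF x.
have mfs r k : measurable_fun [set: R * nat] (fun z => f (z.1 + r, (z.2 + k)%N)%R).
  apply: (measurableT_comp mf); apply: measurable_fun_pair.
    by apply: measurable_funD => //; exact: measurable_fst.
  by apply: (measurableT_comp (_ : measurable_fun [set: nat] (addn^~ k))) => //;
    exact: measurable_snd.
(* [r] and [k] are the sum and the length accumulated before [x] is reached; the induction needs
   them to vary. *)
suff partial n : forall x r k, (\sum_(0 <= i < n)
    \int[block_law_rec i x]_z f (z.1 + r, (z.2 + k)%N)%R <= F x r k)%E.
  rewrite integral_kseries//; apply: lime_le.
    by apply: is_cvg_nneseries => n _ _; exact: integral_ge0.
  near=> n; have := partial n x 0%R 0%N.
  by under eq_bigr do under eq_integral => z _ do rewrite addr0 addn0 -surjective_pairing.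
elim: n => [|n IH] {}x r k; first by rewrite big_nil.
rewrite big_nat_recl//=; apply: le_trans (hF x r k); apply: leeD.
  by rewrite ge0_integral_block_first//= add1n.
under eq_bigr do rewrite ge0_integral_block_next//.
rewrite -ge0_integral_sum//.
- apply: ge0_le_integral => //.
  + by move=> y _; apply: sume_ge0 => i _; exact: integral_ge0.
  + apply: emeasurable_sum => i; apply: measurable_integral_sfinite => //.
    exact: (measurable_block_shifted x (mfs r k)).
  + move=> y _; apply: le_trans (IH y (g x + r) k.+1).
    apply: lee_sum => i _; apply: ge0_le_integral => //.
    * exact: (measurable_block_shifted x (mfs r k)).
    * by move=> z _; rewrite /= addrA addSnnS.
- move=> i; apply: measurable_integral_sfinite => //.
  exact: (measurable_block_shifted x (mfs r k)).
- by move=> i y _; exact: integral_ge0.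
Unshelve. all: by end_near.
Qed.

End block_law.
End splitting.

(** * Weighted calculus for the residual kernel and the block law *)

Section dominated_kernel.
Context d d' (S : measurableType d) (T : measurableType d') (R : realType).
Variables (K : R.-ker S ~> T) (v : S -> R) (w : T -> R) (c : R).
Hypotheses (mw : measurable_fun [set: T] w) (w_ge1 : forall y, 1 <= w y).
Hypothesis Kw : forall x, (\int[K x]_y (w y)%:E <= (c * v x)%:E)%E.

Lemma weighted_kernel x : weighted w (K x).
Proof. exact: le_lt_trans (Kw x) (ltry _). Qed.

Lemma measurable_kernel_Rintegral (f : T -> R) : measurable_fun [set: T] f ->
  measurable_fun [set: S] (fun x => \int[K x]_y f y).
Proof.
move=> mf; have mEf : measurable_fun [set: T] (EFin \o f) by exact/measurable_EFinP.
rewrite (_ : (fun x => _) = fine \o (fun x => \int[K x]_y (EFin \o f)^\+ y -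
    \int[K x]_y (EFin \o f)^\- y)%E); last first.
  by apply/funext => x; rewrite /Rintegral/= integralE.
apply: measurableT_comp; first exact: fine_measurable.
apply: emeasurable_funB; apply: measurable_fun_integral_kernel => //;
  [exact: measurable_kernel|exact: measurable_funepos|exact: measurable_kernel|
   exact: measurable_funeneg].
Qed.

Lemma kernel_weight_le x : \int[K x]_y w y <= c * v x.
Proof.
rewrite -lee_fin -(@dominated_EFin _ _ _ w)//.
- exact: weighted_kernel.
- exact: dominated_self.
Qed.

Lemma kernel_Rintegral_le (f : T -> R) b : measurable_fun [set: T] f -> 0 <= b ->
  (forall y, `|f y| <= b * w y) ->
  forall x, `|\int[K x]_y f y| <= b * c * v x.
Proof.
move=> mf b0 fb x; rewrite -mulrA.
rewrite (@le_trans _ _ (b * \int[K x]_y w y))//; last first.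
  by rewrite ler_wpM2l// kernel_weight_le.
by apply: dominated_Rintegral_le => //; exact: weighted_kernel.
Qed.

Lemma dominated_kernel f : dominated w f ->
  dominated v (fun x => \int[K x]_y f y).
Proof.
move=> /[dup] df [mf _]; split; first exact: measurable_kernel_Rintegral.
have [b b0 fb] := dominated_bound w_ge1 df.
by exists (b * c) => x; exact: kernel_Rintegral_le.
Qed.

End dominated_kernel.

Section regenerative_chain.
Context d (T : measurableType d) (R : realType).
Variables (P : R.-pker T ~> T) (nu : probability T R) (C : set T) (delta : R).
Hypotheses (mC : measurable C) (delta_ge0 : 0 <= delta)
  (small : small_set P C nu delta).
Local Notation Q := (residual mC delta_ge0 small).
Local Notation L := (block_law mC delta_ge0 small).

Lemma RintegralQ_cst c x :
  \int[Q x]_y c = c * (1 - delta * \1_C x).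
Proof.
rewrite /Rintegral (@integral_cst _ _ _ (Q x) _ measurableT c%:E).
by rewrite /= residualT.
Qed.

Variables (w : T -> R) (gam : R).
Hypotheses (mw : measurable_fun [set: T] w) (w_ge1 : forall x, 1 <= w x)
  (gam01 : 0 < gam < 1)
  (Qw : forall x, (\int[Q x]_y (w y)%:E <= (gam * w x)%:E)%E).

Let wQ x : weighted w (Q x). Proof. exact: le_lt_trans (Qw x) (ltry _). Qed.

Lemma dominatedQ f : dominated w f -> dominated w (fun x => \int[Q x]_y f y).
Proof. move=> df; apply: (@dominated_kernel _ _ _ _ _ Q w w gam); by []. Qed.

(** Iterating the equation gains a factor [gam] each time. This uniqueness gives the total mass of
    the block law and the additivity of block sums in the summed function. *)
Lemma Q_fixpoint_eq0 f : dominated w f ->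
  (forall x, f x = \int[Q x]_y f y) -> forall x, f x = 0.
Proof.
move=> /[dup] df [mf _] fQ x; have [b b0 fb] := dominated_bound w_ge1 df.
have {}fb n y : `|f y| <= b * gam ^+ n * w y.
  elim: n y => [|n IH] y; first by rewrite expr0 mulr1.
  rewrite fQ exprSr mulrA.
  apply: (@kernel_Rintegral_le _ _ _ _ _ Q w w gam) => //.
  by rewrite mulr_ge0// exprn_ge0//; case/andP: gam01 => /ltW.
have cv : (fun n => b * gam ^+ n * w x) @ \oo --> b * 0 * w x.
  apply: cvgM; last exact: cvg_cst.
  apply: cvgM; first exact: cvg_cst.
  by apply: cvg_expr; case/andP: gam01 => ? ?; rewrite gtr0_norm.
rewrite mulr0 mul0r in cv.
apply/eqP; rewrite -normr_le0 -(cvg_lim _ cv)//; apply: limr_ge.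
  by apply/cvg_ex; exists 0.
by near=> n; exact: fb.
Unshelve. all: by end_near.
Qed.

(** The signed [f] is the difference of the nonnegative functions [f + b * w] and [b * w]; the same
    device serves for the other signed identities below. *)
Lemma P_splitting f x : weighted w nu -> dominated w f ->
  \int[P x]_y f y = \int[Q x]_y f y + delta * \1_C x * \int[nu]_y f y.
Proof.
move=> wnu df; have [b b0 fb] := dominated_bound w_ge1 df.
have wP : weighted w (P x).
  rewrite /weighted (ge0_integral_splitting mC delta_ge0 small)//.
  - apply: lte_add_pinfty; first exact: wQ.
    by apply: lte_mul_pinfty => //; rewrite lee_fin mulr_ge0.
  - exact/measurable_EFinP.
  - by move=> y; rewrite lee_fin (le_trans _ (w_ge1 y)).
have P0 h : dominated w h -> (forall y, 0 <= h y) ->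
    \int[P x]_y h y = \int[Q x]_y h y + delta * \1_C x * \int[nu]_y h y.
  move=> dh h0; apply: EFin_inj; rewrite EFinD EFinM.
  rewrite -!(@dominated_EFin _ _ _ w)//.
  apply: ge0_integral_splitting; first by apply/measurable_EFinP; case: dh.
  by move=> y; rewrite lee_fin.
have dw := dominated_self mw w_ge1.
have dbw := dominatedZ b dw.
have dfb := dominatedD df dbw.
have := P0 _ dfb; rewrite !(@dominated_RintegralD _ _ _ w)//.
rewrite (P0 _ dbw); last by move=> y; rewrite mulr_ge0// (le_trans _ (w_ge1 y)).
move=> e; have {}e := e (fun y => ltac:(by have := fb y; rewrite ler_norml; lra)).
lra.
Qed.

Section block_moments.
Variables (g : T -> R) (mg : measurable_fun [set: T] g)
  (wL : R * nat -> R) (K : R).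
Hypotheses (mwL : measurable_fun [set: R * nat] wL) (wL_ge1 : forall z, 1 <= wL z)
  (wL_shift : forall x, exists c, forall z, wL (z.1 + g x, z.2.+1) <= c * wL z)
  (LwL : forall x, (\int[L mg x]_z (wL z)%:E <= (K * w x)%:E)%E).

Lemma weightedL x : weighted wL (L mg x). Proof. exact: le_lt_trans (LwL x) (ltry _). Qed.

Lemma dominatedL f : dominated wL f -> dominated w (fun x => \int[L mg x]_z f z).
Proof. move=> df; apply: (@dominated_kernel _ _ _ _ _ (L mg) w wL K); by []. Qed.

Lemma dominated_shift f x : dominated wL f ->
  dominated wL (fun z => f (z.1 + g x, z.2.+1)).
Proof.
move=> /[dup] df [mf _]; have [b b0 fb] := dominated_bound wL_ge1 df.
have [c hc] := wL_shift x; split.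
  apply/measurable_EFinP; apply: (measurable_block_shifted g x (f := EFin \o f)).
  exact/measurable_EFinP.
by exists (b * c) => z; rewrite (le_trans (fb _))// -mulrA ler_wpM2l.
Qed.

Lemma Rintegral_block_law f x : dominated wL f ->
  \int[L mg x]_z f z = delta * \1_C x * f (g x, 1%N) +
    \int[Q x]_y \int[L mg y]_z f (z.1 + g x, z.2.+1).
Proof.
have L0 h : dominated wL h -> (forall z, 0 <= h z) ->
    \int[L mg x]_z h z = delta * \1_C x * h (g x, 1%N) +
    \int[Q x]_y \int[L mg y]_z h (z.1 + g x, z.2.+1).
  move=> dh h0; have wx := weightedL; have ds := dominated_shift x dh.
  apply: EFin_inj; rewrite -(@dominated_EFin _ _ _ wL)//.
  have mh : measurable_fun [set: R * nat] (EFin \o h).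
    by apply/measurable_EFinP; case: dh.
  rewrite (ge0_integral_block_law mC delta_ge0 small mg x mh)//.
  rewrite EFinD EFinM; congr (_ + _)%E.
  rewrite -(@dominated_EFin _ _ _ w)//; last exact: dominatedL.
  by apply: eq_integral => y _; rewrite -(@dominated_EFin _ _ _ wL).
move=> df; have [b b0 fb] := dominated_bound wL_ge1 df.
have dw := dominated_self mwL wL_ge1.
have dbw := dominatedZ b dw.
have dfb := dominatedD df dbw.
have wx := weightedL.
have := L0 _ dfb; rewrite (@dominated_RintegralD _ _ _ wL)//.
have := L0 _ dbw (fun z => mulr_ge0 b0 (le_trans ler01 (wL_ge1 z))).
have fb0 z : 0 <= f z + b * wL z.
  by have := fb z; rewrite ler_norml; move: (f z) (b * wL z) => p q; lra.
move=> eb e; have {}e := e fb0.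
have aux (A B c1 F1 W1 F2 W2 : R) : A + B = c1 * (F1 + W1) + (F2 + W2) ->
    B = c1 * W1 + W2 -> A = c1 * F1 + F2 by lra.
have e1 : \int[Q x]_y \int[L mg y]_z (f (z.1 + g x, z.2.+1) + b * wL (z.1 + g x, z.2.+1)) =
    \int[Q x]_y \int[L mg y]_z (f (z.1 + g x, z.2.+1)) +
    \int[Q x]_y \int[L mg y]_z (b * wL (z.1 + g x, z.2.+1)).
  rewrite -(@dominated_RintegralD _ _ _ w)//.
  - apply: eq_Rintegral => y _; rewrite (@dominated_RintegralD _ _ _ wL)//.
    + exact: dominated_shift.
    + exact: (@dominated_shift (fun z => b * wL z)).
  - by apply: dominatedL; exact: dominated_shift.
  - by apply: dominatedL; exact: (@dominated_shift (fun z => b * wL z)).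
rewrite e1 in e; exact: aux e eb.
Qed.

(** Blocks are almost surely finite: the missing mass is a fixed point of the residual kernel, hence
    zero. *)
Lemma block_law_mass x : \int[L mg x]_z 1 = 1.
Proof.
have d1 := dominated_cst wL_ge1 1.
have dM := dominatedL d1.
suff: 1 - \int[L mg x]_z 1 = 0 by lra.
apply: (@Q_fixpoint_eq0 (fun x => 1 - \int[L mg x]_z 1)).
  by apply: dominatedB => //; exact: dominated_cst.
move=> {}x /=; rewrite (@dominated_RintegralB _ _ _ w)//; last first.
  exact: dominated_cst.
rewrite (Rintegral_block_law x d1) RintegralQ_cst; lra.
Qed.

Lemma block_law_cst c x : \int[L mg x]_z c = c.
Proof.
rewrite -[LHS](_ : \int[L mg x]_z (c * 1) = _); last first.
  by apply: eq_Rintegral => z _; rewrite mulr1.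
rewrite (@dominated_RintegralZ _ _ _ wL)//; last exact: dominated_cst.
  by rewrite block_law_mass mulr1.
exact: weightedL.
Qed.

(** The block sum contains [g x] in both branches of the first-step equation, and the two branches
    have total mass 1. *)
Lemma block_sum_poisson x : dominated wL fst ->
  \int[L mg x]_z z.1 = g x + \int[Q x]_y \int[L mg y]_z z.1.
Proof.
move=> d1; rewrite (Rintegral_block_law x d1)/=.
have wx := weightedL.
rewrite -[X in _ + X = _](_ : \int[Q x]_y (\int[L mg y]_z z.1 + g x) = _).
  rewrite (@dominated_RintegralD _ _ _ w)//.
  - by rewrite RintegralQ_cst; lra.
  - exact: dominatedL.
  - exact: dominated_cst.
apply: eq_Rintegral => y _; rewrite (@dominated_RintegralD _ _ _ wL)//.
- by rewrite block_law_cst.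
- exact: wx.
- exact: dominated_cst.
Qed.

End block_moments.
End regenerative_chain.

(** * Integrals against the stationary law *)

Section stationary_integrals.
Context d (T : measurableType d) (R : realType).
Variables (P : R.-pker T ~> T) (pi : probability T R).
Hypothesis piP : stationary P pi.

Lemma ge0_stationary_integral (f : T -> R) : measurable_fun [set: T] f ->
  (forall x, 0 <= f x) ->
  (\int[pi]_x \int[P x]_y (f y)%:E = \int[pi]_x (f x)%:E)%E.
Proof.
move=> mf f0.
have mk A : measurable A -> measurable_fun [set: T] (fun x => \d_x A : \bar R).
  by move=> mA; exact: (measurable_kernel (kdirac (R := R) (@measurable_id _ T setT)) A mA).
have := @ge0_mixture_eq _ _ T T R pi P (fun x => \d_x) (fun=> 1) (fun=> 1).
move=> /(_ (fun A mA => measurable_kernel P A mA) mk).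
move=> /(_ (measurable_cst _) (fun=> ler01) (measurable_cst _) (fun=> ler01)).
have e A : measurable A -> (\int[pi]_w (1 * P w A) = \int[pi]_w (1 * \d_w A))%E.
  move=> mA; under eq_integral do rewrite mul1e.
  rewrite piP//; under eq_integral do rewrite mul1e.
  by rewrite -{1}(setIT A) -integral_indic.
move=> /(_ e f mf f0).
under eq_integral do rewrite mul1e.
move=> ->; apply: eq_integral => x _.
by rewrite mul1e integral_dirac ?diracT ?mul1e//; exact/measurable_EFinP.
Qed.

Variables (w : T -> R).
Hypotheses (mw : measurable_fun [set: T] w) (w_ge1 : forall x, 1 <= w x)
  (wpi : weighted w pi) (c : R)
  (Pw : forall x, (\int[P x]_y (w y)%:E <= (c * w x)%:E)%E).

Lemma stationary_Rintegral f : dominated w f ->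
  \int[pi]_x \int[P x]_y f y = \int[pi]_x f x.
Proof.
have wP x : weighted w (P x) by exact: le_lt_trans (Pw x) (ltry _).
have dP f' : dominated w f' -> dominated w (fun x => \int[P x]_y f' y).
  by move=> df; apply: (@dominated_kernel _ _ _ _ _ P w w c).
have pi0 h : dominated w h -> (forall y, 0 <= h y) ->
    \int[pi]_x \int[P x]_y h y = \int[pi]_x h x.
  move=> dh h0; apply: EFin_inj.
  rewrite -(dominated_EFin mw w_ge1 wpi dh) -(dominated_EFin mw w_ge1 wpi (dP _ dh)).
  rewrite -(ge0_stationary_integral (dominated_measurable dh) h0).
  by apply: eq_integral => x _; rewrite (dominated_EFin mw w_ge1 (wP x) dh).
move=> df; have [b b0 fb] := dominated_bound w_ge1 df.
have dw := dominated_self mw w_ge1.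
have dbw := dominatedZ b dw.
have dfb := dominatedD df dbw.
have h1 := pi0 _ dbw (fun z => mulr_ge0 b0 (le_trans ler01 (w_ge1 z))).
have fb0 z : 0 <= f z + b * w z.
  by have := fb z; rewrite ler_norml; move: (f z) (b * w z) => p q; lra.
have := pi0 _ dfb fb0.
under eq_Rintegral do rewrite (dominated_RintegralD mw w_ge1 (wP _) df dbw).
rewrite (dominated_RintegralD mw w_ge1 wpi (dP _ df) (dP _ dbw)).
rewrite (dominated_RintegralD mw w_ge1 wpi df dbw).
by rewrite h1 => /addIr.
Qed.

End stationary_integrals.

(** * Block sums of functions dominated by the drift weight *)

Section regenerative_blocks.
Context d (T : measurableType d) (R : realType).
Variables (P : R.-pker T ~> T) (nu : probability T R) (C : set T) (delta : R).
Hypotheses (mC : measurable C) (delta_ge0 : 0 <= delta)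
  (small : small_set P C nu delta).
Local Notation Q := (residual mC delta_ge0 small).
Local Notation L := (block_law mC delta_ge0 small).
Variables (u : T -> R) (gam : R).
Hypotheses (mu : measurable_fun [set: T] u) (u_ge1 : forall x, 1 <= u x)
  (gam01 : 0 < gam < 1)
  (Qu : forall x, (\int[Q x]_y (u y)%:E <= (gam * u x)%:E)%E).

Let gam_ge0 : 0 <= gam. Proof. by case/andP: gam01 => /ltW. Qed.
Let gam_lt1 : gam < 1. Proof. by case/andP: gam01. Qed.

Lemma residualT_EFin x c : (\int[Q x]_y c%:E = (c * (1 - delta * \1_C x))%:E)%E.
Proof. by rewrite (@integral_cst _ _ _ (Q x) _ measurableT c%:E) /= residualT. Qed.

Section dominated_sum.
Variables (g : T -> R) (mg : measurable_fun [set: T] g) (kap : R).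
Hypotheses (kap_ge0 : 0 <= kap) (g_le : forall x, `|g x| <= kap * u x).

Definition abs_weight (z : R * nat) : R := `|z.1| + 1.

Lemma abs_weight_ge1 z : 1 <= abs_weight z. Proof. by rewrite /abs_weight lerDr. Qed.

Lemma measurable_abs_weight : measurable_fun [set: R * nat] abs_weight.
Proof.
by apply: measurable_funD => //; apply: measurableT_comp.
Qed.

Lemma abs_weight_shift x : exists c, forall z,
  abs_weight (z.1 + g x, z.2.+1) <= c * abs_weight z.
Proof.
exists (`|g x| + 1) => z; rewrite /abs_weight/=.
have := ler_normD z.1 (g x); have := normr_ge0 (g x); have := normr_ge0 z.1.
move: `|z.1| `|g x| `|_ + _| => p q r p0 q0 rpq.
by have := mulr_ge0 p0 q0; lra.
Qed.

(** By minimality of the block law it is enough to exhibit a supersolution, here [|r| + 1 + c * u].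
    The constant solves [kap + c * gam = c]: it is the sum of the geometric series of the
    contributions [kap * gam ^+ n]. *)
Lemma block_abs_weight_le x :
  (\int[L mg x]_z (abs_weight z)%:E <= (1 + kap / (1 - gam) * u x)%:E)%E.
Proof.
pose c := kap / (1 - gam).
have c0 : 0 <= c by rewrite divr_ge0// subr_ge0 ltW.
have g1 : 1 - gam != 0 by rewrite subr_eq0 gt_eqF.
have cE : kap + c * gam = c by rewrite /c; field.
pose F (y : T) (r : R) (_ : nat) : \bar R := (`|r| + 1 + c * u y)%:E.
have F0 y r k : (0 <= F y r k)%E.
  rewrite lee_fin addr_ge0// ?addr_ge0// mulr_ge0//.
  exact: le_trans (u_ge1 y).
have mF r k : measurable_fun [set: T] (fun y => F y r k).
  apply/measurable_EFinP; apply: measurable_funD => //.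
  exact: measurable_funM.
have f0 z : (0 <= (EFin \o abs_weight) z)%E.
  by rewrite /= lee_fin; exact: le_trans ler01 (abs_weight_ge1 z).
have mf : measurable_fun [set: R * nat] (EFin \o abs_weight).
  by apply/measurable_EFinP; apply: measurable_abs_weight.
suff hF (y : T) (r : R) (k : nat) :
    ((delta * \1_C y)%:E * (EFin \o abs_weight) (g y + r, k.+1)%R +
    \int[Q y]_z F z (g y + r)%R k.+1 <= F y r k)%E.
  have := ge0_integral_block_law_le mg mf f0 F0 mF hF x.
  by rewrite /F normr0 add0r.
rewrite /F/abs_weight/=; move: y => {}x.
pose a := `|g x + r| + 1; have a0 : 0 <= a by rewrite addr_ge0.
rewrite (_ : (fun y => _) = (fun y => a%:E + (c * u y)%:E)%E)//.
rewrite ge0_integralD//; last 2 first.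
- by move=> y _; rewrite lee_fin mulr_ge0// (le_trans _ (u_ge1 y)).
- by apply/measurable_EFinP; exact: measurable_funM.
rewrite residualT_EFin.
under eq_integral do rewrite EFinM.
rewrite ge0_integralZl_EFin//; last 2 first.
- by move=> y _; rewrite lee_fin (le_trans _ (u_ge1 y)).
- exact/measurable_EFinP.
apply: (@le_trans _ _ ((delta * \1_C x * a)%:E + ((a * (1 - delta * \1_C x))%:E
    + c%:E * (gam * u x)%:E))%E).
  by rewrite leeD// leeD// lee_wpmul2l.
rewrite -EFinM -!EFinD lee_fin.
have h1 := ler_normD (g x) r; have h2 := g_le x.
have -> : delta * \1_C x * a + (a * (1 - delta * \1_C x) + c * (gam * u x)) =
  a + c * gam * u x by ring.
rewrite -[in leRHS]cE /a; move: h1 h2; move: `|g x + r| `|g x| `|r| (u x) => A B D E.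
lra.
Qed.

Let K := 1 + kap / (1 - gam).

Lemma abs_weightL x : (\int[L mg x]_z (abs_weight z)%:E <= (K * u x)%:E)%E.
Proof.
apply: le_trans (block_abs_weight_le x) _; rewrite lee_fin /K mulrDl mul1r.
by rewrite lerD2r.
Qed.

Lemma dominated_abs_fst : dominated abs_weight fst.
Proof.
split; first exact: measurable_fst.
by exists 1 => z; rewrite mul1r /abs_weight lerDl.
Qed.

(** As a function of [g] this is the resolvent [(1 - Q)^-1] of the residual kernel, see
    [block_sumE]. *)
Definition block_sum (x : T) : R := \int[L mg x]_z z.1.

Lemma dominated_block_sum : dominated u block_sum.
Proof.
apply: (@dominatedL _ _ _ _ _ _ _ mC delta_ge0 small u g mg abs_weight K) => //.
- exact: measurable_abs_weight.
- exact: abs_weight_ge1.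
- exact: abs_weightL.
- exact: dominated_abs_fst.
Qed.

Lemma block_sum_le x : `|block_sum x| <= kap / (1 - gam) * u x.
Proof.
have mW := measurable_abs_weight; have W1 := abs_weight_ge1.
have wLx : weighted abs_weight (L mg x).
  by exact: le_lt_trans (abs_weightL x) (ltry _).
have := block_law_cst mu u_ge1 gam01 Qu mW W1 abs_weight_shift abs_weightL 1 x.
have d1 := dominated_norm W1 dominated_abs_fst.
have dc := dominated_cst W1 1.
move=> e; have := block_abs_weight_le x.
rewrite (@dominated_EFin _ _ _ abs_weight)//; last exact: dominated_self.
rewrite (@dominated_RintegralD _ _ _ abs_weight)// e lee_fin addrC lerD2l.
apply: le_trans; apply: (dominated_Rintegral_norm mW W1 wLx).
exact: dominated_abs_fst.
Qed.

Lemma block_sumE x : block_sum x = g x + \int[Q x]_y block_sum y.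
Proof.
exact: (block_sum_poisson mu u_ge1 gam01 Qu measurable_abs_weight
  abs_weight_ge1 abs_weight_shift abs_weightL x dominated_abs_fst).
Qed.

End dominated_sum.
End regenerative_blocks.

Lemma probability_Rintegral_cst d (T : measurableType d) (R : realType)
  (p : probability T R) (a : R) : \int[p]_x a = a.
Proof.
rewrite /Rintegral (@integral_cst _ _ _ p _ measurableT a%:E).
rewrite -[RHS]/(fine a%:E) -[in RHS](mule1 a%:E); congr (fine (_ * _)).
exact: probability_setT.
Qed.

(** * Blocks of a bounded function: exponential moments and Kac-type identities *)

Section bounded_blocks.
Context d (T : measurableType d) (R : realType).
Variables (P : R.-pker T ~> T) (nu : probability T R) (C : set T) (delta : R).
Hypotheses (mC : measurable C) (delta_ge0 : 0 <= delta)
  (small : small_set P C nu delta).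
Local Notation Q := (residual mC delta_ge0 small).
Local Notation L := (block_law mC delta_ge0 small).
Variables (u : T -> R) (gam : R).
Hypotheses (mu : measurable_fun [set: T] u) (u_ge1 : forall x, 1 <= u x)
  (gam01 : 0 < gam < 1)
  (Qu : forall x, (\int[Q x]_y (u y)%:E <= (gam * u x)%:E)%E).
Variables (g : T -> R) (mg : measurable_fun [set: T] g) (m c K : R).
Hypotheses (m_gt0 : 0 < m) (g_le : forall x, `|g x| <= m) (c_gt0 : 0 < c)
  (K_ge1 : 1 <= K) (cK : expR c * (delta + K * gam) <= K).

Let gam_ge0 : 0 <= gam. Proof. by case/andP: gam01 => /ltW. Qed.
Let u_ge0 x : 0 <= u x. Proof. exact: le_trans ler01 (u_ge1 x). Qed.
Let K_ge0 : 0 <= K. Proof. exact: le_trans ler01 K_ge1. Qed.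

(** Along a path [|g| <= m] bounds the sum by the length, but the block law is accessed through
    integrals only; two exponentials avoid an almost sure statement. *)
Definition exp_weight (z : R * nat) : R :=
  expR (c * z.2%:R) + expR (c / m * `|z.1|).

Lemma exp_weight_ge1 z : 1 <= exp_weight z.
Proof.
rewrite /exp_weight -[leLHS]addr0 lerD ?expR_ge0// -expR0 ler_expR.
by rewrite mulr_ge0// ltW.
Qed.
Local Notation W1 := exp_weight_ge1.

Lemma measurable_block_length : measurable_fun [set: R * nat] (fun z => z.2%:R : R).
Proof.
have mn : measurable_fun [set: nat] (fun n => n%:R : R) by [].
exact: (measurableT_comp mn measurable_snd).
Qed.

Lemma measurable_exp_weight : measurable_fun [set: R * nat] exp_weight.
Proof.
apply: measurable_funD; apply: measurableT_comp => //;
  apply: measurable_funM => //; first exact: measurable_block_length.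
by apply: measurableT_comp.
Qed.
Local Notation mW := measurable_exp_weight.

Lemma exp_weight_step r y k :
  expR (c * k.+1%:R) + expR (c / m * `|g y + r|) <=
  expR c * (expR (c * k%:R) + expR (c / m * `|r|)).
Proof.
rewrite mulrDr -!expRD; apply: lerD; rewrite ler_expR.
  by rewrite -natr1 mulrDr mulr1 addrC.
rewrite (@le_trans _ _ (c / m * (m + `|r|)))//.
  apply: ler_wpM2l; first by rewrite divr_ge0 ?ltW.
  by rewrite (le_trans (ler_normD _ _))// lerD2r.
by rewrite mulrDr divfK// gt_eqF.
Qed.

Lemma exp_weight_shift x : exists b, forall z,
  exp_weight (z.1 + g x, z.2.+1) <= b * exp_weight z.
Proof.
by exists (expR c) => z; rewrite /exp_weight/= addrC addrC (addrC z.1) exp_weight_step.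
Qed.

(** The supersolution is [K * u] times the weight accumulated so far. One step multiplies that
    weight by at most [expR c], and [cK] lets the drift under the residual kernel pay for it, the
    regeneration being bounded by [delta * u]. *)
Lemma exp_weightL x : (\int[L mg x]_z (exp_weight z)%:E <= (2 * K * u x)%:E)%E.
Proof.
pose A (r : R) (k : nat) := expR (c * k%:R) + expR (c / m * `|r|).
have A0 r k : 0 <= A r k by rewrite addr_ge0// expR_ge0.
pose F (y : T) (r : R) (k : nat) : \bar R := (A r k * K * u y)%:E.
have F0 y r k : (0 <= F y r k)%E by rewrite lee_fin !mulr_ge0.
have mF r k : measurable_fun [set: T] (fun y => F y r k).
  by apply/measurable_EFinP; exact: measurable_funM.
have f0 z : (0 <= (EFin \o exp_weight) z)%E.
  by rewrite /= lee_fin; exact: le_trans ler01 (W1 z).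
have mf : measurable_fun [set: R * nat] (EFin \o exp_weight).
  by apply/measurable_EFinP; exact: mW.
suff hF (y : T) (r : R) (k : nat) :
    ((delta * \1_C y)%:E * (EFin \o exp_weight) (g y + r, k.+1)%R +
    \int[Q y]_z F z (g y + r)%R k.+1 <= F y r k)%E.
  have := ge0_integral_block_law_le mg mf f0 F0 mF hF x.
  by rewrite /F /A normr0 !mulr0 expR0.
rewrite /F/=.
under eq_integral do rewrite EFinM.
rewrite ge0_integralZl_EFin//; last 3 first.
- by move=> z _; rewrite lee_fin.
- exact/measurable_EFinP.
- by rewrite mulr_ge0.
apply: (@le_trans _ _ ((delta * \1_C y)%:E * (A (g y + r) k.+1)%:E +
    (A (g y + r) k.+1 * K)%:E * (gam * u y)%:E))%E.
  by rewrite leeD2l// lee_wpmul2l// lee_fin mulr_ge0.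
rewrite -!EFinM -EFinD lee_fin.
apply: (@le_trans _ _ (A (g y + r) k.+1 * ((delta + K * gam) * u y))).
  have c1 : delta * \1_C y <= delta * u y.
    have i1 : (\1_C y : R) <= 1 by rewrite indicE lern1 leq_b1.
    by apply: ler_wpM2l => //; apply: le_trans (u_ge1 y).
  have := ler_wpM2r (A0 (g y + r) k.+1) c1.
  move: (A _ _) (delta * \1_C y) => a b; lra.
apply: (@le_trans _ _ (expR c * A r k * ((delta + K * gam) * u y))).
  rewrite ler_wpM2r ?exp_weight_step//.
  by rewrite mulr_ge0// addr_ge0// mulr_ge0.
have := ler_wpM2r (mulr_ge0 (A0 r k) (u_ge0 y)) cK.
move: (A r k) (expR c) => a b; lra.
Qed.
Local Notation shiftW := exp_weight_shift.
Local Notation LW := exp_weightL.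
Local Notation dom := (dominated exp_weight).

Lemma weighted_block x : weighted exp_weight (L mg x).
Proof. exact: le_lt_trans (LW x) (ltry _). Qed.

(* The size of a block, measured by [tau], has exponential moments. *)
Definition block_size (z : R * nat) : R := Num.max (`|z.1| / m) z.2%:R.
Local Notation tau := block_size.

Lemma le_tau_length z : z.2%:R <= tau z.
Proof. by rewrite /tau le_max lexx orbT. Qed.

Lemma le_tau_sum z : `|z.1| <= m * tau z.
Proof. by rewrite mulrC -ler_pdivrMr// /tau le_max lexx. Qed.

Lemma tau_ge0 z : 0 <= tau z.
Proof. exact: le_trans (le_tau_length z). Qed.

Lemma expR_tau_le z : expR (c * tau z) <= exp_weight z.
Proof.
rewrite /tau /exp_weight; case: (leP (`|z.1| / m)) => _; first by rewrite lerDl expR_ge0.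
have -> : c / m * `|z.1| = c * (`|z.1| / m) by ring.
by rewrite lerDr expR_ge0.
Qed.

Lemma dominated_tau (f : R * nat -> R) b : measurable_fun [set: R * nat] f ->
  (forall z, `|f z| <= b * expR (c * tau z)) -> dom f.
Proof.
move=> mf fb; split=> //; exists `|b| => z; rewrite (le_trans (fb z))//.
rewrite (@le_trans _ _ (`|b| * expR (c * tau z)))//.
  by rewrite ler_wpM2r ?expR_ge0// ler_norm.
by rewrite ler_wpM2l// expR_tau_le.
Qed.

Let tau1 z : tau z <= c^-1 * expR (c * tau z).
Proof.
rewrite ler_pdivlMl//; apply: le_trans (expR_ge1Dx _).
by rewrite lerDr.
Qed.

Let tau2 z : tau z ^+ 2 <= 2 / c ^+ 2 * expR (c * tau z).
Proof. by apply: scaled_sqr_le_expR; rewrite ?tau_ge0. Qed.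

Let m_ge0 : 0 <= m := ltW m_gt0.

Lemma dominated_sum : dom fst.
Proof.
apply: (@dominated_tau _ (m / c)) => // z.
by rewrite (le_trans (le_tau_sum z))// -mulrA ler_wpM2l.
Qed.

Lemma dominated_sum2 : dom (fun z => z.1 ^+ 2).
Proof.
apply: (@dominated_tau _ (m ^+ 2 * (2 / c ^+ 2))) => [|z].
  by apply: measurable_funX.
rewrite normrX -mulrA (@le_trans _ _ (m ^+ 2 * tau z ^+ 2))//.
  by rewrite -exprMn ler_pXn2r ?nnegrE ?le_tau_sum ?mulr_ge0 ?tau_ge0.
by rewrite ler_wpM2l ?sqr_ge0.
Qed.

Lemma dominated_length : dom (fun z => z.2%:R).
Proof.
apply: (@dominated_tau _ c^-1) => [|z]; first exact: measurable_block_length.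
by rewrite ger0_norm// (le_trans (le_tau_length z)).
Qed.

Lemma dominated_expR_tau p : p <= c ->
  dom (fun z => expR (p * tau z)).
Proof.
move=> pc; apply: (@dominated_tau _ 1) => [|z].
  apply: measurableT_comp => //; apply: measurable_funM => //.
  apply: measurable_maxr; last exact: measurable_block_length.
  by apply: measurable_funM => //; apply: measurableT_comp.
by rewrite mul1r ger0_norm ?expR_ge0// ler_expR ler_wpM2r ?tau_ge0.
Qed.

Definition block_length (x : T) : R := \int[L mg x]_z z.2%:R.

Definition block_square (x : T) : R := \int[L mg x]_z z.1 ^+ 2.

Local Notation h := (block_sum mC delta_ge0 small mg).

Let FS := Rintegral_block_law mu u_ge1 Qu mW W1 shiftW LW.
Let cstL := block_law_cst mu u_ge1 gam01 Qu mW W1 shiftW LW.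
Let domL f (df : dom f) := dominatedL mW W1 LW df.

Lemma dominated_block_length : dominated u block_length.
Proof. exact: domL dominated_length. Qed.

Lemma dominated_block_square : dominated u block_square.
Proof. exact: domL dominated_sum2. Qed.

Lemma block_lengthE x : block_length x = 1 + \int[Q x]_y block_length y.
Proof.
rewrite /block_length (FS x dominated_length)/=.
have dn := dominated_length; have d1 := dominated_cst W1 1.
have wQ : weighted u (Q x) by exact: le_lt_trans (Qu x) (ltry _).
rewrite (_ : \int[Q x]_y \int[L mg y]_z z.2.+1%:R =
    \int[Q x]_y (block_length y + 1)); last first.
  apply: eq_Rintegral => y _.
  under eq_Rintegral do rewrite -natr1.
  by rewrite (dominated_RintegralD mW W1 (weighted_block y) dn d1) cstL.
rewrite (dominated_RintegralD mu u_ge1 wQ dominated_block_length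
  (dominated_cst u_ge1 1)) RintegralQ_cst.
by rewrite /block_length; move: (\int[Q x]_y _) => I; lra.
Qed.

Lemma block_length_ge1 x : 1 <= block_length x.
Proof.
rewrite block_lengthE lerDl; apply: Rintegral_ge0 => y _.
by apply: Rintegral_ge0 => z _; rewrite ler0n.
Qed.

(** Expansion of [(z.1 + g x) ^+ 2] in the first-step equation; the cross term brings in the
    expected block sum after the first step. *)
Lemma block_squareE x : block_square x = g x ^+ 2 +
  2 * g x * \int[Q x]_y h y + \int[Q x]_y block_square y.
Proof.
rewrite /block_square (FS x dominated_sum2)/=.
have d2 := dominated_sum2; have d1 := dominated_sum.
have dg := dominated_cst W1 (g x ^+ 2).
have d1' := dominatedZ (2 * g x) d1.
have wQ : weighted u (Q x) by exact: le_lt_trans (Qu x) (ltry _).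
have dh : dominated u h := domL dominated_sum.
have dh' := dominatedZ (2 * g x) dh.
rewrite (_ : \int[Q x]_y \int[L mg y]_z (z.1 + g x) ^+ 2 =
    \int[Q x]_y (block_square y + 2 * g x * h y + g x ^+ 2)); last first.
  apply: eq_Rintegral => y _; have wy := weighted_block y.
  rewrite -[RHS](_ : \int[L mg y]_z (z.1 ^+ 2 + 2 * g x * z.1 + g x ^+ 2) = _).
    by apply: eq_Rintegral => z _; ring.
  rewrite (dominated_RintegralD mW W1 wy (dominatedD d2 d1') dg) cstL.
  rewrite (dominated_RintegralD mW W1 wy d2 d1').
  by rewrite (dominated_RintegralZ mW W1 _ wy d1).
rewrite (dominated_RintegralD mu u_ge1 wQ
  (dominatedD dominated_block_square dh') (dominated_cst u_ge1 _)) RintegralQ_cst.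
rewrite (dominated_RintegralD mu u_ge1 wQ dominated_block_square dh').
rewrite (dominated_RintegralZ mu u_ge1 _ wQ dh).
move: (\int[Q x]_y _) (\int[Q x]_y _) (delta * _) (g x ^+ 2) => I J a b.
by rewrite /block_square; lra.
Qed.

Lemma block_square_ge0 x : 0 <= block_square x.
Proof. by apply: Rintegral_ge0 => z _; exact: sqr_ge0. Qed.

Section stationary_identities.
Variable pi : probability T R.
Hypotheses (piP : stationary P pi) (wpi : weighted u pi) (wnu : weighted u nu).

Let uP x : (\int[P x]_y (u y)%:E <=
  ((gam + delta * fine (\int[nu]_y (u y)%:E)) * u x)%:E)%E.
Proof.
have mEu : measurable_fun [set: T] (EFin \o u) by exact/measurable_EFinP.
have Eu0 y : (0 <= (EFin \o u) y)%E by rewrite lee_fin.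
rewrite (ge0_integral_splitting mC delta_ge0 small x mEu Eu0)/=.
rewrite mulrDl EFinD; apply: leeD; first exact: Qu.
have I0 : (0 <= \int[nu]_y (u y)%:E)%E by apply: integral_ge0 => y _; rewrite lee_fin.
have fI : (\int[nu]_y (u y)%:E)%E \is a fin_num by rewrite ge0_fin_numE.
rewrite -{1}(fineK fI) -EFinM lee_fin.
move: (fine_ge0 I0); move: (fine _) => N N0.
have i1 : (\1_C x : R) <= u x.
  by apply: le_trans (u_ge1 x); rewrite indicE lern1 leq_b1.
by rewrite mulrAC ler_wpM2l// mulr_ge0.
Qed.

(** Stationarity read through the splitting: what [pi] loses under the residual kernel is restored
    from [nu]. *)
Let balance f : dominated u f ->
  \int[pi]_x f x = \int[pi]_x \int[Q x]_y f y +
    (\int[pi]_x (delta * \1_C x)) * \int[nu]_y f y.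
Proof.
move=> df; rewrite -{1}(stationary_Rintegral piP mu u_ge1 wpi uP df).
have dc : dominated u (fun x => delta * \1_C x).
  apply: (@le_dominated _ _ _ _ u_ge1 _ (fun=> delta) 1) => //.
  - by apply: measurable_funM.
  - move=> x; rewrite mul1r normrM -[leRHS]mulr1 ler_wpM2l//.
    by rewrite ger0_norm// indicE lern1 leq_b1.
  - exact: dominated_cst.
have dc' := dominatedZ (\int[nu]_y f y) dc.
have dQ := dominatedQ mu u_ge1 Qu df.
rewrite [X in _ + X]mulrC -(dominated_RintegralZ mu u_ge1 _ wpi dc).
rewrite -(dominated_RintegralD mu u_ge1 wpi dQ dc').
apply: eq_Rintegral => x _.
by rewrite (P_splitting mu u_ge1 Qu x wnu df) [X in _ + X]mulrC.
Qed.

Definition regeneration_rate : R := \int[pi]_x (delta * \1_C x).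

(** Kac's formula: [balance] applied to the expected block length, which the residual kernel lowers
    by exactly 1. *)
Lemma block_length_kac : regeneration_rate * \int[nu]_x block_length x = 1.
Proof.
have dl := dominated_block_length.
have := balance dl.
have -> : \int[pi]_x block_length x = 1 + \int[pi]_x \int[Q x]_y block_length y.
  under eq_Rintegral do rewrite block_lengthE.
  rewrite (dominated_RintegralD mu u_ge1 wpi (dominated_cst u_ge1 1)
    (dominatedQ mu u_ge1 Qu dl)).
  by rewrite probability_Rintegral_cst.
rewrite /regeneration_rate.
move: (\int[pi]_x _) (\int[pi]_x _ ) (\int[nu]_x _) => I J k; lra.
Qed.

Lemma regeneration_rate_neq0 : regeneration_rate != 0.
Proof.
by apply/eqP => r0; have := block_length_kac; rewrite r0 mul0r; lra.
Qed.

Let dh : dominated u h := domL dominated_sum.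

Hypothesis pig : \int[pi]_x g x = 0.

Let hE x : h x = g x + \int[Q x]_y h y.
Proof.
exact: (block_sum_poisson mu u_ge1 gam01 Qu mW W1 shiftW LW x dominated_sum).
Qed.

Let dg : dominated u g.
Proof.
split=> //; exists m => x; rewrite (le_trans (g_le x))// ler_peMr//.
Qed.

(** [balance] for [h], whose defect under the residual kernel is [g], of mean zero; the regeneration
    rate can then be cancelled. *)
Lemma block_sum_mean0 : \int[nu]_x h x = 0.
Proof.
have := balance dh.
have -> : \int[pi]_x h x = \int[pi]_x \int[Q x]_y h y.
  under [LHS]eq_Rintegral do rewrite hE.
  rewrite (dominated_RintegralD mu u_ge1 wpi dg (dominatedQ mu u_ge1 Qu dh)).
  by rewrite pig add0r.
move=> /eqP; rewrite -subr_eq0 opprD addrA subrr add0r oppr_eq0 mulf_eq0.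
by rewrite (negPf regeneration_rate_neq0)/= => /eqP.
Qed.

(** [balance] for the second moment: substituting [h - g] for the residual image of [h] turns the
    defect into the integrand of the asymptotic variance. Together with Kac's formula, the mean
    square of a block sum under [nu] is that variance times the mean block length. *)
Lemma block_square_mean : regeneration_rate * \int[nu]_x block_square x =
  \int[pi]_x (2 * g x * h x - g x ^+ 2).
Proof.
have dq := dominated_block_square.
have := balance dq; rewrite -/regeneration_rate.
have dgh : dominated u (fun x => 2 * g x * h x - g x ^+ 2).
  apply: dominatedB.
    apply: (@le_dominated _ _ _ _ u_ge1 _ h (2 * m)) => //.
      apply: measurable_funM; last exact: dominated_measurable dh.
      exact: measurable_funM.
    by move=> x; rewrite !normrM ler_wpM2r// ger0_norm// ler_wpM2l.
  apply: (@le_dominated _ _ _ _ u_ge1 _ g m) => //.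
    exact: measurable_funX.
  by move=> x; rewrite normrX expr2 ler_wpM2r.
have -> : \int[pi]_x block_square x = \int[pi]_x (2 * g x * h x - g x ^+ 2) +
    \int[pi]_x \int[Q x]_y block_square y.
  rewrite -(dominated_RintegralD mu u_ge1 wpi dgh (dominatedQ mu u_ge1 Qu dq)).
  apply: eq_Rintegral => x _; rewrite block_squareE.
  by have := hE x; move: (h x) (\int[Q x]_y h y) (\int[Q x]_y _) => a b e ->; ring.
move: (\int[pi]_x _) (\int[pi]_x _ ) (_ * _) => I J k; lra.
Qed.

End stationary_identities.
End bounded_blocks.

(** * The exponential block functional and its supermartingale *)

Section exponential_block_functional.
Context d (T : measurableType d) (R : realType).
Variables (P : R.-pker T ~> T) (nu : probability T R) (C : set T) (delta : R).
Hypotheses (mC : measurable C) (delta_ge0 : 0 <= delta)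
  (small : small_set P C nu delta).
Local Notation Q := (residual mC delta_ge0 small).
Local Notation L := (block_law mC delta_ge0 small).
Variables (u : T -> R) (gam : R).
Hypotheses (mu : measurable_fun [set: T] u) (u_ge1 : forall x, 1 <= u x)
  (gam01 : 0 < gam < 1)
  (Qu : forall x, (\int[Q x]_y (u y)%:E <= (gam * u x)%:E)%E).
Variables (g : T -> R) (mg : measurable_fun [set: T] g) (m c K : R).
Hypotheses (m_gt0 : 0 < m) (g_le : forall x, `|g x| <= m) (c_gt0 : 0 < c)
  (K_ge1 : 1 <= K) (cK : expR c * (delta + K * gam) <= K).

Let gam_ge0 : 0 <= gam. Proof. by case/andP: gam01 => /ltW. Qed.
Let u_ge0 x : 0 <= u x. Proof. exact: le_trans ler01 (u_ge1 x). Qed.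
Let K_ge0 : 0 <= K. Proof. exact: le_trans ler01 K_ge1. Qed.

Local Notation W := (exp_weight m c).
Local Notation tau := (block_size m).
Local Notation W1 := (exp_weight_ge1 m c_gt0).
Local Notation mW := (measurable_exp_weight m c).
Local Notation shiftW := (exp_weight_shift m_gt0 g_le c_gt0).
Local Notation LW := (exp_weightL mu u_ge1 gam01 Qu mg m_gt0 g_le c_gt0 K_ge1 cK).
Local Notation h := (block_sum mC delta_ge0 small mg).

Let wL x : weighted W (L mg x).
Proof. exact: le_lt_trans (LW x) (ltry _). Qed.

Let r x := ln (2 * K * u x).

Let expr x : expR (r x) = 2 * K * u x.
Proof.
by rewrite lnK// posrE !mulr_gt0// ?(lt_le_trans ltr01)//.
Qed.

Let Rintegral_expR_tau x : \int[L mg x]_z expR (c * tau z) <= 2 * K * u x.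
Proof.
have dc : dominated W (fun z => expR (c * tau z)) by exact: dominated_expR_tau.
rewrite (@le_trans _ _ (\int[L mg x]_z W z))//.
  apply: (le_dominated_Rintegral mW W1 (wL x)) => //.
    exact: dominated_self mW W1.
  by move=> z; exact: expR_tau_le.
rewrite -lee_fin -(dominated_EFin mW W1 (wL x) (dominated_self mW W1)).
exact: LW.
Qed.

Let cstL := block_law_cst mu u_ge1 gam01 Qu mW W1 shiftW LW.

(** Jensen's inequality for the power [rho / c], obtained by integrating [expRM_le_convex] after
    centring the exponent at [ln (2 * K * u x)]. *)
Lemma expR_block_size_le rho x : 0 <= rho <= c ->
  \int[L mg x]_z expR (rho * tau z) <= expR (rho / c * ln (2 * K * u x)).
Proof.
move=> /andP[rho0 rhoc].
have p01 : 0 <= rho / c <= 1.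
  by rewrite divr_ge0 ?(ltW c_gt0)//= ler_pdivrMr// mul1r.
have dc : dominated W (fun z => expR (c * tau z)) by exact: dominated_expR_tau.
have dr : dominated W (fun z => expR (rho * tau z)) by exact: dominated_expR_tau.
have [p pE] : {p | p = rho / c} by exists (rho / c).
rewrite -pE -/(r x) in p01 *.
pose F z := expR (p * r x) * (1 - p) + expR (p * r x) * p * expR (- r x) * expR (c * tau z).
have d0 : dominated W (fun=> expR (p * r x) * (1 - p)) by exact: dominated_cst W1 _.
have d1 := dominatedZ (expR (p * r x) * p * expR (- r x)) dc.
rewrite (@le_trans _ _ (\int[L mg x]_z F z))//.
  apply: (le_dominated_Rintegral mW W1 (wL x)) => //; first exact: dominatedD.
  move=> z; rewrite /F -!mulrA -mulrDr -expRD.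
  have -> : rho * tau z = p * r x + p * (- r x + c * tau z).
    by rewrite pE; field; rewrite gt_eqF.
  by rewrite (expRD (p * r x)) ler_wpM2l ?expR_ge0// expRM_le_convex.
rewrite (dominated_RintegralD mW W1 (wL x) d0 d1) cstL.
rewrite (dominated_RintegralZ mW W1 _ (wL x) dc).
have k := Rintegral_expR_tau x; rewrite -expr in k.
have k' : expR (- r x) * \int[L mg x]_z expR (c * tau z) <= 1.
  rewrite (le_trans (ler_wpM2l (expR_ge0 _) k))//.
  by rewrite -expRD addNr expR0.
have p0 : 0 <= expR (p * r x) * p by rewrite mulr_ge0 ?expR_ge0//; case/andP: p01.
have := ler_wpM2l p0 k'.
move: (\int[L mg x]_z _) (expR (p * r x)) (expR (- r x)) => I e1 e2 H; lra.
Qed.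

(** Jensen's inequality for the power [- rho / c]. With [p = rho / c] and
    [Y = c * tau - ln (2 * K * u x)], one integrates [expR (- p * Y) >= 1 - p * Y >= 1 + p - p *
    expR Y], where [expR Y] has integral at most 1. *)
Lemma expRN_block_size_ge rho x : 0 <= rho <= c ->
  expR (- (rho / c * ln (2 * K * u x))) <= \int[L mg x]_z expR (- rho * tau z).
Proof.
move=> /andP[rho0 rhoc].
have p0 : 0 <= rho / c by rewrite divr_ge0 ?(ltW c_gt0).
have dc : dominated W (fun z => expR (c * tau z)) by exact: dominated_expR_tau.
have dn : dominated W (fun z => expR (- rho * tau z)).
  by apply: dominated_expR_tau => //; lra.
have [p pE] : {p | p = rho / c} by exists (rho / c).
rewrite -pE -/(r x) in p0 *.
have d0 a : dominated W (fun=> a) by exact: dominated_cst W1 _.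
pose G z := expR (- (p * r x)) * (1 + p) +
  - (expR (- (p * r x)) * p * expR (- r x)) * expR (c * tau z).
have d1 := dominatedZ (- (expR (- (p * r x)) * p * expR (- r x))) dc.
apply: (@le_trans _ _ (\int[L mg x]_z G z)); last first.
  apply: (le_dominated_Rintegral mW W1 (wL x)) => //; first exact: dominatedD.
  move=> z; rewrite /G.
  have -> : - rho * tau z = - (p * r x) + - (p * (- r x + c * tau z)).
    by rewrite pE; field; rewrite gt_eqF.
  have -> : expR (- (p * r x)) * (1 + p) +
      - (expR (- (p * r x)) * p * expR (- r x)) * expR (c * tau z) =
      expR (- (p * r x)) * (1 + p - p * expR (- r x + c * tau z)).
    by rewrite (expRD (- r x)); ring.
  rewrite (expRD (- (p * r x))) ler_wpM2l ?expR_ge0//.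
  have e1 := expR_ge1Dx (- (p * (- r x + c * tau z))).
  have := ler_wpM2l p0 (expR_ge1Dx (- r x + c * tau z)).
  move: e1; move: (- r x + _) => y; move: (expR _) (expR _) => A B'; lra.
rewrite (dominated_RintegralD mW W1 (wL x) (d0 _) d1) cstL.
rewrite (dominated_RintegralZ mW W1 _ (wL x) dc).
have k := Rintegral_expR_tau x; rewrite -expr in k.
have k' : expR (- r x) * \int[L mg x]_z expR (c * tau z) <= 1.
  rewrite (le_trans (ler_wpM2l (expR_ge0 _) k))//.
  by rewrite -expRD addNr expR0.
have e0 : 0 <= expR (- (p * r x)) * p by rewrite mulr_ge0 ?expR_ge0.
have := ler_wpM2l e0 k'.
move: (\int[L mg x]_z _) (expR (- (p * r x))) (expR (- r x)) => I e1 e2 H; lra.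
Qed.

Variables (theta a eps B : R).
Hypotheses (theta_ge0 : 0 <= theta) (theta_eps : theta * m <= eps)
  (a_ge0 : 0 <= a) (a_eps : a <= eps) (eps_c : 8 * eps <= c) (B_ge0 : 0 <= B).

Let expf (z : R * nat) : R := expR (theta * z.1 - a * z.2%:R).

Let eps_ge0 : 0 <= eps := le_trans a_ge0 a_eps.

Let thf z : `|theta * z.1| <= theta * m * tau z.
Proof. by rewrite normrM ger0_norm// -mulrA ler_wpM2l// le_tau_sum. Qed.

Let expf_le z : expf z <= expR (theta * m * tau z).
Proof.
rewrite /expf ler_expR; have := thf z; rewrite ler_norml => /andP[_].
have : 0 <= a * z.2%:R by rewrite mulr_ge0.
by move: (a * z.2%:R) (theta * z.1) => p q; lra.
Qed.

Let expf_ge z : expR (- (theta * m + a) * tau z) <= expf z.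
Proof.
rewrite /expf ler_expR; have := thf z; rewrite ler_norml => /andP[+ _].
have : a * z.2%:R <= a * tau z by rewrite ler_wpM2l// le_tau_length.
rewrite mulNr mulrDl.
by move: (a * z.2%:R) (a * tau z) (theta * z.1) => p q s; lra.
Qed.

Let dexpf : dominated W expf.
Proof.
apply: (dominated_tau (b := 1)) => [|z].
  apply: measurableT_comp => //; apply: measurable_funB.
    by apply: measurable_funM.
  by apply: measurable_funM => //; exact: measurable_block_length.
rewrite mul1r ger0_norm ?expR_ge0// (le_trans (expf_le z))// ler_expR.
apply: ler_wpM2r; first exact: tau_ge0.
by move: theta_eps eps_c eps_ge0; lra.
Qed.

(** [a] is the compensator per time step. Evaluated at [X n], this functional corrects the
    exponential of the partial sums for the block still in progress at time [n]. *)
Definition block_exp (x : T) : R := \int[L mg x]_z expR (theta * z.1 - a * z.2%:R).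

Local Notation U := block_exp.

Lemma dominated_block_exp : dominated u U.
Proof. have h := dominatedL mW W1 LW dexpf. exact: h. Qed.

Lemma block_expE x :
  U x = expR (theta * g x - a) * (delta * \1_C x + \int[Q x]_y U y).
Proof.
rewrite /U (Rintegral_block_law mu u_ge1 Qu mW W1 shiftW LW x dexpf)/=.
have wQ : weighted u (Q x) by exact: le_lt_trans (Qu x) (ltry _).
rewrite {1}/expf [a * _](mulr1 a) mulrDr; congr (_ + _); first exact: mulrC.
rewrite -(dominated_RintegralZ mu u_ge1 _ wQ dominated_block_exp).
apply: eq_Rintegral => y _.
rewrite -(dominated_RintegralZ mW W1 _ (wL y) dexpf).
apply: eq_Rintegral => z _.
by rewrite /expf -expRD; congr expR => /=; rewrite -natr1; ring.
Qed.

Lemma block_exp_le x : U x <= expR (theta * m / c * ln (2 * K * u x)).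
Proof.
have rc : 0 <= theta * m <= c.
  by rewrite mulr_ge0 ?(ltW m_gt0)//=; move: theta_eps eps_c eps_ge0; lra.
apply: le_trans (expR_block_size_le x rc).
apply: (le_dominated_Rintegral mW W1 (wL x)) => //.
by apply: dominated_expR_tau => //; case/andP: rc.
Qed.

Lemma block_exp_ge x : expR (- ((theta * m + a) / c * ln (2 * K * u x))) <= U x.
Proof.
have r0 : 0 <= theta * m + a by rewrite addr_ge0// mulr_ge0 ?(ltW m_gt0).
have rc : 0 <= theta * m + a <= c.
  by rewrite r0/=; move: theta_eps eps_c eps_ge0 a_eps; lra.
apply: le_trans (expRN_block_size_ge x rc) _.
apply: (le_dominated_Rintegral mW W1 (wL x)) => //.
by apply: dominated_expR_tau; move: r0 c_gt0; lra.
Qed.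

Section start_from_nu.
Variables (pi : probability T R) (N : R).
Hypotheses (piP : stationary P pi) (wpi : weighted u pi)
  (nu_u : (\int[nu]_x (u x)%:E <= N%:E)%E) (pig : \int[pi]_x g x = 0).

Let wnu : weighted u nu. Proof. exact: le_lt_trans nu_u (ltry _). Qed.

Let sig2 := \int[pi]_x (2 * g x * h x - g x ^+ 2).

Let Err : R := 3 * a * eps / c ^+ 2 + 4 * (6 / (c / 4) ^+ 3) *
  (a * eps ^+ 2 + (theta * m) ^+ 2 * eps * expR (- (c * B / 2))).

Hypothesis a_large : theta ^+ 2 * sig2 * (2^-1 + 4 * eps * B * expR (2 * eps * B))
  + Err * (2 * K * N) <= a.

(** Integrate [expR_block_bound] over a block started from [nu]. The linear term in [theta] vanishes
    and the square contributes [sig2] times the mean length; as this length is at least 1, the gain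
    of [a] per unit of length covers the quadratic term and the error by [a_large]. *)
Lemma block_exp_nu_le1 : \int[nu]_x U x <= 1.
Proof.
pose b := theta ^+ 2 * (2^-1 + 4 * eps * B * expR (2 * eps * B)).
have Err0 : 0 <= Err.
  have k0 : 0 <= 4 * (6 / (c / 4) ^+ 3).
    by rewrite mulr_ge0// divr_ge0// exprn_ge0// divr_ge0// ltW.
  apply: addr_ge0; first by rewrite divr_ge0 ?exprn_ge0 ?(ltW c_gt0)// !mulr_ge0.
  apply: mulr_ge0 => //; apply: addr_ge0; first by rewrite mulr_ge0// exprn_ge0.
  by rewrite mulr_ge0 ?expR_ge0// mulr_ge0// sqr_ge0.
have d1 := dominated_sum m_gt0 c_gt0.
have d2 := dominated_sum2 m_gt0 c_gt0.
have dl := dominated_length m c_gt0.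
have dW := dominated_self mW W1.
have dc (e : R) : dominated W (fun=> e) by exact: dominated_cst W1 _.
have U_le x : U x <= 1 + theta * h x - a * block_length mC delta_ge0 small mg x +
    b * block_square mC delta_ge0 small mg x + Err * (2 * K * u x).
  pose F z := 1 + theta * z.1 - a * z.2%:R + b * z.1 ^+ 2 + Err * W z.
  have D1 := dominatedZ theta d1; have D2 := dominatedZ b d2.
  have D3 := dominatedZ a dl; have D4 := dominatedZ Err dW.
  have dF : dominated W F by do 2 apply: dominatedD => //; apply: dominatedB => //; apply: dominatedD.
  have UF : U x <= \int[L mg x]_z F z.
    apply: (le_dominated_Rintegral mW W1 (wL x)) => // z.
    have := expR_block_bound m_gt0 c_gt0 theta_ge0 theta_eps a_ge0 a_eps eps_c
      (ler0n _ z.2) (le_tau_length m z) (le_tau_sum m_gt0 z) B_ge0.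
    rewrite -/Err /F => /le_trans; apply.
    apply: lerD; first by rewrite /b mulrAC.
    by rewrite ler_wpM2l// expR_tau_le.
  apply: (le_trans UF).
  rewrite (dominated_RintegralD mW W1 (wL x)
    (dominatedD (dominatedB (dominatedD (dc 1) D1) D3) D2) D4).
  rewrite (dominated_RintegralD mW W1 (wL x) (dominatedB (dominatedD (dc 1) D1) D3) D2).
  rewrite (dominated_RintegralB mW W1 (wL x) (dominatedD (dc 1) D1) D3).
  rewrite (dominated_RintegralD mW W1 (wL x) (dc 1) D1) cstL.
  rewrite !(dominated_RintegralZ mW W1 _ (wL x))//.
  rewrite lerD2l ler_wpM2l//.
  rewrite -lee_fin -(dominated_EFin mW W1 (wL x) dW); exact: LW.
have dh : dominated u h := dominatedL mW W1 LW d1.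
have dlen := dominated_block_length mu u_ge1 gam01 Qu mg m_gt0 g_le c_gt0 K_ge1 cK.
have dsq := dominated_block_square mu u_ge1 gam01 Qu mg m_gt0 g_le c_gt0 K_ge1 cK.
have du := dominated_self mu u_ge1.
have duc (e : R) : dominated u (fun=> e) by exact: dominated_cst u_ge1 _.
have D1 := dominatedZ theta dh; have D2 := dominatedZ b dsq.
have D3 := dominatedZ a dlen; have D4 := dominatedZ Err (dominatedZ (2 * K) du).
have dB := dominatedD (dominatedD (dominatedB (dominatedD (duc 1) D1) D3) D2) D4.
apply: le_trans (le_dominated_Rintegral mu u_ge1 wnu dominated_block_exp dB U_le) _.
rewrite (dominated_RintegralD mu u_ge1 wnu
  (dominatedD (dominatedB (dominatedD (duc 1) D1) D3) D2) D4).
rewrite (dominated_RintegralD mu u_ge1 wnu (dominatedB (dominatedD (duc 1) D1) D3) D2).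
rewrite (dominated_RintegralB mu u_ge1 wnu (dominatedD (duc 1) D1) D3).
rewrite (dominated_RintegralD mu u_ge1 wnu (duc 1) D1) probability_Rintegral_cst.
rewrite (dominated_RintegralZ mu u_ge1 _ wnu dh).
rewrite (dominated_RintegralZ mu u_ge1 _ wnu dlen).
rewrite (dominated_RintegralZ mu u_ge1 _ wnu dsq).
rewrite (dominated_RintegralZ mu u_ge1 _ wnu (dominatedZ (2 * K) du)).
rewrite (dominated_RintegralZ mu u_ge1 _ wnu du).
have hN : \int[nu]_x u x <= N by rewrite -lee_fin -(dominated_EFin mu u_ge1 wnu du).
have := block_sum_mean0 mu u_ge1 gam01 Qu mg m_gt0 g_le c_gt0 K_ge1 cK piP wpi wnu pig.
move=> ->.
have kac := block_length_kac mu u_ge1 gam01 Qu mg m_gt0 g_le c_gt0 K_ge1 cK piP wpi wnu.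
have sq := block_square_mean mu u_ge1 gam01 Qu mg m_gt0 g_le c_gt0 K_ge1 cK piP wpi wnu.
have len1 : 1 <= \int[nu]_x block_length mC delta_ge0 small mg x.
  rewrite -[leLHS](probability_Rintegral_cst nu).
  apply: (le_dominated_Rintegral mu u_ge1 wnu) => // x.
  exact: (block_length_ge1 mu u_ge1 gam01 Qu mg m_gt0 g_le c_gt0 K_ge1 cK).
move: kac sq len1; rewrite -/sig2.
move: (\int[nu]_x block_length _ _ _ _ x) (\int[nu]_x block_square _ _ _ _ x).
move: (regeneration_rate _ _ _) => rate len sq kac sqE len1.
have {sqE} sqE : sq = len * sig2 by rewrite -sqE mulrA [len * _]mulrC kac mul1r.
have hE : Err * (2 * K * \int[nu]_x u x) <= Err * (2 * K * N).
  by rewrite ler_wpM2l// ler_wpM2l// mulr_ge0.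
have ErrN : 0 <= Err * (2 * K * N).
  rewrite mulr_ge0// mulr_ge0 ?mulr_ge0// (le_trans _ hN)//.
  exact: Rintegral_ge0.
have aE : a * len >= (theta ^+ 2 * sig2 * (2^-1 + 4 * eps * B * expR (2 * eps * B))
  + Err * (2 * K * N)) * len by rewrite ler_wpM2r// (le_trans ler01).
have ErrL : Err * (2 * K * N) <= Err * (2 * K * N) * len by rewrite ler_peMr.
rewrite sqE mulr0 addr0 -/b.
have -> : b * (len * sig2) = theta ^+ 2 * sig2 *
  (2^-1 + 4 * eps * B * expR (2 * eps * B)) * len by rewrite /b; ring.
move: aE hE ErrL; rewrite mulrDl.
move: (Err * _) (Err * _) (_ * len) (_ * len) (a * len) => p q s v w'; lra.
Qed.

(** In the first-step equation of [U] a regeneration counts 1, whereas under [P] it counts the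
    integral of [U] against [nu], which is at most 1. The inequality thus concerns [P] itself, and
    no split chain has to be realised. *)
Lemma block_exp_supermartingale x :
  ((expR (theta * g x - a))%:E * \int[P x]_y (U y)%:E <= (U x)%:E)%E.
Proof.
have dU := dominated_block_exp.
have wP : weighted u (P x).
  have mEu : measurable_fun [set: T] (EFin \o u) by exact/measurable_EFinP.
  have Eu0 y : (0 <= (EFin \o u) y)%E by rewrite lee_fin.
  rewrite /weighted (ge0_integral_splitting mC delta_ge0 small x mEu Eu0).
  apply: lte_add_pinfty; first exact: le_lt_trans (Qu x) (ltry _).
  by apply: lte_mul_pinfty => //; rewrite lee_fin mulr_ge0.
rewrite (dominated_EFin mu u_ge1 wP dU) -EFinM lee_fin block_expE.
rewrite ler_wpM2l ?expR_ge0// (P_splitting mu u_ge1 Qu x wnu dU) addrC lerD2r.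
by rewrite ler_piMr ?block_exp_nu_le1// mulr_ge0.
Qed.

End start_from_nu.
End exponential_block_functional.

(** * Contraction of weighted oscillations *)

Section weak_contraction.
Context d (T : measurableType d) (R : realType).
Variables (P : R.-pker T ~> T) (nu : probability T R) (C D : set T) (delta : R)
  (u : T -> R) (gam b : R).
Hypotheses (mC : measurable C) (mD : measurable D) (DC : D `<=` C)
  (delta_gt0 : 0 < delta) (delta_le1 : delta <= 1)
  (small : small_set P C nu delta) (nuC : (0 < nu C)%E)
  (mu : measurable_fun [set: T] u) (u_ge1 : forall x, 1 <= u x)
  (gam01 : 0 < gam < 1) (b_ge0 : 0 <= b)
  (Pu : forall x, (\int[P x]_y (u y)%:E <= (gam * u x + b)%:E)%E)
  (PuD : forall x, ~ D x -> (\int[P x]_y (u y)%:E <= (gam * u x)%:E)%E)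
  (wnu : weighted u nu).

Let u_ge0 x : 0 <= u x. Proof. exact: le_trans ler01 (u_ge1 x). Qed.
Let gam_ge0 : 0 <= gam. Proof. by case/andP: gam01 => /ltW. Qed.
Let gam_lt1 : gam < 1. Proof. by case/andP: gam01. Qed.

Let Pu' x : (\int[P x]_y (u y)%:E <= ((gam + b) * u x)%:E)%E.
Proof. by apply: le_trans (Pu x) _; rewrite lee_fin mulrDl lerD2l ler_peMr. Qed.

Let wP x : weighted u (P x).
Proof. exact: le_lt_trans (Pu x) (ltry _). Qed.

Definition transition (f : T -> R) (x : T) : R := \int[P x]_y f y.

Lemma dominated_transition f : dominated u f -> dominated u (transition f).
Proof. by move=> df; apply: (@dominated_kernel _ _ _ _ _ P u u (gam + b)). Qed.

Lemma dominated_iter_transition n f : dominated u f ->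
  dominated u (iter n transition f).
Proof. by move=> df; elim: n => //= n IH; exact: dominated_transition. Qed.

Lemma transition_cst c x : transition (fun=> c) x = c.
Proof.
rewrite /transition /Rintegral (@integral_cst _ _ _ (P x) _ measurableT c%:E).
by rewrite prob_kernel mule1.
Qed.

Lemma le_transition f g x : dominated u f -> dominated u g ->
  (forall y, f y <= g y) -> transition f x <= transition g x.
Proof. by move=> df dg; exact: (le_dominated_Rintegral mu u_ge1 (wP x)). Qed.

Lemma transitionD f g x : dominated u f -> dominated u g ->
  transition (fun y => f y + g y) x = transition f x + transition g x.
Proof. by move=> df dg; exact: (dominated_RintegralD mu u_ge1 (wP x)). Qed.

Lemma transitionB f g x : dominated u f -> dominated u g ->
  transition (fun y => f y - g y) x = transition f x - transition g x.
Proof. by move=> df dg; exact: (dominated_RintegralB mu u_ge1 (wP x)). Qed.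

Lemma transitionZ c f x : dominated u f ->
  transition (fun y => c * f y) x = c * transition f x.
Proof. by move=> df; exact: (dominated_RintegralZ mu u_ge1 c (wP x)). Qed.

Lemma le_iter_transition n f g x : dominated u f -> dominated u g ->
  (forall y, f y <= g y) -> iter n transition f x <= iter n transition g x.
Proof.
move=> df dg fg; elim: n x => [|n IH] x//=.
by apply: le_transition => //; exact: dominated_iter_transition.
Qed.

Lemma iter_transitionD n f g x : dominated u f -> dominated u g ->
  iter n transition (fun y => f y + g y) x =
  iter n transition f x + iter n transition g x.
Proof.
move=> df dg; elim: n x => [|n IH] x//=.
rewrite -transitionD; try exact: dominated_iter_transition.
by congr (transition _ x); apply/funext => y; exact: IH.
Qed.

Lemma iter_transitionZ n c f x : dominated u f ->
  iter n transition (fun y => c * f y) x = c * iter n transition f x.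
Proof.
move=> df; elim: n x => [|n IH] x//=.
rewrite -transitionZ; last exact: dominated_iter_transition.
by congr (transition _ x); apply/funext => y; exact: IH.
Qed.

Lemma iter_transition_cst n c x : iter n transition (fun=> c) x = c.
Proof.
elim: n x => [|n IH] x//=; rewrite -[RHS](transition_cst c x).
by congr (transition _ x); apply/funext => y; exact: IH.
Qed.

Let du : dominated u u := dominated_self mu u_ge1.
Let dcst c : dominated u (fun=> c) := dominated_cst u_ge1 c.

Lemma transition_weight x : transition u x <= gam * u x + b.
Proof. by rewrite -lee_fin -(dominated_EFin mu u_ge1 (wP x) du). Qed.

Let K : R := b / (1 - gam) + 1.

Let K_ge0 : 0 <= K.
Proof. by rewrite addr_ge0// divr_ge0// subr_ge0 ltW. Qed.

Lemma iter_transition_weight n x : iter n transition u x <= gam ^+ n * u x + K.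
Proof.
have KE : gam * K + b <= K.
  have g0 : 1 - gam != 0 by rewrite subr_eq0 gt_eqF.
  have bE : b = (1 - gam) * (b / (1 - gam)) by field.
  rewrite {1}bE /K; move: (b / (1 - gam)) => q.
  by move: gam_lt1; lra.
elim: n x => [|n IH] x; first by rewrite expr0 mul1r lerDl.
rewrite iterSr.
have dr : dominated u (fun y => gam * u y + b).
  by apply: dominatedD => //; exact: dominatedZ.
apply: le_trans (le_iter_transition n x (dominated_transition du) dr transition_weight) _.
rewrite (iter_transitionD n x (dominatedZ _ du) (dcst b)) iter_transition_cst.
rewrite (iter_transitionZ n _ x du) exprS -mulrA.
by have := ler_wpM2l gam_ge0 (IH x); lra.
Qed.

Let nuf_ge0 f : (forall y, 0 <= f y) -> 0 <= \int[nu]_y f y.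
Proof. by move=> f0; apply: Rintegral_ge0. Qed.

Lemma iter_transition_ge0 n f x : dominated u f -> (forall y, 0 <= f y) ->
  0 <= iter n transition f x.
Proof.
move=> df f0; rewrite -(iter_transition_cst n 0 x).
exact: le_iter_transition.
Qed.

Let small_ge f x : dominated u f -> (forall y, 0 <= f y) -> C x ->
  delta * \int[nu]_y f y <= transition f x.
Proof.
move=> df f0 Cx; have mEf : measurable_fun [set: T] (EFin \o f).
  by apply/measurable_EFinP; case: df.
have Ef0 y : (0 <= (EFin \o f) y)%E by rewrite lee_fin.
rewrite -lee_fin /transition EFinM -(dominated_EFin mu u_ge1 (wP x) df).
rewrite -(dominated_EFin mu u_ge1 wnu df).
rewrite (ge0_integral_splitting mC (ltW delta_gt0) small x mEf Ef0).
rewrite indicE mem_set// mulr1; apply: leeDr.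
by apply: integral_ge0 => y _; rewrite lee_fin.
Qed.

Let eps0 : R := delta * fine (nu C).

Let eps01 : 0 < eps0 <= 1.
Proof.
have nuC1 : (nu C <= 1)%E by apply: probability_le1.
have nufin : nu C \is a fin_num by rewrite fin_num_measure.
rewrite mulr_gt0//=; last by rewrite fine_gt0// nuC ltey_eq nufin.
rewrite -[leRHS]mulr1 ler_pM// ?fine_ge0//; first exact: ltW.
by rewrite -lee_fin fineK.
Qed.

Let dindic A : measurable A -> dominated u (\1_A : T -> R).
Proof.
move=> mA; split=> //; exists 1 => x; rewrite mul1r ger0_norm//.
by apply: le_trans (u_ge1 x); rewrite indicE lern1 leq_b1.
Qed.

Let nu_indic : \int[nu]_y (\1_C y : R) = fine (nu C).
Proof. by rewrite /Rintegral integral_indic// setIT. Qed.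

(* Once in [C] the chain may stay there, hence strong aperiodicity gives a
   minorization in any fixed number of steps. *)
Let small_iter f k x : dominated u f -> (forall y, 0 <= f y) -> C x ->
  eps0 ^+ k * (delta * \int[nu]_y f y) <= iter k.+1 transition f x.
Proof.
move=> df f0; have nf0 := nuf_ge0 f0.
elim: k x => [|k IH] x Cx; first by rewrite expr0 mul1r; exact: small_ge.
have dk := dominated_iter_transition k.+1 df.
apply: le_trans (small_ge dk (fun y => iter_transition_ge0 _ y df f0) Cx).
pose e := eps0 ^+ k * (delta * \int[nu]_y f y).
have e0 : 0 <= e.
  rewrite mulr_ge0// ?exprn_ge0//; first by case/andP: eps01 => /ltW.
  by rewrite mulr_ge0// ltW.
have -> : eps0 ^+ k.+1 * (delta * \int[nu]_y f y) =
    delta * \int[nu]_y (e * \1_C y).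
  rewrite (dominated_RintegralZ mu u_ge1 _ wnu (dindic mC)) nu_indic.
  by rewrite /e exprS /eps0; ring.
apply: ler_wpM2l; first exact: ltW.
apply: (le_dominated_Rintegral mu u_ge1 wnu) => //.
  by apply: dominatedZ; exact: dindic.
move=> y; rewrite indicE; have [/set_mem Cy|] := boolP (y \in C).
  by rewrite mulr1; exact: IH.
by rewrite mulr0 => _; exact: iter_transition_ge0.
Qed.

(** The probability of visiting [D] at one of the times from 0 to [n], written as a first-step
    recursion. *)
Let hit : nat -> T -> R := fix hit n := if n is n'.+1 then
  fun x => \1_D x + \1_(~` D) x * transition (hit n') x else \1_D.

Let hit_prop n : dominated u (hit n) /\ forall x, 0 <= hit n x <= 1.
Proof.
elim: n => [|n [dn IH]] /=.
  by split=> [|x]; [exact: dindic|rewrite indicE ler0n lern1 leq_b1].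
have dt := dominated_transition dn.
have t01 x : 0 <= transition (hit n) x <= 1.
  rewrite -{1}(transition_cst 0 x) -(transition_cst 1 x).
  by apply/andP; split; apply: le_transition => // y; case/andP: (IH y).
split=> [|x].
  apply: dominatedD; first exact: dindic.
  apply: (@le_dominated _ _ _ _ u_ge1 _ (transition (hit n)) 1) => //.
    apply: measurable_funM; last exact: dominated_measurable dt.
    by apply: measurable_indic; exact: measurableC.
  move=> x; rewrite normrM ler_wpM2r// ger0_norm// indicE lern1 leq_b1//.
have [Dx|nDx] := pselect (D x); rewrite !indicE.
  by rewrite mem_set// memNset ?mul0r ?addr0 ?ler01 ?lexx//; exact.
by rewrite memNset// mem_set// add0r mul1r.
Qed.

Let hit01 n x : 0 <= hit n x <= 1.
Proof. by case: (hit_prop n). Qed.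

Let dhit n : dominated u (hit n).
Proof. by case: (hit_prop n). Qed.

(** If [D] is reached at a time [j <= n], the remaining steps are spent as in [small_iter]. Strong
    aperiodicity makes the total number of steps independent of [j]. *)
Let hit_minor n f x : dominated u f -> (forall y, 0 <= f y) ->
  eps0 ^+ n * (delta * \int[nu]_y f y) * hit n x <= iter n.+1 transition f x.
Proof.
move=> df f0; have nf0 := nuf_ge0 f0.
have e0 : 0 <= eps0 by case/andP: eps01 => /ltW.
have q0 k : 0 <= eps0 ^+ k * (delta * \int[nu]_y f y).
  by rewrite mulr_ge0 ?exprn_ge0// mulr_ge0// ltW.
have inD k y : D y -> eps0 ^+ k * (delta * \int[nu]_y f y) * hit k y <=
    iter k.+1 transition f y.
  move=> Dy; apply: le_trans (small_iter k df f0 (DC Dy)).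
  by rewrite ler_piMr//; case/andP: (hit01 k y).
have [Dx|nDx] := pselect (D x); first exact: inD.
elim: n x nDx => [|n IH] x nDx.
  by rewrite /= indicE memNset// mulr0; exact: (iter_transition_ge0 1).
rewrite [hit _ _]/= !indicE memNset// mem_set// add0r mul1r.
have dk := dominated_iter_transition n.+1 df.
have dqh := dominatedZ (eps0 ^+ n * (delta * \int[nu]_y f y)) (dhit n).
apply: (@le_trans _ _ (transition (fun y => eps0 ^+ n * (delta * \int[nu]_y f y) * hit n y) x)).
  rewrite transitionZ// ler_wpM2r//.
    rewrite -(transition_cst 0 x); apply: le_transition => // y.
    by case/andP: (hit01 n y).
  rewrite ler_wpM2r//; first by rewrite mulr_ge0// ltW.
  by rewrite exprS ler_piMl ?exprn_ge0//; case/andP: eps01.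
apply: le_transition => // y.
by have [Dy|nDy] := pselect (D y); [exact: inD|exact: IH].
Qed.

(** Off [D] the drift shrinks the mean of [u] by [gam], so each further step spent avoiding [D]
    costs this factor. *)
Let hit_ge n x : 1 - hit n x <= gam ^+ n * u x.
Proof.
elim: n x => [|n IH] x.
  rewrite expr0 mul1r; apply: le_trans (u_ge1 x).
  by rewrite gerBl.
have [Dx|nDx] := pselect (D x).
  rewrite /= !indicE mem_set// memNset//.
  by rewrite mul0r addr0 subrr mulr_ge0// exprn_ge0.
rewrite /= !indicE memNset// mem_set// add0r mul1r -(transition_cst 1 x).
rewrite -transitionB//.
have dg := dominatedZ (gam ^+ n) du.
apply: le_trans (le_transition x (dominatedB (dcst 1) (dhit n)) dg IH) _.
rewrite transitionZ// exprSr -mulrA ler_wpM2l ?exprn_ge0//.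
by rewrite -lee_fin -(dominated_EFin mu u_ge1 (wP x) du); exact: PuD.
Qed.

(** [n] is so large that [D] is visited with probability at least 1/2 from every point where
    [u <= r]. *)
Let sublevel_minor r : exists m, exists2 e, 0 < e <= 1 &
  forall f x, dominated u f -> (forall y, 0 <= f y) -> u x <= r ->
    e * \int[nu]_y f y <= iter m.+1 transition f x.
Proof.
have : (fun n => gam ^+ n * r) @ \oo --> (0 : R).
  rewrite -[0](mul0r r); apply: cvgM; last exact: cvg_cst.
  by apply: cvg_expr; rewrite ger0_norm.
move=> /cvgr_lt /(_ 2^-1) []; first by rewrite invr_gt0.
move=> n _ /(_ n (leqnn n)) /= gn.
have [e0 e1] := andP eps01.
exists n, (eps0 ^+ n * delta / 2).
  rewrite !mulr_gt0 ?exprn_gt0 ?invr_gt0//=.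
  have : eps0 ^+ n * delta <= 1 by rewrite mulr_ile1 ?exprn_ge0 ?exprn_ile1// ltW.
  lra.
move=> f x df f0 ur; apply: le_trans (hit_minor n x df f0).
have q0 : 0 <= eps0 ^+ n * (delta * \int[nu]_y f y).
  exact: mulr_ge0 (exprn_ge0 _ (ltW e0)) (mulr_ge0 (ltW delta_gt0) (nuf_ge0 f0)).
have h2 : 2^-1 <= hit n x.
  have := hit_ge n x; have : gam ^+ n * u x <= gam ^+ n * r.
    by rewrite ler_wpM2l// exprn_ge0.
  by move: gn; lra.
have := ler_wpM2l q0 h2; move: (hit n x) (\int[nu]_y _) => a I; lra.
Qed.

(** The centre is the supremum of [f - A * (1 + beta * u)], which by hypothesis stays below
    [f + A * (1 + beta * u)] everywhere. *)
Let oscillation_centre (A beta : R) (f : T -> R) (x0 : T) :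
  (forall x y, `|f x - f y| <= A * (2 + beta * u x + beta * u y)) ->
  exists k, forall x, `|f x - k| <= A * (1 + beta * u x).
Proof.
move=> fA; pose S := [set f x - A * (1 + beta * u x) | x in [set: T]].
have Sub y : ubound S (f y + A * (1 + beta * u y)).
  move=> _ [x _ <-]; have := fA x y; rewrite ler_norml.
  by move: (f x) (f y) (u x) (u y) => a b' c e /andP[_]; lra.
have S0 : S !=set0 by exists (f x0 - A * (1 + beta * u x0)); exists x0.
have hS : has_sup S by split=> //; exists (f x0 + A * (1 + beta * u x0)).
exists (sup S) => x; rewrite ler_norml; apply/andP; split.
  have : sup S <= f x + A * (1 + beta * u x) by apply: ge_sup => //; exact: Sub.
  by lra.
have : f x - A * (1 + beta * u x) <= sup S.
  by apply: ub_le_sup; [case: hS|exists x].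
by lra.
Qed.

Let K_gt0 : 0 < K.
Proof. by rewrite ltr_pwDr// divr_ge0// subr_ge0 ltW. Qed.

Let weight_le n x : iter n.+1 transition u x <= gam * u x + K.
Proof.
apply: le_trans (iter_transition_weight n.+1 x) _; rewrite lerD2r ler_wpM2r//.
by rewrite exprS ler_piMr// exprn_ile1// ltW.
Qed.

Let iter_centre n (A beta k : R) f x : 0 <= A -> 0 <= beta -> dominated u f ->
  (forall x, `|f x - k| <= A * (1 + beta * u x)) ->
  `|iter n.+1 transition f x - k| <= A * (1 + beta * (gam * u x + K)).
Proof.
move=> A0 beta0 df fk.
have dr : dominated u (fun y => A + A * beta * u y).
  by apply: dominatedD => //; exact: dominatedZ.
have up : iter n.+1 transition (fun y => A + A * beta * u y) x <=
    A * (1 + beta * (gam * u x + K)).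
  rewrite (iter_transitionD _ x (dcst A) (dominatedZ _ du)) iter_transition_cst.
  rewrite (iter_transitionZ _ _ x du).
  have := ler_wpM2l (mulr_ge0 A0 beta0) (weight_le n x).
  by move: (iter _ _ u x) => v; lra.
have dk := dominatedD df (dcst (- k)).
have dk' := dominatedZ (-1) dk.
have le1 y : f y + - k <= A + A * beta * u y.
  by have := fk y; rewrite ler_norml => /andP[_]; lra.
have le2 y : -1 * (f y + - k) <= A + A * beta * u y.
  by have := fk y; rewrite ler_norml => /andP[+ _]; lra.
have h1 := le_iter_transition n.+1 x dk dr le1.
have h2 := le_iter_transition n.+1 x dk' dr le2.
rewrite (iter_transitionZ _ _ x dk) in h2.
rewrite (iter_transitionD _ x df (dcst _)) iter_transition_cst in h1 h2.
by rewrite ler_norml; apply/andP; split; move: up h1 h2; lra.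
Qed.

(* The Hairer-Mattingly contraction: on a sublevel set of [u] the minorization
   contracts oscillations, outside of it the drift does. *)
Lemma weak_contraction : exists m : nat, exists beta rho : R,
  [/\ 0 < beta, 0 < rho < 1 & forall A f, dominated u f ->
    (forall x y, `|f x - f y| <= A * (2 + beta * u x + beta * u y)) ->
    forall x y, `|iter m.+1 transition f x - iter m.+1 transition f y| <=
      rho * A * (2 + beta * u x + beta * u y)].
Proof.
have g1 : 0 < 1 - gam by rewrite subr_gt0.
(* Once [u x + u y > r], the drift constant [2 * K] of the two points is at most half of
   [(1 - gam) * (u x + u y)]. *)
pose r := 4 * K / (1 - gam).
have r0 : 0 < r by rewrite divr_gt0// mulr_gt0.
have rK : (1 - gam) * r = 4 * K by rewrite /r mulrC divfK// gt_eqF.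
have [m [e /andP[e0 e1] minor]] := sublevel_minor r.
(* With this weight the drift constants of the two points cost [2 * beta * K = e], which is half of
   the gain [2 * e] due to the minorization. *)
pose beta := e / (2 * K).
have beta0 : 0 < beta by rewrite divr_gt0// mulr_gt0.
have betaK : 2 * beta * K = e by rewrite /beta; field; rewrite gt_eqF.
(* A lower bound for the share of [beta * (u x + u y)] in [2 + beta * (u x + u y)] when
   [u x + u y > r]; it converts contraction of the weight into contraction of the whole. *)
pose t := beta * r / (2 + beta * r).
have br0 : 0 < beta * r by rewrite mulr_gt0.
have t01 : 0 < t < 1.
  rewrite divr_gt0//=; last by rewrite addr_gt0.
  by rewrite ltr_pdivrMr ?addr_gt0// mul1r ltrDr.
have tE : t * (2 + beta * r) = beta * r by rewrite /t divfK// gt_eqF// addr_gt0.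
have [t0 t1] := andP t01.
pose rho := Num.max (1 - (1 - gam) / 2 * t) (Num.max (1 - e / 2) gam).
exists m, beta, rho; split=> //.
  have h1 : 0 < (1 - gam) / 2 * t by apply: mulr_gt0 => //; rewrite divr_gt0.
  rewrite /rho !lt_max !gt_max; have /andP[-> ->] := gam01.
  rewrite !orbT/= andbT; apply/andP; split; first by move: h1; lra.
  by move: e0; lra.
move=> A f df fA.
have rho1 : 1 - (1 - gam) / 2 * t <= rho by rewrite /rho le_max lexx.
have rho2 : 1 - e / 2 <= rho by rewrite /rho !le_max lexx orbT.
have rho3 : gam <= rho by rewrite /rho !le_max lexx !orbT.
move: rho rho1 rho2 rho3 => rho rho1 rho2 rho3.
suff one x y : iter m.+1 transition f x - iter m.+1 transition f y <=
    rho * A * (2 + beta * u x + beta * u y).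
  move=> x y; rewrite ler_norml one andbT.
  by have := one y x; move: (iter _ _ _ _) (iter _ _ _ _) (u x) (u y) => ? ? ? ?; lra.
have u_gt0 z : 0 < u z := lt_le_trans ltr01 (u_ge1 z).
have pos z z' : 0 < 2 + beta * u z + beta * u z' by rewrite !addr_gt0// mulr_gt0.
have A0 : 0 <= A.
  have := fA x x; rewrite subrr normr0 pmulr_lge0//.
have [k fk] := oscillation_centre x fA.
have cx := iter_centre m x A0 (ltW beta0) df fk.
have cy := iter_centre m y A0 (ltW beta0) df fk.
have Sge : 0 <= u x + u y by rewrite addr_ge0.
have [Sr|rS] := leP (u x + u y) r.
  have dA : dominated u (fun z => A + A * beta * u z).
    by apply: dominatedD => //; exact: dominatedZ.
  have dfk := dominatedD df (dcst (- k)).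
  have F1 z : 0 <= A + A * beta * u z - (f z + - k).
    by have := fk z; rewrite ler_norml => /andP[_]; lra.
  have F2 z : 0 <= A + A * beta * u z + (f z + - k).
    by have := fk z; rewrite ler_norml => /andP[+ _]; lra.
  have ux : u x <= r by apply: le_trans Sr; rewrite lerDl.
  have uy : u y <= r by apply: le_trans Sr; rewrite lerDr.
  have m1 := minor _ x (dominatedB dA dfk) F1 ux.
  have m2 := minor _ y (dominatedD dA dfk) F2 uy.
  have I : 2 * A <= \int[nu]_z (A + A * beta * u z - (f z + - k)) +
      \int[nu]_z (A + A * beta * u z + (f z + - k)).
    rewrite (dominated_RintegralB mu u_ge1 wnu dA dfk).
    rewrite (dominated_RintegralD mu u_ge1 wnu dA dfk).
    rewrite (dominated_RintegralD mu u_ge1 wnu (dcst A) (dominatedZ _ du)).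
    rewrite probability_Rintegral_cst (dominated_RintegralZ mu u_ge1 _ wnu du).
    have nu0 := nuf_ge0 u_ge0.
    have := mulr_ge0 (mulr_ge0 A0 (ltW beta0)) nu0.
    by move: (\int[nu]_z _) (\int[nu]_z _) => I J; lra.
  have eI := ler_wpM2l (ltW e0) I.
  have iB : iter m.+1 transition (fun z => A + A * beta * u z - (f z + - k)) x =
    A + A * beta * iter m.+1 transition u x - (iter m.+1 transition f x - k).
    have -> : (fun z => A + A * beta * u z - (f z + - k)) =
      (fun z => A + A * beta * u z + -1 * (f z + - k)).
      by apply/funext => z; rewrite mulN1r.
    rewrite (iter_transitionD _ x dA (dominatedZ _ dfk)) (iter_transitionZ _ _ x dfk).
    rewrite (iter_transitionD _ x df (dcst _)).
    rewrite (iter_transitionD _ x (dcst A) (dominatedZ _ du)) !iter_transition_cst.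
    by rewrite (iter_transitionZ _ _ x du) mulN1r.
  have iD : iter m.+1 transition (fun z => A + A * beta * u z + (f z + - k)) y =
    A + A * beta * iter m.+1 transition u y + (iter m.+1 transition f y - k).
    rewrite (iter_transitionD _ y dA dfk) (iter_transitionD _ y df (dcst _)).
    rewrite (iter_transitionD _ y (dcst A) (dominatedZ _ du)) !iter_transition_cst.
    by rewrite (iter_transitionZ _ _ y du).
  rewrite iB in m1; rewrite iD in m2.
  have Ab : 0 <= A * beta by rewrite mulr_ge0// ltW.
  have wx := ler_wpM2l Ab (weight_le m x); have wy := ler_wpM2l Ab (weight_le m y).
  have key : iter m.+1 transition f x - iter m.+1 transition f y <=
      A * (2 - e + gam * (beta * (u x + u y))).
    have : A * beta * K * 2 = A * e by rewrite -betaK; ring.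
    move: m1 m2 wx wy eI.
    move: (iter _ _ _ _) (iter _ _ _ _) (iter _ _ _ _) (iter _ _ _ _) => a1 a2 a3 a4.
    by move: (\int[nu]_z _) (\int[nu]_z _) => I1 I2; lra.
  apply: (le_trans key).
  have h1 : 2 - e <= 2 * rho by move: rho2; lra.
  have h2 := ler_wpM2r (mulr_ge0 (ltW beta0) Sge) rho3.
  have h3 : 2 - e + gam * (beta * (u x + u y)) <= rho * (2 + beta * u x + beta * u y).
    by move: h1 h2; lra.
  have := ler_wpM2l A0 h3; lra.
have key : iter m.+1 transition f x - iter m.+1 transition f y <=
    A * (2 + beta * (gam * (u x + u y) + 2 * K)).
  move: cx cy; rewrite !ler_norml => /andP[_ cx] /andP[cy _].
  by move: cx cy; move: (iter _ _ _ _) (iter _ _ _ _) => a1 a2; lra.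
apply: (le_trans key).
have h1 : (1 - gam) / 2 * t * (2 + beta * (u x + u y)) <=
    (1 - gam) / 2 * (beta * (u x + u y)).
  rewrite -mulrA ler_wpM2l//; first by rewrite divr_ge0// ltW.
  have t1' : 0 <= 1 - t by rewrite subr_ge0 ltW.
  have := ler_wpM2l (mulr_ge0 (ltW beta0) t1') (ltW rS).
  by move: tE; lra.
have h2 : 2 * K <= (1 - gam) / 2 * (u x + u y).
  have := ler_wpM2l (ltW g1) (ltW rS); rewrite rK; lra.
have h3 := ler_wpM2l (ltW beta0) h2.
have h4 : 2 + beta * (gam * (u x + u y) + 2 * K) <=
    (1 - (1 - gam) / 2 * t) * (2 + beta * (u x + u y)).
  by move: h1 h3; lra.
have h5 := ler_wpM2r (ltW (pos x y)) rho1.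
have h6 : 2 + beta * (gam * (u x + u y) + 2 * K) <= rho * (2 + beta * u x + beta * u y).
  by move: h4 h5; lra.
by have := ler_wpM2l A0 h6; lra.
Qed.

End weak_contraction.

(** * Correlations of the stationary chain *)

Lemma dominated_eq_subtractive d (T : measurableType d) (R : realType)
    (w : T -> R) (F1 F2 : (T -> R) -> R) :
  measurable_fun [set: T] w -> (forall x, 1 <= w x) ->
  (forall f g, dominated w f -> dominated w g ->
    F1 (fun x => f x - g x) = F1 f - F1 g) ->
  (forall f g, dominated w f -> dominated w g ->
    F2 (fun x => f x - g x) = F2 f - F2 g) ->
  (forall f, dominated w f -> (forall x, 0 <= f x) -> F1 f = F2 f) ->
  forall f, dominated w f -> F1 f = F2 f.
Proof.
move=> mw w1 F1B F2B F12 f df; have [b b0 fb] := dominated_bound w1 df.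
have dw := dominatedZ b (dominated_self mw w1); have dfw := dominatedD df dw.
have -> : f = (fun x => (f x + b * w x) - b * w x) by apply/funext => x; rewrite addrK.
rewrite F1B// F2B// !F12// => x; first by rewrite mulr_ge0// (le_trans ler01).
by have := fb x; rewrite ler_norml; move: (f x) (b * w x) => p q; lra.
Qed.

Section squared_weight.
Context d (T : measurableType d) (R : realType) (u : T -> R).
Hypotheses (mu : measurable_fun [set: T] u) (u_ge1 : forall x, 1 <= u x).

Definition sqr_weight (x : T) : R := u x ^+ 2.

Lemma sqr_weight_ge1 x : 1 <= sqr_weight x.
Proof. by rewrite /sqr_weight exprn_ege1. Qed.

Lemma measurable_sqr_weight : measurable_fun [set: T] sqr_weight.
Proof. exact: measurable_funX. Qed.

Lemma le_sqr_weight x : u x <= sqr_weight x.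
Proof. by rewrite /sqr_weight expr2 ler_peMr// (le_trans ler01). Qed.

Lemma dominated_sqr f : dominated u f -> dominated sqr_weight f.
Proof.
move=> df; have [b b0 fb] := dominated_bound u_ge1 df.
split; first by case: df.
by exists b => x; rewrite (le_trans (fb x))// ler_wpM2l// le_sqr_weight.
Qed.

Lemma dominatedM f g : dominated u f -> dominated u g ->
  dominated sqr_weight (fun x => f x * g x).
Proof.
move=> df dg; have [a a0 fa] := dominated_bound u_ge1 df.
have [b b0 gb] := dominated_bound u_ge1 dg.
split; first by apply: measurable_funM; [case: df|case: dg].
exists (a * b) => x; rewrite normrM /sqr_weight expr2 mulrACA.
exact: ler_pM.
Qed.

Lemma weighted_sqr (p : {measure set T -> \bar R}) : weighted sqr_weight p -> weighted u p.
Proof.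
move=> h; apply: le_lt_trans h; apply: ge0_le_integral => //.
- by move=> x _; rewrite lee_fin (le_trans ler01).
- exact/measurable_EFinP.
- exact/measurable_EFinP/measurable_sqr_weight.
- by move=> x _; rewrite lee_fin le_sqr_weight.
Qed.

End squared_weight.

Section stationary_chain.
Context d dO (T : measurableType d) (Omega : measurableType dO) (R : realType).
Variables (P : R.-pker T ~> T) (pi : probability T R)
  (Q : probability Omega R) (X : nat -> Omega -> T).
Hypotheses (chain : markov_chain P pi Q X) (piP : stationary P pi).

Let mX n : measurable_fun [set: Omega] (X n).
Proof. by case: chain. Qed.

Lemma stationary_marginal n (h : T -> R) : measurable_fun [set: T] h ->
  (forall x, 0 <= h x) ->
  (\int[Q]_w (h (X n w))%:E = \int[pi]_x (h x)%:E)%E.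
Proof.
move=> mh h0.
suff law A : measurable A -> Q (X n @^-1` A) = pi A.
  transitivity (\int[pushforward Q (X n)]_x (h x)%:E)%E.
    rewrite ge0_integral_pushforward//; first exact/measurable_EFinP.
    by move=> x _; rewrite lee_fin.
  by apply: eq_measure_integral => A mA _; exact: law.
elim: n A {h mh h0} => [|n IH] A mA; first by case: chain => _ ->.
have [_ _ step] := chain.
have := step n (fun=> setT) A (fun=> measurableT) mA => /=.
have -> : \bigcap_(i in `I_n.+1) X i @^-1` [set: T] = setT.
  by apply/seteqP; split => // w _ i _.
rewrite setTI => ->.
transitivity (\int[pushforward Q (X n)]_x P x A)%E.
  by rewrite ge0_integral_pushforward//; exact: measurable_kernel.
rewrite (eq_measure_integral pi); first exact: piP.
by move=> B mB _; exact: IH.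
Qed.

Variables (u : T -> R) (c : R).
Hypotheses (mu : measurable_fun [set: T] u) (u_ge1 : forall x, 1 <= u x)
  (wpi : weighted (sqr_weight u) pi)
  (Pu : forall x, (\int[P x]_y (u y)%:E <= (c * u x)%:E)%E).

Let u_ge0 x : 0 <= u x. Proof. exact: le_trans ler01 (u_ge1 x). Qed.

Let wP x : weighted u (P x).
Proof. exact: le_lt_trans (Pu x) (ltry _). Qed.

Local Notation tr := (transition P).

Let dtr f : dominated u f -> dominated u (tr f).
Proof. by move=> df; apply: (@dominated_kernel _ _ _ _ _ P u u c). Qed.

Let diter n f : dominated u f -> dominated u (iter n tr f).
Proof. by move=> df; elim: n => //= n IH; exact: dtr. Qed.

Let w1 := sqr_weight_ge1 u_ge1.
Let mw := measurable_sqr_weight mu.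

(** Induction on the lag, peeling off the last transition; [chain_step] is used with all factors
    equal to 1 except the one of index [i]. *)
Lemma ge0_stationary_pair i k (f h : T -> R) : measurable_fun [set: T] f ->
  (forall x, 0 <= f x) -> dominated u h -> (forall x, 0 <= h x) ->
  (\int[Q]_w (f (X i w) * h (X (i + k)%N w))%:E =
   \int[pi]_x (f x * iter k tr h x)%:E)%E.
Proof.
move=> mf f0; elim: k h => [|k IH] h dh h0.
  have mh := dominated_measurable dh.
  rewrite -(@stationary_marginal i (fun x => f x * h x)).
  - by under eq_integral do rewrite addn0.
  - exact: measurable_funM.
  - by move=> x; rewrite mulr_ge0.
rewrite iterSr -IH; last 2 first.
- exact: dtr.
- by move=> x; exact: Rintegral_ge0.
pose F j := if j == i then f else fun=> 1.
have mF j : measurable_fun [set: T] (F j) by rewrite /F; case: ifP.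
have F0 j x : 0 <= F j x by rewrite /F; case: ifP.
have ik : (i < (i + k).+1)%N by rewrite ltnS leq_addr.
have pF w : path_product X F (i + k).+1 w = f (X i w).
  rewrite /path_product (bigD1 (Ordinal ik))//= /F eqxx big1 ?mulr1// => j.
  by rewrite -val_eqE/= => /negPf ->.
have mh := dominated_measurable dh.
have := chain_step chain (i + k)%N mF F0 mh h0.
rewrite addnS; under eq_integral do rewrite pF.
move=> ->; apply: eq_integral => w _.
by rewrite pF (dominated_EFin mu u_ge1 (wP _) dh) -EFinM.
Qed.

Let pair_weight i j (w : Omega) : R := sqr_weight u (X i w) + sqr_weight u (X j w).

Let pair_weight_ge1 i j w : 1 <= pair_weight i j w.
Proof. by rewrite ler_wpDr// (le_trans ler01). Qed.

Let measurable_pair_weight i j : measurable_fun [set: Omega] (pair_weight i j).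
Proof. by apply: measurable_funD; apply: (measurableT_comp mw). Qed.

Let weighted_pair i j : weighted (pair_weight i j) Q.
Proof.
have mEw k : measurable_fun [set: Omega] (fun w => (sqr_weight u (X k w))%:E).
  by apply/measurable_EFinP; exact: (measurableT_comp mw (mX k)).
have w0 x : 0 <= sqr_weight u x by exact: le_trans ler01 (w1 x).
rewrite /weighted /pair_weight; under eq_integral do rewrite EFinD.
rewrite ge0_integralD//; try by move=> w _; rewrite lee_fin.
by rewrite !stationary_marginal//; apply: lte_add_pinfty.
Qed.

Let dominated_pair i j f h : dominated u f -> dominated u h ->
  dominated (pair_weight i j) (fun w => f (X i w) * h (X j w)).
Proof.
move=> df dh; have [a a0 fa] := dominated_bound u_ge1 df.
have [b b0 hb] := dominated_bound u_ge1 dh.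
split.
  apply: measurable_funM.
    exact: (measurableT_comp (dominated_measurable df) (mX i)).
  exact: (measurableT_comp (dominated_measurable dh) (mX j)).
exists (a * b) => w; rewrite normrM.
apply: (@le_trans _ _ ((a * u (X i w)) * (b * u (X j w)))); first exact: ler_pM.
rewrite mulrACA ler_wpM2l ?mulr_ge0// /pair_weight /sqr_weight.
move: (u (X i w)) (u (X j w)) (u_ge0 (X i w)) (u_ge0 (X j w)) => p q p0 q0.
have := sqr_ge0 (p - q); rewrite sqrrB; have := sqr_ge0 (p + q); rewrite sqrrD.
by lra.
Qed.

Lemma stationary_pair i k (f h : T -> R) : dominated u f -> dominated u h ->
  \int[Q]_w (f (X i w) * h (X (i + k)%N w)) = \int[pi]_x (f x * iter k tr h x).
Proof.
have wQ := weighted_pair i (i + k).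
have pw1 := pair_weight_ge1 i (i + k); have mpw := measurable_pair_weight i (i + k).
have dp f' h' (df : dominated u f') (dh : dominated u h') := dominated_pair i (i + k) df dh.
have trB f1 f2 x : dominated u f1 -> dominated u f2 ->
    iter k tr (fun y => f1 y - f2 y) x = iter k tr f1 x - iter k tr f2 x.
  move=> d1 d2; elim: k x {wQ pw1 mpw dp} => //= n IH x.
  rewrite /transition -(dominated_RintegralB mu u_ge1 (wP x) (diter n d1) (diter n d2)).
  by apply: eq_Rintegral => y _; exact: IH.
have dpi f' h' (df : dominated u f') (dh : dominated u h') := dominatedM u_ge1 df dh.
move=> df dh; move: h dh; apply: (@dominated_eq_subtractive _ _ _ u
  (fun h => \int[Q]_w (f (X i w) * h (X (i + k)%N w)))
  (fun h => \int[pi]_x (f x * iter k tr h x))) => //.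
- move=> h1 h2 d1 d2.
  rewrite -(dominated_RintegralB mpw pw1 wQ (dp _ _ df d1) (dp _ _ df d2)).
  by apply: eq_Rintegral => w _; rewrite mulrBr.
- move=> h1 h2 d1 d2.
  rewrite -(dominated_RintegralB mw w1 wpi (dpi _ _ df (diter k d1)) (dpi _ _ df (diter k d2))).
  by apply: eq_Rintegral => x _; rewrite trB// mulrBr.
move=> h dh h0; move: f df; apply: (@dominated_eq_subtractive _ _ _ u
  (fun f => \int[Q]_w (f (X i w) * h (X (i + k)%N w)))
  (fun f => \int[pi]_x (f x * iter k tr h x))) => //.
- move=> h1 h2 d1 d2.
  rewrite -(dominated_RintegralB mpw pw1 wQ (dp _ _ d1 dh) (dp _ _ d2 dh)).
  by apply: eq_Rintegral => w _; rewrite mulrBl.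
- move=> h1 h2 d1 d2.
  rewrite -(dominated_RintegralB mw w1 wpi (dpi _ _ d1 (diter k dh)) (dpi _ _ d2 (diter k dh))).
  by apply: eq_Rintegral => x _; rewrite mulrBl.
move=> f df f0; rewrite /Rintegral ge0_stationary_pair//.
exact: dominated_measurable df.
Qed.

End stationary_chain.

(** * Decay of correlations *)

Section mixing.
Context d (T : measurableType d) (R : realType).
Variables (P : R.-pker T ~> T) (nu : probability T R) (C D : set T) (delta : R)
  (u : T -> R) (gam b : R).
Hypotheses (mC : measurable C) (mD : measurable D) (DC : D `<=` C)
  (delta_gt0 : 0 < delta) (delta_le1 : delta <= 1)
  (small : small_set P C nu delta) (nuC : (0 < nu C)%E)
  (mu : measurable_fun [set: T] u) (u_ge1 : forall x, 1 <= u x)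
  (gam01 : 0 < gam < 1) (b_ge0 : 0 <= b)
  (Pu : forall x, (\int[P x]_y (u y)%:E <= (gam * u x + b)%:E)%E)
  (PuD : forall x, ~ D x -> (\int[P x]_y (u y)%:E <= (gam * u x)%:E)%E)
  (wnu : weighted u nu).
Variables (pi : probability T R) (wpi : weighted (sqr_weight u) pi).

Local Notation tr := (transition P).

Let Pu' x : (\int[P x]_y (u y)%:E <= ((gam + b) * u x)%:E)%E.
Proof. by apply: le_trans (Pu x) _; rewrite lee_fin mulrDl lerD2l ler_peMr. Qed.

Let u_ge0 x : 0 <= u x. Proof. exact: le_trans ler01 (u_ge1 x). Qed.

(** Time is written [k * m.+1 + r]. The bound is geometric in [k] and uniform in [r], since all
    iterates of [f] stay below a fixed multiple of [u x + K]. *)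
Let iter_contraction f : dominated u f ->
  exists m (A beta rho : R), [/\ 0 <= A, 0 < beta, 0 < rho < 1 &
    forall k r x y, `|iter (k * m.+1 + r) tr f x - iter (k * m.+1 + r) tr f y| <=
      rho ^+ k * (A * (2 + beta * u x + beta * u y))].
Proof.
have [m [beta [rho [beta0 rho01 contr]]]] := weak_contraction mC mD DC delta_gt0
  delta_le1 small nuC mu u_ge1 gam01 b_ge0 Pu PuD wnu.
move=> df; have [c c0 fc] := dominated_bound u_ge1 df.
pose K := b / (1 - gam) + 1.
have K0 : 0 <= K.
  by rewrite addr_ge0// divr_ge0// subr_ge0 ltW//; case/andP: gam01.
have it n x : `|iter n tr f x| <= c * (u x + K).
  have du := dominated_self mu u_ge1.
  have up h : dominated u h -> (forall y, h y <= c * u y) -> iter n tr h x <= c * (u x + K).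
    move=> dh hc; have h1 := le_iter_transition mu u_ge1 b_ge0 Pu n x dh (dominatedZ c du) hc.
    apply: (le_trans h1); rewrite (iter_transitionZ mu u_ge1 b_ge0 Pu n c x du) ler_wpM2l//.
    apply: le_trans (iter_transition_weight mu u_ge1 gam01 b_ge0 Pu n x) _.
    rewrite lerD2r ler_piMl// exprn_ile1//; first by case/andP: gam01 => /ltW.
    by case/andP: gam01 => _ /ltW.
  rewrite ler_norml; apply/andP; split; last first.
    by apply: up => // y; rewrite (le_trans (ler_norm _)).
  have := up _ (dominatedZ (-1) df).
  rewrite (iter_transitionZ mu u_ge1 b_ge0 Pu n _ x df) => /(_ _)/=.
  have fN y : -1 * f y <= c * u y.
    by have := fc y; rewrite ler_norml => /andP[+ _]; lra.
  by move=> /(_ fN); lra.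
(* Makes the case [k = 0] hold: [c * (u x + u y + 2 * K) <= A * (2 + beta * u x + beta * u y)]. *)
pose A := c * (K + beta^-1).
have bi0 : 0 <= beta^-1 by rewrite invr_ge0 ltW.
exists m, A, beta, rho; split=> //.
  by rewrite mulr_ge0// addr_ge0.
move=> k r x y; elim: k x y => [|k IH] x y.
  rewrite mul0n add0n expr0 mul1r.
  have h1 := it r x; have h2 := it r y.
  apply: (le_trans (ler_normB _ _)).
  have e : beta^-1 * beta = 1 by rewrite mulVf// gt_eqF.
  have : c * (beta^-1 * beta) * (u x + u y) = c * (u x + u y) by rewrite e mulr1.
  have : 0 <= c * K * (beta * (u x + u y)).
    by rewrite !mulr_ge0// ?addr_ge0// ltW.
  have : 0 <= c * beta^-1 by rewrite mulr_ge0.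
  rewrite /A; move: h1 h2; move: `|_| `|_| => a1 a2; lra.
rewrite mulSn -addnA !(iterD m.+1).
have dk := dominated_iter_transition mu u_ge1 b_ge0 Pu (k * m.+1 + r) df.
have IH' x' y' : `|iter (k * m.+1 + r) tr f x' - iter (k * m.+1 + r) tr f y'| <=
    rho ^+ k * A * (2 + beta * u x' + beta * u y') by rewrite -mulrA.
by apply: (le_trans (contr _ _ dk IH' x y)); rewrite exprS !mulrA.
Qed.

(** As [g0] has mean zero, the value of the iterate at a fixed point [x0] may be subtracted, and the
    resulting oscillation decays geometrically. *)
Lemma transition_mean_to0 (f g0 : T -> R) : dominated u f -> dominated u g0 ->
  \int[pi]_x g0 x = 0 ->
  (fun n => \int[pi]_x (g0 x * iter n tr f x)) @ \oo --> (0 : R).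
Proof.
move=> df dg pig; have [m [A [beta [rho [A0 beta0 rho01 contr]]]]] := iter_contraction df.
have [rho0 rho1] := andP rho01.
have w1 := sqr_weight_ge1 u_ge1; have mw := measurable_sqr_weight mu.
have [x0 _] : exists x : T, True.
  apply: contrapT => noT; have := probability_setT pi.
  have -> : [set: T] = set0 by apply/seteqP; split => // x _; apply: noT; exists x.
  by rewrite measure0 => /eqP; rewrite eq_sym onee_eq0.
pose G x := `|g0 x| * (A * (2 + beta * u x + beta * u x0)).
have du := dominated_self mu u_ge1.
have dcst c : dominated u (fun=> c) by exact: dominated_cst u_ge1 _.
have dG : dominated (sqr_weight u) G.
  apply: dominatedM => //; first exact: dominated_norm.
  apply: dominatedZ; apply: dominatedD => //; apply: dominatedD => //.
  exact: dominatedZ.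
pose M := \int[pi]_x G x.
have bound k r : `|\int[pi]_x (g0 x * iter (k * m.+1 + r) tr f x)| <= rho ^+ k * M.
  set n := (k * m.+1 + r)%N.
  have dn := dominated_iter_transition mu u_ge1 b_ge0 Pu n df.
  have d1 := dominatedM u_ge1 dg dn.
  have d2 := dominatedM u_ge1 dg (dcst (iter n tr f x0)).
  have -> : \int[pi]_x (g0 x * iter n tr f x) =
      \int[pi]_x (g0 x * iter n tr f x - g0 x * iter n tr f x0).
    rewrite (dominated_RintegralB mw w1 wpi d1 d2).
    under [X in _ - X]eq_Rintegral do rewrite mulrC.
    rewrite (dominated_RintegralZ mw w1 _ wpi (dominated_sqr u_ge1 dg)).
    by rewrite pig mulr0 subr0.
  have d3 := dominatedB d1 d2.
  apply: (le_trans (dominated_Rintegral_norm mw w1 wpi d3)).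
  rewrite /M -(dominated_RintegralZ mw w1 _ wpi dG).
  apply: (le_dominated_Rintegral mw w1 wpi).
  - exact: dominated_norm.
  - exact: dominatedZ.
  - move=> x; rewrite -mulrBr normrM /G mulrCA ler_wpM2l//.
    exact: contr.
have M0 : 0 <= M.
  by apply: Rintegral_ge0 => x _; rewrite mulr_ge0// mulr_ge0// !addr_ge0// mulr_ge0// ltW.
have rhoM : (fun k => rho ^+ k * M) @ \oo --> (0 : R).
  rewrite -[0](mul0r M); apply: cvgM; last exact: cvg_cst.
  by apply: cvg_expr; rewrite gtr0_norm.
apply/cvgrPdist_le => e e0.
have [k _ hk] : \forall k \near \oo, rho ^+ k * M <= e.
  by have /cvgr_le := rhoM; apply.
near=> n; rewrite sub0r normrN.
have nk : (k * m.+1 <= n)%N by near: n; exact: nbhs_infty_ge.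
rewrite -(subnKC nk); apply: (le_trans (bound k _)).
by apply: hk => /=.
Unshelve. all: by end_near.
Qed.

End mixing.

(** * The asymptotic variance through the Poisson equation *)

Section asymptotic_variance.
Context d dO (T : measurableType d) (Omega : measurableType dO) (R : realType).
Variables (P : R.-pker T ~> T) (pi : probability T R)
  (Q : probability Omega R) (X : nat -> Omega -> T).
Hypotheses (chain : markov_chain P pi Q X) (piP : stationary P pi).
Variables (u : T -> R) (c : R).
Hypotheses (mu : measurable_fun [set: T] u) (u_ge1 : forall x, 1 <= u x)
  (wpi : weighted (sqr_weight u) pi)
  (Pu : forall x, (\int[P x]_y (u y)%:E <= (c * u x)%:E)%E).
Variables (g h : T -> R).
Hypotheses (dg : dominated u g) (dh : dominated u h).

Local Notation tr := (transition P).
Let g0 x := g x - \int[pi]_y g y.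
Hypothesis hE : forall x, h x = g0 x + tr h x.
Hypothesis mixing : (fun n => \int[pi]_x (g0 x * iter n tr h x)) @ \oo --> (0 : R).

Let mX n : measurable_fun [set: Omega] (X n).
Proof. by case: chain. Qed.

Let dg0 : dominated u g0.
Proof. by apply: dominatedB => //; exact: dominated_cst. Qed.

Let w1 := sqr_weight_ge1 u_ge1.
Let mw := measurable_sqr_weight mu.

Let wP x : weighted u (P x).
Proof. exact: le_lt_trans (Pu x) (ltry _). Qed.

Let diter n f : dominated u f -> dominated u (iter n tr f).
Proof.
move=> df; elim: n => //= n IH.
by apply: (@dominated_kernel _ _ _ _ _ P u u c).
Qed.

Let cov k := \int[pi]_x (g0 x * iter k tr g0 x).

Let partial n := cov 0 + 2 * \sum_(1 <= k < n) cov k.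

Let iterB n f1 f2 x : dominated u f1 -> dominated u f2 ->
  iter n tr (fun y => f1 y - f2 y) x = iter n tr f1 x - iter n tr f2 x.
Proof.
move=> d1 d2; elim: n x => //= n IH x.
rewrite /transition -(dominated_RintegralB mu u_ge1 (wP x) (diter n d1) (diter n d2)).
by apply: eq_Rintegral => y _; exact: IH.
Qed.

(** Telescoping sum, since the Poisson equation writes [g0] as [h - tr h]. *)
Let sum_cov n : \sum_(0 <= k < n) cov k =
  \int[pi]_x (g0 x * h x) - \int[pi]_x (g0 x * iter n tr h x).
Proof.
elim: n => [|n IH]; first by rewrite big_nil subrr.
rewrite big_nat_recr//= IH /cov.
have dgn := dominatedM u_ge1 dg0 (diter n dg0).
have dhn := dominatedM u_ge1 dg0 (diter n dh).
have dhn1 := dominatedM u_ge1 dg0 (diter n.+1 dh).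
have -> : \int[pi]_x (g0 x * iter n tr g0 x) =
    \int[pi]_x (g0 x * iter n tr h x) - \int[pi]_x (g0 x * iter n.+1 tr h x).
  rewrite -(dominated_RintegralB mw w1 wpi dhn dhn1).
  apply: eq_Rintegral => x _; rewrite -mulrBr; congr (_ * _).
  rewrite iterSr -(iterB n x dh (diter 1 dh)).
  by congr (iter n tr _ x); apply/funext => y /=; rewrite hE addrK.
by rewrite addrA subrK.
Qed.

(** The Poisson-equation form of the Green-Kubo sum. Its integrand is the one of
    [block_square_mean], which links the variance of the chain to that of the blocks. *)
Definition limit_variance : R := \int[pi]_x (2 * g0 x * h x - g0 x ^+ 2).

Let partial_cvg : partial n @[n --> \oo] --> limit_variance.
Proof.
have dgh := dominatedM u_ge1 dg0 dh; have dgg := dominatedM u_ge1 dg0 dg0.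
have -> : limit_variance = 2 * (\int[pi]_x (g0 x * h x) - 0) - cov 0.
  rewrite subr0 /limit_variance /cov/= -(dominated_RintegralZ mw w1 _ wpi dgh).
  rewrite -(dominated_RintegralB mw w1 wpi (dominatedZ _ dgh) dgg).
  by apply: eq_Rintegral => x _; rewrite expr2 mulrA.
rewrite -(cvg_shiftS partial).
have -> : (fun n => partial n.+1) = (fun n =>
    2 * (\int[pi]_x (g0 x * h x) - \int[pi]_x (g0 x * iter n.+1 tr h x)) - cov 0).
  apply/funext => n; rewrite /partial -sum_cov [in RHS]big_nat_recl//.
  by rewrite big_add1/=; lra.
apply: cvgB; last exact: cvg_cst.
apply: cvgM; first exact: cvg_cst.
apply: cvgB; first exact: cvg_cst.
by rewrite (cvg_shiftS (fun n => \int[pi]_x (g0 x * iter n tr h x))).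
Qed.

Let pair i k := stationary_pair chain piP mu u_ge1 wpi Pu i k dg0 dg0.

(** A single weight on [Omega] that dominates all products [g0 (X i) * g0 (X j)] with [i] and [j]
    below [n]. *)
Let weight n (w : Omega) : R := 1 + \sum_(0 <= i < n) sqr_weight u (X i w).

Let weight_ge1 n w : 1 <= weight n w.
Proof.
by rewrite lerDl sumr_ge0// => i _; rewrite (le_trans ler01)// w1.
Qed.

Let measurable_weight n : measurable_fun [set: Omega] (weight n).
Proof.
apply: measurable_funD => //; apply: measurable_sum => i.
exact: (measurableT_comp mw (mX i)).
Qed.

Let weighted_weight n : weighted (weight n) Q.
Proof.
have w0 x : 0 <= sqr_weight u x by exact: le_trans ler01 (w1 x).
rewrite /weighted; elim: n => [|n IH].
  rewrite /weight; under eq_integral do rewrite big_nil addr0.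
  rewrite integral_cst//; apply: lte_mul_pinfty => //.
  by apply: (@le_lt_trans _ _ 1%E); rewrite ?ltry//; exact: probability_le1.
rewrite /weight; under eq_integral do rewrite big_nat_recr//= addrA EFinD.
rewrite ge0_integralD//.
- apply: lte_add_pinfty; first exact: IH.
  by rewrite (stationary_marginal chain piP n mw w0).
- by move=> w _; rewrite lee_fin (le_trans ler01)// weight_ge1.
- exact/measurable_EFinP/measurable_weight.
- by move=> w _; rewrite lee_fin.
- by apply/measurable_EFinP; exact: (measurableT_comp mw (mX n)).
Qed.

Let weight_mem n i w : (i < n)%N -> sqr_weight u (X i w) <= weight n w.
Proof.
move=> i_n; rewrite /weight big_mkord (bigD1 (Ordinal i_n))//=.
rewrite addrCA lerDl addr_ge0// sumr_ge0// => j _.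
by rewrite (le_trans ler01)// w1.
Qed.

Let dpair n i j : (i < n)%N -> (j < n)%N ->
  dominated (weight n) (fun w => g0 (X i w) * g0 (X j w)).
Proof.
move=> i_n j_n; have [a a0 ga] := dominated_bound u_ge1 dg0.
split.
  by apply: measurable_funM; exact: (measurableT_comp (dominated_measurable dg0) (mX _)).
exists (a * a) => w; rewrite normrM.
apply: (@le_trans _ _ ((a * u (X i w)) * (a * u (X j w)))); first exact: ler_pM.
rewrite mulrACA ler_wpM2l ?mulr_ge0//.
have := weight_mem w i_n; have := weight_mem w j_n; rewrite /sqr_weight.
move: (weight n w) (u (X i w)) (u (X j w)) => W p q.
have := sqr_ge0 (p - q); rewrite sqrrB; lra.
Qed.

Let S n w := \sum_(0 <= i < n) g0 (X i w).

Let dS1 n i : (i < n)%N -> dominated (weight n) (fun w => S i w * g0 (X i w)).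
Proof.
move=> i_n; rewrite /S.
suff H j : (j <= i)%N -> dominated (weight n)
    (fun w => (\sum_(0 <= k < j) g0 (X k w)) * g0 (X i w)) by exact: H.
elim: j => [_|j IH ji].
  under eq_fun do rewrite big_nil mul0r.
  by apply: dominated_cst; exact: weight_ge1.
under eq_fun do rewrite big_nat_recr//= mulrDl.
apply: dominatedD; first exact/IH/ltnW.
by apply: dpair => //; exact: ltn_trans ji i_n.
Qed.

Let weight_le n m w : (n <= m)%N -> weight n w <= weight m w.
Proof.
move=> nm; rewrite /weight lerD2l [leRHS](@big_cat_nat _ _ _ n)//= lerDl.
by rewrite sumr_ge0// => j _; rewrite (le_trans ler01)// w1.
Qed.

Let dSS m n : (n <= m)%N -> dominated (weight m) (fun w => S n w ^+ 2).
Proof.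
elim: n => [_|n IH nm].
  under eq_fun do rewrite /S big_nil expr0n.
  by apply: dominated_cst; exact: weight_ge1.
have -> : (fun w => S n.+1 w ^+ 2) = (fun w => S n w ^+ 2 +
    (2 * (S n w * g0 (X n w)) + g0 (X n w) * g0 (X n w))).
  by apply/funext => w; rewrite /S big_nat_recr//=; ring.
apply: dominatedD; first exact/IH/ltnW.
by apply: dominatedD; [apply: dominatedZ; exact: dS1|exact: dpair].
Qed.

Let var n := \int[Q]_w (S n w ^+ 2).

Let cross n : \int[Q]_w (S n w * g0 (X n w)) = \sum_(1 <= k < n.+1) cov k.
Proof.
suff H j : (j <= n)%N -> \int[Q]_w ((\sum_(0 <= i < j) g0 (X i w)) * g0 (X n w)) =
    \sum_(0 <= i < j) cov (n - i).
  rewrite H// big_add1/= big_nat_rev/=.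
  by apply: eq_big_nat => i /= i_n; rewrite add0n subKn.
have ww := weighted_weight n.+1; have mww := @measurable_weight n.+1.
have w1w := weight_ge1 n.+1.
elim: j => [_|j IH jn].
  by under eq_Rintegral do rewrite big_nil mul0r; rewrite probability_Rintegral_cst big_nil.
under eq_Rintegral do rewrite big_nat_recr//= mulrDl.
have djn : dominated (weight n.+1) (fun w => g0 (X j w) * g0 (X n w)).
  by apply: dpair => //; exact: ltnW.
have dj : dominated (weight n.+1)
    (fun w => (\sum_(0 <= k < j) g0 (X k w)) * g0 (X n w)).
  elim: (j) (ltnW jn) => [_|k IHk kn].
    under eq_fun do rewrite big_nil mul0r.
    by apply: dominated_cst; exact: weight_ge1.
  under eq_fun do rewrite big_nat_recr//= mulrDl.
  apply: dominatedD; first exact/IHk/ltnW.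
  by apply: dpair => //; exact: leq_trans kn _.
rewrite (dominated_RintegralD mww w1w ww dj djn) (IH (ltnW jn)).
rewrite big_nat_recr//=; have jn' := ltnW jn.
by congr (_ + _); rewrite /cov -(pair j) subnKC.
Qed.

(** By stationarity the increments of the variance are the partial sums of the covariance series.
    Both limits thus come from one convergence, the limit of normalized variances through Cesaro
    means. *)
Let varS n : var n.+1 = var n + partial n.+1.
Proof.
have ww := weighted_weight n.+1; have mww := @measurable_weight n.+1.
have w1w := weight_ge1 n.+1.
have d1 : dominated (weight n.+1) (fun w => S n w ^+ 2) by exact: dSS.
have d2 : dominated (weight n.+1) (fun w => S n w * g0 (X n w)) by exact: dS1.
have d3 : dominated (weight n.+1) (fun w => g0 (X n w) * g0 (X n w)) by exact: dpair.
rewrite /var.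
have -> : \int[Q]_w (S n.+1 w ^+ 2) = \int[Q]_w (S n w ^+ 2 +
    (2 * (S n w * g0 (X n w)) + g0 (X n w) * g0 (X n w))).
  by apply: eq_Rintegral => w _; rewrite /S big_nat_recr//=; ring.
rewrite (dominated_RintegralD mww w1w ww d1 (dominatedD (dominatedZ 2 d2) d3)).
rewrite (dominated_RintegralD mww w1w ww (dominatedZ 2 d2) d3).
rewrite (dominated_RintegralZ mww w1w _ ww d2) cross.
have -> : \int[Q]_w (g0 (X n w) * g0 (X n w)) = cov 0.
  by rewrite /cov -(pair n 0) addn0.
by rewrite /partial; lra.
Qed.

Let varE n : var n = \sum_(0 <= k < n) partial k.+1.
Proof.
elim: n => [|n IH]; last by rewrite varS IH big_nat_recr.
rewrite big_nil /var /S; under eq_Rintegral do rewrite big_nil expr0n/=.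
exact: probability_Rintegral_cst.
Qed.

Let weight1_ge1 i w : 1 <= u (X i w). Proof. exact: u_ge1. Qed.

Let measurable_weight1 i : measurable_fun [set: Omega] (fun w => u (X i w)).
Proof. exact: (measurableT_comp mu (mX i)). Qed.

Let weighted_weight1 i : weighted (fun w => u (X i w)) Q.
Proof.
have u0 x : 0 <= u x by exact: le_trans ler01 (u_ge1 x).
by rewrite /weighted (stationary_marginal chain piP i mu)//; exact: weighted_sqr.
Qed.

Let dominated_g i : dominated (fun w => u (X i w)) (fun w => g (X i w)).
Proof.
have [b b0 gb] := dominated_bound u_ge1 dg.
split; first exact: (measurableT_comp (dominated_measurable dg) (mX i)).
by exists b.
Qed.

Let Rintegral_g i : \int[Q]_w g (X i w) = \int[pi]_x g x.
Proof.
have := stationary_pair chain piP mu u_ge1 wpi Pu i 0 (dominated_cst u_ge1 1) dg.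
under eq_Rintegral do rewrite mul1r addn0.
by move=> ->; apply: eq_Rintegral => x _; rewrite mul1r.
Qed.

Let expectation_g i : ('E_Q[g \o X i] = (\int[pi]_x g x)%:E)%E.
Proof.
rewrite expectation.unlock -(Rintegral_g i).
exact: (dominated_EFin (measurable_weight1 i) (weight1_ge1 i) (weighted_weight1 i)
  (dominated_g i)).
Qed.

Let covariance_g i : covariance Q (g \o X 0%N) (g \o X i) = (cov i)%:E.
Proof.
rewrite covariance.unlock !expectation_g expectation.unlock/=.
rewrite /cov -(pair 0 i) add0n.
rewrite -(dominated_EFin (@measurable_weight i.+1) (weight_ge1 i.+1)
  (weighted_weight i.+1))//.
exact: dpair.
Qed.

Let af n w := additive_functional g X n w.

Let afE n w : af n w = S n w + n%:R * \int[pi]_x g x.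
Proof.
rewrite /af /S /additive_functional; elim: n => [|n IH].
  by rewrite !big_nil mul0r addr0.
by rewrite !big_nat_recr//= IH /g0 -natr1; ring.
Qed.

Let daf n m : (n <= m)%N -> dominated (weight m) (af n).
Proof.
rewrite /af /additive_functional; elim: n => [_|n IH nm].
  under eq_fun do rewrite big_nil.
  by apply: dominated_cst; exact: weight_ge1.
under eq_fun do rewrite big_nat_recr//=.
apply: dominatedD; first exact/IH/ltnW.
have [b b0 gb] := dominated_bound u_ge1 dg.
split; first exact: (measurableT_comp (dominated_measurable dg) (mX n)).
exists b => w; rewrite (le_trans (gb _))// ler_wpM2l//.
by rewrite (le_trans (le_sqr_weight u_ge1 _))// weight_mem.
Qed.

Let Rintegral_af n : \int[Q]_w af n w = n%:R * \int[pi]_x g x.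
Proof.
rewrite /af /additive_functional; elim: n => [|n IH].
  by under eq_Rintegral do rewrite big_nil; rewrite probability_Rintegral_cst mul0r.
under eq_Rintegral do rewrite big_nat_recr//=.
have ww := weighted_weight n.+1; have mww := @measurable_weight n.+1.
have dgn : dominated (weight n.+1) (fun w => g (X n w)).
  have [b b0 gb] := dominated_bound u_ge1 dg.
  split; first exact: (measurableT_comp (dominated_measurable dg) (mX n)).
  exists b => w; rewrite (le_trans (gb _))// ler_wpM2l//.
  by rewrite (le_trans (le_sqr_weight u_ge1 _))// weight_mem.
rewrite (dominated_RintegralD mww (weight_ge1 n.+1) ww (daf (leqnSn n)) dgn).
by rewrite IH Rintegral_g -natr1; ring.
Qed.

Let variance_af n : ('V_Q[additive_functional g X n] = (var n)%:E)%E.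
Proof.
have ww := weighted_weight n; have mww := @measurable_weight n.
have w1w := weight_ge1 n.
have e : ('E_Q[additive_functional g X n] = (n%:R * \int[pi]_x g x)%:E)%E.
  rewrite expectation.unlock -Rintegral_af.
  exact: (dominated_EFin mww w1w ww (daf (leqnn n))).
rewrite /variance covariance.unlock !e expectation.unlock/=.
rewrite /var -(dominated_EFin mww w1w ww (dSS (leqnn n))).
apply: eq_integral => w _; congr EFin.
have SE : S n w = additive_functional g X n w - n%:R * \int[pi]_x g x.
  by rewrite -[additive_functional g X n w]/(af n w) afE addrK.
by rewrite SE expr2.
Qed.

Lemma asymptotic_variance_limit : asymptotic_variance Q g X limit_variance.
Proof.
have shifted : partial n.+1 @[n --> \oo] --> limit_variance.
  by rewrite (cvg_shiftS partial).
split.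
  under eq_fun do rewrite variance_af -EFinM.
  apply: cvg_EFin; first by near=> n.
  rewrite /comp/=.
  rewrite -(cvg_shiftS (fun n => var n * n%:R^-1)).
  rewrite (_ : (fun n => _) = arithmetic_mean (fun n => partial n.+1)).
    exact: cesaro shifted.
  by apply/funext => n; rewrite /arithmetic_mean/= /series/= varE mulrC.
rewrite (_ : (fun n => _) = EFin \o partial).
  by apply: cvg_EFin; [near=> n|exact: partial_cvg].
apply/funext => n; rewrite /= /partial.
have -> : \sum_(1 <= i < n) covariance Q (g \o X 0%N) (g \o X i) =
    (\sum_(1 <= i < n) cov i)%:E.
  by rewrite -sumEFin; apply: eq_bigr => i _; exact: covariance_g.
have -> : 'V_Q[g \o X 0%N] = (cov 0)%:E by exact: covariance_g 0%N.
by rewrite -EFinM -EFinD.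
Unshelve. all: by end_near.
Qed.

End asymptotic_variance.

(** * Moments of the stationary law *)

Section stationary_moment.
Context d (T : measurableType d) (R : realType).
Variables (P : R.-pker T ~> T) (pi : probability T R) (w : T -> R) (gam b : R).
Hypotheses (piP : stationary P pi) (mw : measurable_fun [set: T] w)
  (w_ge0 : forall x, 0 <= w x) (gam01 : 0 <= gam < 1) (b_ge0 : 0 <= b)
  (Pw : forall x, (\int[P x]_y (w y)%:E <= (gam * w x + b)%:E)%E).

Let cut (k : R) x := Num.min (w x) k.

Let one_ge1 (x : T) : (1 : R) <= cst 1 x. Proof. by []. Qed.

Let bounded_dominated (f : T -> R) k : measurable_fun [set: T] f ->
  (forall x, `|f x| <= k) -> dominated (cst 1) f.
Proof. by move=> mf fk; split=> //; exists k => x; rewrite mulr1. Qed.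

Let weighted1 (p : probability T R) : weighted (cst 1) p.
Proof.
rewrite /weighted (@integral_cst _ _ _ p _ measurableT 1%:E).
apply: lte_mul_pinfty => //.
by apply: (@le_lt_trans _ _ 1%E); rewrite ?ltry//; exact: probability_le1.
Qed.

Let weighted1P x : weighted (cst 1) (P x).
Proof.
by rewrite /weighted (@integral_cst _ _ _ (P x) _ measurableT 1%:E) prob_kernel mule1 ltry. Qed.

(* Integrating the concave truncations of [w] against [pi = pi P]. *)
Let cut_moment (k : R) : 0 <= k ->
  (1 - gam) * \int[pi]_x (w x * \1_[set x | w x <= k] x) <= b.
Proof.
move=> k0; have [gam0 gam1] := andP gam01.
have mcut : measurable_fun [set: T] (cut k) by exact: measurable_minr.
have cut0 x : 0 <= cut k x by rewrite le_min w_ge0.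
have dcut : dominated (cst 1) (cut k).
  by apply: (bounded_dominated (k := k) mcut) => x; rewrite ger0_norm// /cut ge_min lexx orbT.
pose v x := Num.min (gam * w x + b) k.
have v0 x : 0 <= v x by rewrite le_min k0 andbT addr_ge0// mulr_ge0.
have mv : measurable_fun [set: T] v.
  by apply: measurable_minr => //; apply: measurable_funD => //; exact: measurable_funM.
have dv : dominated (cst 1) v.
  by apply: (bounded_dominated (k := k) mv) => x; rewrite ger0_norm// /v ge_min lexx orbT.
have m1 : measurable_fun [set: T] (cst 1 : T -> R) by [].
have mS : measurable [set x | w x <= k].
  rewrite -[X in measurable X]setTI.
  have -> : [set x | w x <= k] = w @^-1` `]-oo, k] by apply/seteqP; split=> x /=; rewrite in_itv.
  exact: mw.
pose f x := w x * \1_[set x | w x <= k] x.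
have mf : measurable_fun [set: T] f by exact: measurable_funM.
have fE x : f x = if w x <= k then w x else 0.
  rewrite /f indicE; case: ifPn => wk; first by rewrite mem_set ?mulr1.
  by rewrite memNset ?mulr0//; exact/negP.
have df : dominated (cst 1) f.
  apply: (bounded_dominated (k := k) mf) => x; rewrite fE; case: ifP => // wk.
    by rewrite ger0_norm.
  by rewrite normr0.
have Pcut x : \int[P x]_y cut k y <= v x.
  rewrite le_min; apply/andP; split.
    rewrite -lee_fin -(dominated_EFin m1 one_ge1 (weighted1P x) dcut).
    apply: le_trans (Pw x); apply: ge0_le_integral => //.
    - by move=> y _; rewrite lee_fin.
    - exact/measurable_EFinP.
    - exact/measurable_EFinP.
    - by move=> y _; rewrite lee_fin /cut ge_min lexx.
  have dk := dominated_cst one_ge1 k.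
  have : \int[P x]_y cut k y <= \int[P x]_y k.
    apply: (le_dominated_Rintegral m1 one_ge1 (weighted1P x)) => // y.
    by rewrite /cut ge_min lexx orbT.
  rewrite [X in _ <= X -> _]/Rintegral (@integral_cst _ _ _ (P x) _ measurableT k%:E).
  by rewrite prob_kernel mule1.
have P1 x : (\int[P x]_y (cst 1 y)%:E <= (1 * cst 1 x)%:E)%E.
  by rewrite (@integral_cst _ _ _ (P x) _ measurableT 1%:E) prob_kernel mule1 mul1r.
have st := stationary_Rintegral piP m1 one_ge1 (weighted1 pi) P1 dcut.
have h1 : \int[pi]_x cut k x <= \int[pi]_x v x.
  rewrite -st; apply: (le_dominated_Rintegral m1 one_ge1 (weighted1 pi)) => //.
  by apply: (@dominated_kernel _ _ _ _ _ P (cst 1) (cst 1) 1).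
have h2 : \int[pi]_x ((1 - gam) * f x - b) <= \int[pi]_x (cut k x - v x).
  apply: (le_dominated_Rintegral m1 one_ge1 (weighted1 pi)).
  - apply: dominatedB; first exact: dominatedZ.
    exact: dominated_cst one_ge1 b.
  - exact: dominatedB.
  - move=> x; rewrite fE /cut /v; case: ifPn => wk.
      rewrite (min_idPl wk).
      have : Num.min (gam * w x + b) k <= gam * w x + b by rewrite ge_min lexx.
      by lra.
    rewrite mulr0 sub0r; have kw : k <= w x by rewrite ltW// ltNge.
    rewrite (min_idPr kw).
    have : Num.min (gam * w x + b) k <= k by rewrite ge_min lexx orbT.
    by move: b_ge0; lra.
rewrite (dominated_RintegralB m1 one_ge1 (weighted1 pi) dcut dv) in h2.
rewrite (dominated_RintegralB m1 one_ge1 (weighted1 pi) (dominatedZ _ df)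
  (dominated_cst one_ge1 b)) in h2.
rewrite (dominated_RintegralZ m1 one_ge1 _ (weighted1 pi) df)
  probability_Rintegral_cst in h2.
rewrite -/f; move: h1 h2.
by move: (\int[pi]_x f x) (\int[pi]_x cut k x) (\int[pi]_x v x) => I J L; lra.
Qed.

(** The bound on truncated moments does not depend on the level, so monotone convergence delivers
    the finiteness of the moment together with its bound. *)
Lemma stationary_moment_le : (\int[pi]_x (w x)%:E <= (b / (1 - gam))%:E)%E.
Proof.
have [gam0 gam1] := andP gam01; have g1 : 0 < 1 - gam by rewrite subr_gt0.
pose f (k : nat) x : \bar R := (w x * \1_[set x | w x <= k%:R] x)%:E.
have mS k : measurable [set x | w x <= k].
  rewrite -[X in measurable X]setTI.
  have -> : [set x | w x <= k] = w @^-1` `]-oo, k] by apply/seteqP; split=> x /=; rewrite in_itv.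
  exact: mw.
have mf k : measurable_fun [set: T] (f k).
  by apply/measurable_EFinP; exact: measurable_funM.
have f0 k x : (0 <= f k x)%E by rewrite lee_fin mulr_ge0.
have cvf x : f n x @[n --> \oo] --> (w x)%:E.
  apply: cvg_near_cst; near=> n.
  rewrite /f indicE mem_set ?mulr1//=.
  by near: n; exact: nbhs_infty_ger.
have -> : (\int[pi]_x (w x)%:E = \int[pi]_x limn (f^~ x))%E.
  by apply: eq_integral => x _; apply/esym/cvg_lim => //; exact: cvf.
have ndf x : nondecreasing_seq (f^~ x).
  move=> k l kl; rewrite lee_fin ler_wpM2l// !indicE.
  have [/set_mem/= wk|] := boolP (x \in [set x | w x <= k%:R]); last by rewrite ler0n.
  by rewrite mem_set//=; apply: (le_trans wk); rewrite ler_nat.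
rewrite monotone_convergence//.
apply: lime_le.
  apply: ereal_nondecreasing_is_cvgn => k l kl; apply: ge0_le_integral => //.
  by move=> x _; exact: ndf.
near=> k; have := cut_moment (ler0n R k).
have m1 : measurable_fun [set: T] (cst 1 : T -> R) by [].
have df : dominated (cst 1) (fun x => w x * \1_[set x | w x <= k%:R] x).
  apply: (bounded_dominated (k := k%:R)); first exact: measurable_funM.
  move=> x; rewrite indicE; case: (boolP (x \in _)) => [/set_mem/= wk|_].
    by rewrite mulr1 ger0_norm.
  by rewrite mulr0 normr0.
rewrite /f (dominated_EFin m1 one_ge1 (weighted1 pi) df) lee_fin.
by rewrite ler_pdivlMr// mulrC.
Unshelve. all: by end_near.
Qed.

End stationary_moment.

(** * First moments and tails along the chain *)

Section chain_tails.
Context d dO (T : measurableType d) (Omega : measurableType dO) (R : realType).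
Variables (P : R.-pker T ~> T) (x0 : T) (Q : probability Omega R)
  (X : nat -> Omega -> T).
Hypothesis chain : markov_chain P \d_x0 Q X.
Variables (u : T -> R) (gam b : R).
Hypotheses (mu : measurable_fun [set: T] u) (u_ge1 : forall x, 1 <= u x)
  (gam01 : 0 < gam < 1) (b_ge0 : 0 <= b)
  (Pu : forall x, (\int[P x]_y (u y)%:E <= (gam * u x + b)%:E)%E).

Let u_ge0 x : 0 <= u x. Proof. exact: le_trans ler01 (u_ge1 x). Qed.

Let mX n : measurable_fun [set: Omega] (X n).
Proof. by case: chain. Qed.

Lemma measurable_event (F : Omega -> R) y : measurable_fun [set: Omega] F ->
  measurable [set w | y < F w].
Proof.
move=> mF; rewrite -[X in measurable X]setTI.
have -> : [set w | y < F w] = F @^-1` `]y, +oo[.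
  by apply/seteqP; split=> w /=; rewrite in_itv/= andbT.
exact: mF.
Qed.

Lemma ge0_markov (F : Omega -> R) (a M : R) : measurable_fun [set: Omega] F ->
  (forall w, 0 <= F w) -> (\int[Q]_w (F w)%:E <= M%:E)%E -> 0 < a ->
  (Q [set w | (a < F w)%R] <= (M / a)%:E)%E.
Proof.
move=> mF F0 FM a0.
have mE := measurable_event a mF.
have h : (a%:E * Q [set w | (a < F w)%R] <= M%:E)%E.
  apply: le_trans FM.
  rewrite -[Q _](_ : \int[Q]_w (\1_[set w | (a < F w)%R] w)%:E = _)%E; last first.
    by rewrite integral_indic// setIT.
  rewrite -ge0_integralZl_EFin//; last 2 first.
  - exact/measurable_EFinP.
  - exact: ltW.
  apply: ge0_le_integral => //.
  - by move=> w _; rewrite -EFinM lee_fin mulr_ge0// ltW.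
  - by apply/measurable_EFinP; exact: measurable_funM.
  - exact/measurable_EFinP.
  - move=> w _; rewrite -EFinM lee_fin indicE.
    by have [/set_mem/= /ltW|] := boolP (w \in _); rewrite ?mulr1 ?mulr0.
have Qf : Q [set w | (a < F w)%R] \is a fin_num by rewrite fin_num_measure.
rewrite -(fineK Qf) -EFinM lee_fin in h; rewrite -(fineK Qf) lee_fin.
by rewrite ler_pdivlMr// mulrC.
Qed.

Lemma integral_dirac_start (h : T -> R) : measurable_fun [set: T] h ->
  (\int[\d_x0]_x (h x)%:E = (h x0)%:E)%E.
Proof.
by move=> mh; rewrite integral_dirac ?diracT ?mul1e//; exact/measurable_EFinP.
Qed.

Lemma chain_mean n : (\int[Q]_w (u (X n w))%:E <= (u x0 + b / (1 - gam))%:E)%E.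
Proof.
have [gam0 gam1] := andP gam01; have g1 : 0 < 1 - gam by rewrite subr_gt0.
pose K := b / (1 - gam).
have K0 : 0 <= K by rewrite divr_ge0// ltW.
have KE : gam * K + b = K by rewrite /K; field; rewrite gt_eqF.
elim: n => [|n IH].
  rewrite (chain_initial chain mu u_ge0) integral_dirac_start//.
  by rewrite lee_fin lerDl.
have := @chain_step _ _ _ _ _ _ _ _ _ chain (fun _ _ => 1) u n
  (fun=> measurable_cst _) (fun _ _ => ler01) mu u_ge0.
have p1 w : path_product X (fun _ _ => 1 : R) n.+1 w = 1.
  by rewrite /path_product big1.
under eq_integral do rewrite p1 mul1r.
move=> ->.
under eq_integral do rewrite p1 mul1e.
have muX : measurable_fun [set: Omega] (fun w => u (X n w)).
  exact: (measurableT_comp mu (mX n)).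
apply: (@le_trans _ _ (\int[Q]_w (gam%:E * (u (X n w))%:E + b%:E))%E).
  apply: ge0_le_integral => //.
  - by move=> w _; apply: integral_ge0 => y _; rewrite lee_fin.
  - pose k (w : Omega) : {measure set T -> \bar R} := P (X n w).
    apply: (@measurable_fun_integral_kernel _ _ Omega T R k _ (EFin \o u)).
    + by move=> A mA; exact: (measurableT_comp (measurable_kernel P A mA) (mX n)).
    + by move=> z; rewrite lee_fin.
    + exact/measurable_EFinP.
  - apply: emeasurable_funD => //; apply: emeasurable_funM => //.
    exact/measurable_EFinP.
have mEu : measurable_fun [set: Omega] (fun w => (u (X n w))%:E).
  exact/measurable_EFinP.
rewrite (@ge0_integralD _ _ _ Q _ measurableT (fun w => gam%:E * (u (X n w))%:E)%E (cst b%:E))//; first last.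
- by apply: emeasurable_funM.
- by move=> w _; rewrite -EFinM lee_fin mulr_ge0// ltW.
have gu : (\int[Q]_w (gam%:E * (u (X n w))%:E) = gam%:E * \int[Q]_w (u (X n w))%:E)%E.
  by apply: ge0_integralZl_EFin => //; [move=> w _; rewrite lee_fin|exact: ltW].
rewrite gu.
have -> : (\int[Q]_w b%:E = b%:E)%E.
  rewrite (@integral_cst _ _ _ Q _ measurableT b%:E) -[RHS]mule1.
  by congr (_ * _)%E; exact: probability_setT.
apply: (@le_trans _ _ (gam%:E * (u x0 + K)%:E + b%:E)%E).
  by rewrite leeD2r// lee_wpmul2l// lee_fin ltW.
rewrite -EFinM -EFinD lee_fin mulrDr -addrA KE lerD2r ler_piMl//.
exact: ltW.
Qed.

Lemma chain_weight_tail n v :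
  (Q [set w | (v < ln (u (X n w)))%R] <= ((u x0 + b / (1 - gam)) * expR (- v))%:E)%E.
Proof.
have -> : [set w | v < ln (u (X n w))] = [set w | expR v < u (X n w)].
  by apply/seteqP; split=> w /=; rewrite -[v < _]ltr_expR lnK// posrE (lt_le_trans ltr01).
have := ge0_markov (measurableT_comp mu (mX n)) (fun w => u_ge0 _) (chain_mean n)
  (expR_gt0 v).
by rewrite expRN.
Qed.

End chain_tails.

(** * The contribution of large values *)

Lemma measure_le_add d (T : measurableType d) (R : realType)
    (p : {measure set T -> \bar R}) (A B C : set T) (b c : R) :
  measurable A -> measurable B -> measurable C -> A `<=` B `|` C ->
  (p B <= b%:E)%E -> (p C <= c%:E)%E -> (p A <= (b + c)%:E)%E.
Proof.
move=> mA mB mC ABC pB pC; rewrite EFinD.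
apply: (le_trans _ (leeD pB pC)); apply: (le_trans _ (measureU2 p mB mC)).
by apply: le_measure; rewrite ?inE//; exact: measurableU.
Qed.

Section remainder_tail.
Context d dO (T : measurableType d) (Omega : measurableType dO) (R : realType).
Variables (P : R.-pker T ~> T) (x0 : T) (Q : probability Omega R)
  (X : nat -> Omega -> T).
Hypothesis chain : markov_chain P \d_x0 Q X.
Variables (u : T -> R) (gam b : R).
Hypotheses (mu : measurable_fun [set: T] u) (u_ge1 : forall x, 1 <= u x)
  (gam01 : 0 < gam < 1) (b_ge0 : 0 <= b)
  (Pu : forall x, (\int[P x]_y (u y)%:E <= (gam * u x + b)%:E)%E).

Let u_gt0 x : 0 < u x. Proof. exact: lt_le_trans ltr01 (u_ge1 x). Qed.

Let mX n : measurable_fun [set: Omega] (X n).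
Proof. by case: chain. Qed.

Let high (y : R) : set T := [set x | y < ln (u x)].

Let measurable_high y : measurable (high y).
Proof.
apply: (measurable_event y (F := fun x => ln (u x))).
exact: (measurableT_comp (@measurable_ln R) mu).
Qed.

Let visits y n w : R := \sum_(0 <= i < n) \1_(high y) (X i w).

Let measurable_visits y n : measurable_fun [set: Omega] (visits y n).
Proof.
apply: measurable_sum => i.
exact: (measurableT_comp (measurable_indic (measurable_high y)) (mX i)).
Qed.

(** Supermartingale with [W = 1 + e * u] and [e = expR (- L)]. At a visit [e * u >= 1], so the drift
    multiplies [W] by at most [(1 + gam) / 2], up to a factor [1 + e * b]. Over [n <= expR L] steps
    these factors cost no more than [expR b]. *)
Let visits_mean y n L : 0 <= L -> L <= y -> n%:R <= expR L ->
  (\int[Q]_w (expR (ln (2 / (1 + gam)) * visits y n w))%:E <= (expR b * (1 + u x0))%:E)%E.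
Proof.
have [gam0 gam1] := andP gam01.
move=> L0 Ly nL; pose e := expR (- L); pose c := ln (2 / (1 + gam)).
have e0 : 0 < e by exact: expR_gt0.
have e1 : e <= 1 by rewrite /e -[leRHS]expR0 ler_expR oppr_le0.
pose W x := 1 + e * u x.
pose f x := c * \1_(high y) x - e * b.
have W0 x : 0 <= W x by rewrite addr_ge0// mulr_ge0// ltW.
have W1 x : 1 <= W x by rewrite lerDl mulr_ge0// ltW.
have mW : measurable_fun [set: T] W.
  by apply: measurable_funD => //; exact: measurable_funM.
have mf : measurable_fun [set: T] f.
  by apply: measurable_funB => //; exact: measurable_funM.
have ec : expR c = 2 / (1 + gam) by rewrite lnK// posrE divr_gt0// addr_gt0.
have PW x : (\int[P x]_z (W z)%:E <= ((1 + e * b) * (1 + gam * (e * u x)))%:E)%E.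
  have -> : (\int[P x]_z (W z)%:E = 1 + e%:E * \int[P x]_z (u z)%:E)%E.
    transitivity (\int[P x]_z (1%:E + e%:E * (u z)%:E))%E.
      by apply: eq_integral => z _; rewrite -EFinM -EFinD.
    rewrite (@ge0_integralD _ _ _ (P x) _ measurableT (cst 1%:E)
      (fun z => e%:E * (u z)%:E)%E)//; last 2 first.
    - by move=> z _; rewrite -EFinM lee_fin mulr_ge0// ltW.
    - by apply: emeasurable_funM => //; exact/measurable_EFinP.
    rewrite (@integral_cst _ _ _ (P x) _ measurableT 1%:E) prob_kernel mule1.
    congr (_ + _)%E; apply: ge0_integralZl_EFin => //.
    + by move=> z _; rewrite lee_fin ltW.
    + exact/measurable_EFinP.
    + exact: ltW.
  apply: (@le_trans _ _ (1 + e%:E * (gam * u x + b)%:E)%E).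
    by rewrite leeD2l// lee_wpmul2l// lee_fin ltW.
  rewrite -EFinM -EFinD lee_fin.
  have : 0 <= (e * b) * (gam * (e * u x)).
    by rewrite !mulr_ge0// ltW.
  have -> : (1 + e * b) * (1 + gam * (e * u x)) =
      1 + e * (gam * u x + b) + e * b * (gam * (e * u x)) by ring.
  by rewrite lerDl.
have fW x : ((expR (f x))%:E * \int[P x]_z (W z)%:E <= (W x)%:E)%E.
  apply: (@le_trans _ _ ((expR (f x))%:E *
      ((1 + e * b) * (1 + gam * (e * u x)))%:E)%E).
    by rewrite lee_wpmul2l// lee_fin expR_ge0.
  rewrite -EFinM lee_fin.
  have eb : expR (- (e * b)) * (1 + e * b) <= 1.
    rewrite expRN mulrC ler_pdivrMr ?expR_gt0// mul1r.
    exact: expR_ge1Dx.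
  have g0 : 0 <= 1 + gam * (e * u x) by rewrite addr_ge0// !mulr_ge0// ltW.
  have key : expR (c * \1_(high y) x) * (1 + gam * (e * u x)) <= W x.
    rewrite indicE; case: (boolP (x \in high y)) => [/set_mem/= xy|_]; last first.
      rewrite mulr0 expR0 mul1r /W lerD2l ler_piMl ?ltW//.
      by rewrite mulr_gt0.
    rewrite mulr1 ec mulrAC ler_pdivrMr ?addr_gt0// /W.
    have : 1 <= e * u x.
      rewrite /e expRN mulrC ler_pdivlMr ?expR_gt0// mul1r.
      rewrite -[u x]lnK ?posrE// ler_expR; exact/ltW/(le_lt_trans Ly).
    move: (e * u x) => z z1.
    have : 0 <= (1 - gam) * (z - 1) by rewrite mulr_ge0// subr_ge0// ltW.
    by lra.
  rewrite /f expRD.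
  have -> : expR (c * \1_(high y) x) * expR (- (e * b)) *
      ((1 + e * b) * (1 + gam * (e * u x))) =
      (expR (- (e * b)) * (1 + e * b)) *
      (expR (c * \1_(high y) x) * (1 + gam * (e * u x))) by ring.
  apply: le_trans key; rewrite ler_piMl// mulr_ge0// expR_ge0//.
have sm := chain_supermartingale chain mf mW W0 fW n.
rewrite (integral_dirac_start _ mW) in sm.
have sumE w : \sum_(0 <= i < n) f (X i w) = c * visits y n w - n%:R * (e * b).
  rewrite big_split/= -mulr_sumr; congr (_ + _).
  by rewrite big_const_nat iter_addr addr0 subn0 mulNrn mulr_natl.
have ne : n%:R * (e * b) <= b.
  rewrite mulrA ler_piMl//.
  by rewrite /e expRN ler_pdivrMr ?expR_gt0// mul1r.
have m1 : measurable_fun [set: Omega] (fun w => expR (c * visits y n w)).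
  apply: (measurableT_comp (@measurable_expR R)); exact: measurable_funM.
have mWX : measurable_fun [set: Omega] (fun w => W (X n w)).
  exact: (measurableT_comp mW (mX n)).
apply: (@le_trans _ _ ((expR b)%:E * (W x0)%:E)%E); last first.
  by rewrite -EFinM lee_fin ler_wpM2l ?expR_ge0// /W lerD2l ler_piMl// ltW.
apply: (@le_trans _ _ ((expR b)%:E * \int[Q]_w (expR (\sum_(0 <= i < n) f (X i w)) * W (X n w))%:E)%E); last first.
  by apply: lee_wpmul2l => //; rewrite lee_fin expR_ge0.
have mfW : measurable_fun [set: Omega]
    (fun w => (expR (\sum_(0 <= i < n) f (X i w)) * W (X n w))%:E).
  apply/measurable_EFinP; apply: measurable_funM => //.
  apply: (measurableT_comp (@measurable_expR R)); apply: measurable_sum => i.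
  exact: (measurableT_comp mf (mX i)).
rewrite -(ge0_integralZl_EFin Q measurableT (k := expR b) _ mfW (expR_ge0 _)); last first.
  by move=> w _; rewrite lee_fin mulr_ge0// expR_ge0.
apply: ge0_le_integral => //.
- exact/measurable_EFinP.
- by apply: emeasurable_funM.
- move=> w _; rewrite -EFinM lee_fin mulrA -expRD sumE.
  rewrite -[leLHS]mulr1; apply: ler_pM => //; rewrite ?expR_ge0//.
  by rewrite ler_expR; move: ne; rewrite -/c; lra.
Qed.

Let visits_tail y n L v : 0 <= L -> L <= y -> n%:R <= expR L ->
  (Q [set w | (v < visits y n w)%R]
    <= (expR b * (1 + u x0) * expR (- (ln (2 / (1 + gam)) * v)))%:E)%E.
Proof.
have [gam0 gam1] := andP gam01.
move=> L0 Ly nL; pose c := ln (2 / (1 + gam)).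
have c0 : 0 < c.
  rewrite ln_gt0// ltr_pdivlMr ?addr_gt0// mul1r.
  by move: gam1; lra.
have -> : [set w | v < visits y n w] =
    [set w | expR (c * v) < expR (c * visits y n w)].
  by apply/seteqP; split=> w /=; rewrite ltr_expR ltr_pM2l.
rewrite expRN; apply: ge0_markov.
- by apply: (measurableT_comp (@measurable_expR R)); exact: measurable_funM.
- by move=> w; exact: expR_ge0.
- exact: visits_mean Ly nL.
- exact: expR_gt0.
Qed.

Let high_tail n L M : n%:R <= expR L ->
  (Q [set w | (expR M < \sum_(0 <= i < n) u (X i w))%R]
    <= ((u x0 + b / (1 - gam)) * expR (L - M))%:E)%E.
Proof.
have [gam0 gam1] := andP gam01.
move=> nL.
have K0 : 0 <= u x0 + b / (1 - gam).
  by rewrite addr_ge0 ?(ltW (u_gt0 _))// divr_ge0// subr_ge0 ltW.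
have muX i : measurable_fun [set: Omega] (fun w => u (X i w)).
  exact: (measurableT_comp mu (mX i)).
rewrite expRB mulrA; apply: ge0_markov.
- exact: measurable_sum.
- by move=> w; apply: sumr_ge0 => i _; exact: ltW.
- under eq_integral do rewrite -sumEFin.
  rewrite (@ge0_integral_sum _ _ _ Q _ measurableT _
    (fun i w => (u (X i w))%:E))//; last 2 first.
  - by move=> i; exact/measurable_EFinP.
  - by move=> i w _; rewrite lee_fin ltW.
  apply: (@le_trans _ _ (\sum_(0 <= i < n) (u x0 + b / (1 - gam))%:E)%E).
    by apply: lee_sum => i _; exact: (chain_mean chain mu u_ge1 gam01 b_ge0 Pu).
  rewrite sumEFin lee_fin big_const_nat iter_addr addr0 subn0 -mulr_natr.
  exact: ler_wpM2l.
- exact: expR_gt0.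
Qed.

(** Origin of the exponent [1 / (s + 1)]: either the sum of the [u (X i)] exceeds [expR (max v y)],
    or all terms are at most [v ^ s] and there are more than [v] of them. The first event has a
    factor [n <= expR L], which [2 * L <= y] turns into the halved rate [v / 2]. *)
Lemma remainder_tail (s L y v : R) (n : nat) : 0 < s -> 0 <= L -> 2 * L <= y ->
  n%:R <= expR L -> 0 <= v ->
  (Q [set w | (v `^ (s + 1) < \sum_(0 <= i < n)
       ln (u (X i w)) `^ s * \1_[set x | (y < ln (u x))%R] (X i w))%R]
    <= ((u x0 + b / (1 - gam)) * expR (- (v / 2)) +
        expR b * (1 + u x0) * expR (- (ln (2 / (1 + gam)) * v)))%:E)%E.
Proof.
have [gam0 gam1] := andP gam01.
move=> s0 L0 Ly nL v0.
have K0 : 0 <= u x0 + b / (1 - gam).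
  by rewrite addr_ge0 ?(ltW (u_gt0 _))// divr_ge0// subr_ge0 ltW.
pose M := Num.max v y.
have ml : measurable_fun [set: T] (fun x => ln (u x) `^ s).
  by apply: (measurableT_comp (measurable_powR s));
     exact: (measurableT_comp (@measurable_ln R) mu).
have muX i : measurable_fun [set: Omega] (fun w => u (X i w)).
  exact: (measurableT_comp mu (mX i)).
apply: (@measure_le_add _ _ _ Q _
  [set w | expR M < \sum_(0 <= i < n) u (X i w)] [set w | v < visits y n w]).
- apply: measurable_event; apply: measurable_sum => i.
  apply: (measurableT_comp (f := fun x => ln (u x) `^ s * \1_(high y) x) _ (mX i)).
  by apply: measurable_funM => //; exact: measurable_indic.
- by apply: measurable_event; exact: measurable_sum.
- by apply: measurable_event; exact: measurable_visits.
- move=> w /= vw; have [//|uM] := ltP (expR M) (\sum_(0 <= i < n) u (X i w)).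
    by left.
  right; have lM i : (i < n)%N -> ln (u (X i w)) <= M.
    move=> ni; rewrite -ler_expR lnK ?posrE//; apply: le_trans uM.
    rewrite (bigD1_seq i) ?iota_uniq ?mem_index_iota//=.
    by rewrite lerDl sumr_ge0// => j _; exact: ltW.
  (* If [v <= y], no state passes the threshold [y]: the sum is zero and cannot exceed a nonnegative
     power. *)
  have [vy|yv] := leP v y.
    exfalso; move: vw; apply/negP; rewrite -leNgt.
    rewrite big_nat big1 ?powR_ge0// => i /andP[_ ni].
    rewrite indicE memNset ?mulr0//=; apply/negP; rewrite -leNgt.
    by apply: (le_trans (lM i ni)); rewrite /M (max_idPr vy).
  have y0 : 0 <= y by rewrite (le_trans _ Ly)// mulr_ge0.
  have vp : 0 < v by exact: le_lt_trans yv.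
  have vs : 0 < v `^ s by exact: powR_gt0.
  rewrite -(ltr_pM2l vs); apply: lt_le_trans (_ : v `^ s * v < _) _; last first.
    exact: lexx.
  have <- : v `^ (s + 1) = v `^ s * v.
    by rewrite powRD ?powRr1//; rewrite ?(gt_eqF vp) ?implybT.
  apply: (lt_le_trans vw); rewrite /visits mulr_sumr.
  rewrite !big_nat; apply: ler_sum => i /andP[_ ni].
  apply: ler_wpM2r => //; apply: ge0_ler_powR; rewrite ?nnegrE ?ln_ge0//.
  - exact: ltW.
  - by apply: (le_trans (lM i ni)); rewrite /M (max_idPl (ltW yv)).
- apply: (le_trans (high_tail M nL)); rewrite lee_fin ler_wpM2l// ler_expR.
  have : v <= M by rewrite le_max lexx.
  have : y <= M by rewrite le_max lexx orbT.
  by move: Ly; lra.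
- apply: visits_tail nL => //; move: Ly L0; lra.
Qed.

End remainder_tail.

Lemma powR_le_expR (R : realType) (s z : R) : 0 < s -> 0 <= z ->
  z `^ s <= (2 * s) `^ s * expR (z / 2).
Proof.
move=> s0 z0.
have s20 : 0 < 2 * s by rewrite mulr_gt0.
have zE : z = 2 * s * (z / (2 * s)) by rewrite mulrCA divff ?mulr1// gt_eqF.
have q0 : 0 <= z / (2 * s) by rewrite divr_ge0// ltW.
have -> : expR (z / 2) = expR (z / (2 * s)) `^ s.
  rewrite -expRM; congr expR; field; rewrite gt_eqF//.
rewrite {1}zE powRM ?(ltW s20)//.
apply: ler_wpM2l; first exact: powR_ge0.
apply: ge0_ler_powR; rewrite ?nnegrE ?expR_ge0//; first exact: ltW.
by apply: le_trans (expR_ge1Dx _); rewrite lerDr.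
Qed.

(** * Truncation of the function and its effect on the variance *)

Section truncation.
Context d (T : measurableType d) (R : realType).
Variables (P : R.-pker T ~> T) (nu : probability T R) (C : set T) (delta : R).
Hypotheses (mC : measurable C) (delta_ge0 : 0 <= delta)
  (small : small_set P C nu delta).
Local Notation Q := (residual mC delta_ge0 small).
Variables (u : T -> R) (gam : R).
Hypotheses (mu : measurable_fun [set: T] u) (u_ge1 : forall x, 1 <= u x)
  (gam01 : 0 < gam < 1)
  (Qu : forall x, (\int[Q x]_y (u y)%:E <= (gam * u x)%:E)%E).
Variables (pi : probability T R) (M : R).
Hypothesis (piu2 : (\int[pi]_x (sqr_weight u x)%:E <= M%:E)%E).
Variables (g : T -> R) (s k : R).
Hypotheses (mg : measurable_fun [set: T] g) (s_gt0 : 0 < s) (k_ge0 : 0 <= k)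
  (g_le : forall x, `|g x| <= k * ln (u x) `^ s).

(** By [powR_le_expR], [g] is at most [linear_rate] times the square root of [u]. The spare half
    power of [u] makes the part beyond the truncation level exponentially small. *)
Definition linear_rate := k * (2 * s) `^ s.
Definition centered_rate := linear_rate * (1 + M).
Local Notation ku := linear_rate.
Local Notation k0 := centered_rate.

Let u_gt0 x : 0 < u x. Proof. exact: lt_le_trans ltr01 (u_ge1 x). Qed.
Let mu2 := measurable_sqr_weight mu.
Let u2_ge1 := sqr_weight_ge1 u_ge1.

Let wpi2 : weighted (sqr_weight u) pi.
Proof. exact: le_lt_trans piu2 (ltry _). Qed.

Let wpi : weighted u pi. Proof. exact: (weighted_sqr mu u_ge1 wpi2). Qed.

Let Rpiu2 : \int[pi]_x sqr_weight u x <= M.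
Proof.
rewrite -lee_fin -(dominated_EFin mu2 u2_ge1 wpi2)//.
exact: dominated_self mu2 u2_ge1.
Qed.

Let Rpiu : \int[pi]_x u x <= M.
Proof.
apply: le_trans Rpiu2; apply: (le_dominated_Rintegral mu2 u2_ge1 wpi2).
- exact: (dominated_sqr u_ge1 (dominated_self mu u_ge1)).
- exact: dominated_self mu2 u2_ge1.
- exact: le_sqr_weight.
Qed.

Let M_ge1 : 1 <= M.
Proof.
apply: le_trans Rpiu; rewrite -[leLHS](probability_Rintegral_cst pi).
apply: (le_dominated_Rintegral mu u_ge1 wpi) => //; first exact: dominated_cst.
exact: dominated_self.
Qed.

Let ku_ge0 : 0 <= ku. Proof. by rewrite mulr_ge0// powR_ge0. Qed.
Let k0_ge0 : 0 <= k0.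
Proof. by rewrite mulr_ge0// addr_ge0// (le_trans ler01). Qed.

Lemma linear_growth x : `|g x| <= ku * expR (ln (u x) / 2).
Proof.
apply: (le_trans (g_le x)); rewrite /ku -mulrA ler_wpM2l//.
by apply: powR_le_expR => //; exact: ln_ge0.
Qed.

Let sqrt_le x : expR (ln (u x) / 2) <= u x.
Proof.
rewrite -[leRHS]lnK ?posrE// ler_expR.
by have := ln_ge0 (u_ge1 x); move: (ln (u x)) => z z0; lra.
Qed.

Let g_u x : `|g x| <= ku * u x.
Proof. by apply: (le_trans (linear_growth x)); rewrite ler_wpM2l. Qed.

Let dg : dominated u g. Proof. by split=> //; exists ku. Qed.

Definition centered x := g x - \int[pi]_y g y.

Lemma measurable_centered : measurable_fun [set: T] centered.
Proof. exact: measurable_funB. Qed.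

Let abs_pi (f : T -> R) a : 0 <= a -> measurable_fun [set: T] f ->
  (forall x, `|f x| <= a * u x) -> `|\int[pi]_x f x| <= a * M.
Proof.
move=> a0 mf fa; apply: (le_trans (dominated_Rintegral_le mu u_ge1 wpi mf fa)).
exact: ler_wpM2l.
Qed.

Let sub_pi (f : T -> R) a x : 0 <= a -> measurable_fun [set: T] f ->
  (forall x, `|f x| <= a * u x) -> `|f x - \int[pi]_y f y| <= a * (1 + M) * u x.
Proof.
move=> a0 mf fa; apply: (le_trans (ler_normB _ _)).
rewrite mulrDr mulr1 mulrDl; apply: lerD => //.
apply: (le_trans (abs_pi a0 mf fa)); rewrite ler_peMr//.
by rewrite mulr_ge0// (le_trans ler01).
Qed.

Lemma centered_le x : `|centered x| <= k0 * u x.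
Proof. exact: sub_pi. Qed.

Lemma centered_mean0 : \int[pi]_x centered x = 0.
Proof.
rewrite (dominated_RintegralB mu u_ge1 wpi dg (dominated_cst u_ge1 _)).
by rewrite probability_Rintegral_cst subrr.
Qed.

Variable y : R.
Hypothesis y_ge0 : 0 <= y.

Let low : set T := [set x | ln (u x) <= y].
Let high : set T := [set x | y < ln (u x)].

Let mlnu : measurable_fun [set: T] (fun x => ln (u x)).
Proof. exact: (measurableT_comp (@measurable_ln R) mu). Qed.

Let measurable_low : measurable low.
Proof.
rewrite -[X in measurable X]setTI.
have -> : low = (fun x => ln (u x)) @^-1` `]-oo, y].
  by apply/seteqP; split=> x /=; rewrite in_itv.
exact: mlnu.
Qed.

Let measurable_high : measurable high.
Proof.
rewrite -[X in measurable X]setTI.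
have -> : high = (fun x => ln (u x)) @^-1` `]y, +oo[.
  by apply/seteqP; split=> x /=; rewrite in_itv/= andbT.
exact: mlnu.
Qed.

Let gl x := g x * \1_low x.
Let gh x := g x * \1_high x.

Let glE x : gl x = if ln (u x) <= y then g x else 0.
Proof.
rewrite /gl indicE; case: ifPn => h; first by rewrite mem_set ?mulr1.
by rewrite memNset ?mulr0//; exact/negP.
Qed.

Let ghE x : gh x = if ln (u x) <= y then 0 else g x.
Proof.
rewrite /gh indicE; case: ifPn => h; last by rewrite mem_set ?mulr1// /high/= ltNge.
by rewrite memNset ?mulr0// /high/= ltNge h.
Qed.

Let gE x : g x = gl x + gh x.
Proof. by rewrite glE ghE; case: ifP; rewrite ?addr0 ?add0r. Qed.

Let mgl : measurable_fun [set: T] gl.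
Proof. by apply: measurable_funM => //; exact: measurable_indic. Qed.
Let mgh : measurable_fun [set: T] gh.
Proof. by apply: measurable_funM => //; exact: measurable_indic. Qed.

Let gl_u x : `|gl x| <= ku * u x.
Proof.
by rewrite glE; case: ifP => // _; rewrite normr0 mulr_ge0// ltW.
Qed.

Let gh_u x : `|gh x| <= ku * expR (- (y / 2)) * u x.
Proof.
rewrite ghE; case: ifPn => [_|]; first by rewrite normr0; apply: mulr_ge0; [rewrite mulr_ge0// expR_ge0|exact: ltW].
rewrite -ltNge => yu; apply: (le_trans (linear_growth x)).
rewrite -mulrA ler_wpM2l// -[u x in leRHS]lnK ?posrE// -expRD ler_expR.
by move: yu; move: (ln (u x)) => z yz; lra.
Qed.

Let dgl : dominated u gl. Proof. by split=> //; exists ku. Qed.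
Let dgh : dominated u gh. Proof. by split=> //; exists (ku * expR (- (y / 2))) => x; exact: gh_u. Qed.

Let pigE : \int[pi]_x g x = \int[pi]_x gl x + \int[pi]_x gh x.
Proof.
rewrite -(dominated_RintegralD mu u_ge1 wpi dgl dgh).
by apply: eq_Rintegral => x _; exact: gE.
Qed.

(** Recentred after the cut, so that its block sums still have mean zero under [nu]. *)
Definition truncated x := gl x - \int[pi]_z gl z.

Lemma measurable_truncated : measurable_fun [set: T] truncated.
Proof. exact: measurable_funB. Qed.

Lemma truncated_le x : `|truncated x| <= 2 * k * y `^ s.
Proof.
have glb z : `|gl z| <= k * y `^ s * cst 1 z.
  rewrite /= mulr1 glE; case: ifP => zy; last by rewrite normr0 mulr_ge0// powR_ge0.
  apply: (le_trans (g_le z)); rewrite ler_wpM2l//.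
  by apply: ge0_ler_powR; rewrite ?nnegrE ?ln_ge0//; exact: ltW.
have one1 (z : T) : 1 <= cst (1 : R) z by [].
have m1 : measurable_fun [set: T] (cst (1 : R)) by [].
have w1 : weighted (cst 1) pi.
  rewrite /weighted (@integral_cst _ _ _ pi _ measurableT 1%:E) mul1e.
  by apply: (@le_lt_trans _ _ 1%E); [exact: probability_le1|exact: ltry].
have := dominated_Rintegral_le m1 one1 w1 mgl glb.
rewrite (probability_Rintegral_cst pi 1) mulr1 => h.
apply: (le_trans (ler_normB _ _)).
have := glb x; rewrite /= mulr1 => h2.
by apply: (le_trans (lerD h2 h)); rewrite -mulrA mulr_natl mulr2n.
Qed.

Lemma truncated_mean0 : \int[pi]_x truncated x = 0.
Proof.
rewrite (dominated_RintegralB mu u_ge1 wpi dgl (dominated_cst u_ge1 _)).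
by rewrite probability_Rintegral_cst subrr.
Qed.

Let truncated_u x : `|truncated x| <= k0 * u x.
Proof. exact: sub_pi. Qed.

Let r x := gh x - \int[pi]_z gh z.

Let mr : measurable_fun [set: T] r. Proof. exact: measurable_funB. Qed.

Let r_u x : `|r x| <= k0 * expR (- (y / 2)) * u x.
Proof.
have e0 : 0 <= ku * expR (- (y / 2)) by rewrite mulr_ge0// expR_ge0.
have -> : k0 * expR (- (y / 2)) = ku * expR (- (y / 2)) * (1 + M) by rewrite /k0 mulrAC.
exact: sub_pi.
Qed.

Let centeredE x : centered x = truncated x + r x.
Proof. by rewrite /centered /truncated /r gE pigE; lra. Qed.

(** Three parts: a bounded centred function, the large values left to [remainder_tail], and the mean
    of the large values, which the spare half power of [u] makes small. *)
Lemma centered_le_truncated x : centered x <= truncated x +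
  k * (ln (u x) `^ s * \1_[set z | y < ln (u z)] x) + k0 * expR (- (y / 2)).
Proof.
rewrite centeredE -[leRHS]addrA; apply: lerD; first exact: lexx.
rewrite /r; apply: lerD.
  rewrite /gh mulrA ler_wpM2r//.
  exact: le_trans (ler_norm _) (g_le x).
rewrite (le_trans (ler_norm _))// normrN.
have e0 : 0 <= ku * expR (- (y / 2)) by rewrite mulr_ge0// expR_ge0.
apply: (le_trans (abs_pi e0 mgh gh_u)).
rewrite /k0 [leRHS]mulrAC ler_wpM2l// lerDr//.
Qed.

Local Notation hc := (block_sum mC delta_ge0 small measurable_centered).
Local Notation ht := (block_sum mC delta_ge0 small measurable_truncated).
Local Notation hr := (block_sum mC delta_ge0 small mr).

Let e := expR (- (y / 2)).
Let e_ge0 : 0 <= e. Proof. exact: expR_ge0. Qed.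
Let k0e_ge0 : 0 <= k0 * e. Proof. exact: mulr_ge0. Qed.

Let dhc := dominated_block_sum mu u_ge1 gam01 Qu measurable_centered k0_ge0 centered_le.
Let dht := dominated_block_sum mu u_ge1 gam01 Qu measurable_truncated k0_ge0 truncated_u.
Let dhr := dominated_block_sum mu u_ge1 gam01 Qu mr k0e_ge0 r_u.

Let wQ x : weighted u (Q x).
Proof. exact: le_lt_trans (Qu x) (ltry _). Qed.

(** The defect of additivity is a dominated fixed point of the residual kernel. *)
Let hcE x : hc x = ht x + hr x.
Proof.
pose D z := hc z - ht z - hr z.
have dD : dominated u D by apply: dominatedB => //; exact: dominatedB.
have DQ z : D z = \int[Q z]_t D t.
  rewrite (dominated_RintegralB mu u_ge1 (wQ z) (dominatedB dhc dht) dhr).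
  rewrite (dominated_RintegralB mu u_ge1 (wQ z) dhc dht) /D.
  have aux (t r' a b c : R) : t + r' + a - (t + b) - (r' + c) = a - b - c by ring.
  have h1 := block_sumE mu u_ge1 gam01 Qu measurable_centered k0_ge0 centered_le z.
  have h2 := block_sumE mu u_ge1 gam01 Qu measurable_truncated k0_ge0 truncated_u z.
  have h3 := block_sumE mu u_ge1 gam01 Qu mr k0e_ge0 r_u z.
  rewrite [in LHS]h1 [in LHS]h2 [in LHS]h3 centeredE; exact: aux.
have := Q_fixpoint_eq0 mu u_ge1 gam01 Qu dD DQ x; rewrite /D -addrA -opprD.
by move=> /eqP; rewrite subr_eq0 => /eqP.
Qed.

Let gam1 : 0 < 1 - gam. Proof. by case/andP: gam01 => _; rewrite subr_gt0. Qed.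

Let ht_u x : `|ht x| <= k0 / (1 - gam) * u x.
Proof. exact: (block_sum_le mu u_ge1 gam01 Qu measurable_truncated k0_ge0 truncated_u). Qed.

Let hc_u x : `|hc x| <= k0 / (1 - gam) * u x.
Proof. exact: (block_sum_le mu u_ge1 gam01 Qu measurable_centered k0_ge0 centered_le). Qed.

Let hr_u x : `|hr x| <= k0 * e / (1 - gam) * u x.
Proof. exact: (block_sum_le mu u_ge1 gam01 Qu mr k0e_ge0 r_u). Qed.

Let abs_mul (a b A B v : R) : 0 <= v -> 0 <= A -> 0 <= B ->
  `|a| <= A * v -> `|b| <= B * v -> a * b <= A * B * v ^+ 2.
Proof.
move=> v0 A0 B0 aA bB; apply: (le_trans (ler_norm _)); rewrite normrM.
by apply: (le_trans (ler_pM _ _ aA bB)) => //; rewrite expr2 mulrACA.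
Qed.

Let dsq (a : R) : dominated (sqr_weight u) (fun x => a * sqr_weight u x).
Proof. by apply: dominatedZ; exact: dominated_self mu2 u2_ge1. Qed.

Let pi_sq a : 0 <= a -> \int[pi]_x (a * sqr_weight u x) <= a * M.
Proof.
move=> a0; rewrite (dominated_RintegralZ mu2 u2_ge1 a wpi2 (dominated_self mu2 u2_ge1)).
exact: ler_wpM2l.
Qed.

Let dt : dominated u truncated.
Proof. by split=> //; [exact: measurable_truncated|exists k0]. Qed.
Let dc : dominated u centered.
Proof. by split; [exact: measurable_centered|exists k0 => x; exact: centered_le]. Qed.

Let var (f h : T -> R) x := 2 * f x * h x - f x ^+ 2.

Let dvar f h : dominated u f -> dominated u h -> dominated (sqr_weight u) (var f h).
Proof.
move=> df dh; rewrite (_ : var f h = fun x => 2 * (f x * h x) - f x * f x); last first.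
  by apply/funext => x; rewrite /var mulrA expr2.
apply: dominatedB; first by apply: dominatedZ; exact: dominatedM.
exact: dominatedM.
Qed.

Lemma limit_variance_le : limit_variance pi g hc <= 2 * k0 ^+ 2 * M / (1 - gam).
Proof.
pose a := 2 * k0 ^+ 2 / (1 - gam).
have a0 : 0 <= a by rewrite divr_ge0// ?(ltW gam1)// mulr_ge0// sqr_ge0.
rewrite (_ : 2 * k0 ^+ 2 * M / (1 - gam) = a * M); last by rewrite /a mulrAC.
apply: le_trans (pi_sq a0).
apply: (le_dominated_Rintegral mu2 u2_ge1 wpi2) => //; first exact: dvar dc dhc.
move=> x; rewrite -/(var centered hc x); have := sqr_ge0 (centered x).
have h0 : 0 <= k0 / (1 - gam) by rewrite divr_ge0// ltW.
have := abs_mul (ltW (u_gt0 x)) k0_ge0 h0 (centered_le x) (hc_u x).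
have -> : a * sqr_weight u x = 2 * (k0 * (k0 / (1 - gam)) * u x ^+ 2).
  by rewrite /a /sqr_weight expr2 !mulrA.
have -> : var centered hc x = 2 * (centered x * hc x) - centered x ^+ 2.
  by rewrite /var mulrA.
move: (centered x * hc x) (centered x ^+ 2) (k0 * (k0 / (1 - gam)) * u x ^+ 2).
by move=> p q r'; lra.
Qed.

(** The difference of the two integrands is a sum of four products, each containing [r] or its block
    sum and hence a factor [e]. Their coefficients 2, 2, 1 and 1 add up to 6. *)
Lemma truncated_variance_le :
  \int[pi]_x (2 * truncated x * ht x - truncated x ^+ 2)
    <= limit_variance pi g hc + 6 * k0 ^+ 2 * M / (1 - gam) * e.
Proof.
pose a := 6 * k0 ^+ 2 / (1 - gam) * e.
have a0 : 0 <= a.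
  by rewrite mulr_ge0// divr_ge0// ?(ltW gam1)// mulr_ge0// sqr_ge0.
have -> : 6 * k0 ^+ 2 * M / (1 - gam) * e = a * M.
  by rewrite /a; ring.
rewrite -lerBlDl; apply: le_trans (pi_sq a0).
rewrite /limit_variance -(dominated_RintegralB mu2 u2_ge1 wpi2 (dvar dt dht) (dvar dc dhc)).
apply: (le_dominated_Rintegral mu2 u2_ge1 wpi2) => //.
  exact: (dominatedB (dvar dt dht) (dvar dc dhc)).
move=> x; rewrite /var.
have h0 : 0 <= k0 / (1 - gam) by rewrite divr_ge0// ltW.
have h1 : 0 <= k0 * e / (1 - gam) by rewrite divr_ge0// ltW.
have ux := ltW (u_gt0 x).
have rN : `|- r x| <= k0 * e * u x by rewrite normrN; exact: r_u.
have tN : `|- truncated x| <= k0 * u x by rewrite normrN; exact: truncated_u.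
have b1 := abs_mul ux k0e_ge0 h0 rN (hc_u x).
have b2 := abs_mul ux k0_ge0 h1 tN (hr_u x).
have b3 := abs_mul ux k0e_ge0 k0_ge0 (r_u x) (truncated_u x).
have b4 := abs_mul ux k0e_ge0 k0_ge0 (r_u x) (centered_le x).
have j1 : 1 <= (1 - gam)^-1.
  by rewrite invf_ge1//; case/andP: gam01 => /ltW; move: gam1; lra.
pose z := k0 ^+ 2 * e * u x ^+ 2.
have z0 : 0 <= z by apply: mulr_ge0 (sqr_ge0 _); apply: mulr_ge0 e_ge0; exact: sqr_ge0.
have e1 : k0 * e * (k0 / (1 - gam)) * u x ^+ 2 = z * (1 - gam)^-1.
  by rewrite /z; ring.
have e2 : k0 * (k0 * e / (1 - gam)) * u x ^+ 2 = z * (1 - gam)^-1.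
  by rewrite /z; ring.
have e3 : k0 * e * k0 * u x ^+ 2 = z by rewrite /z; ring.
have e4 : a * sqr_weight u x = 6 * (z * (1 - gam)^-1).
  by rewrite /a /sqr_weight /z; ring.
have zj : z <= z * (1 - gam)^-1 by rewrite ler_peMr.
rewrite e1 in b1; rewrite e2 in b2; rewrite e3 in b3 b4; rewrite e4.
have -> : 2 * truncated x * ht x - truncated x ^+ 2 -
    (2 * centered x * hc x - centered x ^+ 2) =
    2 * (- r x * hc x) + 2 * (- truncated x * hr x) + r x * truncated x + r x * centered x.
  by rewrite hcE centeredE; ring.
move: b1 b2 b3 b4 zj.
move: (- r x * hc x) (- truncated x * hr x) (r x * truncated x) (r x * centered x).
by move: (z / (1 - gam)) => z' p1 p2 p3 p4; lra.
Qed.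

End truncation.

(** * Choice of the parameters *)

Section tuning.
Variable R : realType.
Implicit Types eta x p q w : R.

Let expR_small x : x <= 1 / 2 -> expR x <= 2.
Proof.
move=> x1; have h := expR_ge1Dx (- x).
have : 2^-1 <= expR (- x) by lra.
rewrite expRN => h2; rewrite -[expR x]invrK.
by rewrite invf_ple ?posrE ?invr_gt0 ?expR_gt0.
Qed.

(** Accounting of the slack: [a] exceeds the ideal [w * sig2 / 2] by [w * sig2 * eta / 4] and by
    multiples of [w * E], which together cover the cubic loss [x] and the errors [p] and [q]. *)
Let budget eta w sig2 sigt Ks G E x a p q : 0 < eta <= 1 -> 0 <= w ->
  0 <= sig2 -> 0 <= Ks -> 0 <= G -> 0 <= E -> sigt <= sig2 + Ks * E ->
  0 <= x -> x <= eta / 16 ->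
  a = w / 2 * ((1 + eta / 2) * sig2 + (2 * Ks + G) * E) ->
  p <= a * (eta / 16) -> q <= w * (G * E) / 16 ->
  w * sigt * (2^-1 + x) + (p + q) <= a.
Proof.
move=> /andP[eta0 eta1] w0 s0 Ks0 G0 E0 st x0 xe aE pa qw.
have h1 : w * sigt * (2^-1 + x) <= w * (sig2 + Ks * E) * (2^-1 + x).
  by apply: ler_wpM2r; [lra|exact: ler_wpM2l].
have wS : 0 <= w * (sig2 + Ks * E) by rewrite mulr_ge0// addr_ge0// mulr_ge0.
have h2 : w * (sig2 + Ks * E) * (2^-1 + x) <= w * (sig2 + Ks * E) * (2^-1 + eta / 16).
  by rewrite ler_wpM2l// lerD2l.
apply: (le_trans (lerD (le_trans h1 h2) (lerD pa qw))).
have wsig : 0 <= w * sig2 by rewrite mulr_ge0.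
have wK : 0 <= w * (Ks * E) by rewrite !mulr_ge0.
have wG : 0 <= w * (G * E) by rewrite !mulr_ge0.
rewrite -subr_ge0.
have -> : a - (w * (sig2 + Ks * E) * (2^-1 + eta / 16) + (a * (eta / 16) + w * (G * E) / 16)) =
    w * sig2 * (eta * (5 / 32 - eta / 64)) + w * (Ks * E) * (2^-1 - eta / 8) +
    w * (G * E) * (7 / 16 - eta / 32).
  by rewrite aE; field.
by rewrite addr_ge0// ?addr_ge0// mulr_ge0//; [rewrite mulr_ge0//; lra|lra|lra].
Qed.

Variables (c K N Sg Ks Cs k2 : R).
Hypotheses (c_gt0 : 0 < c) (K_gt0 : 0 < K) (N_gt0 : 0 < N) (Sg_ge0 : 0 <= Sg)
  (Ks_ge0 : 0 <= Ks) (Cs_ge0 : 0 <= Cs) (k2_gt0 : 0 < k2).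

Let k3 := 4 * (6 / (c / 4) ^+ 3).
Let k3_ge0 : 0 <= k3.
Proof. by rewrite mulr_ge0// divr_ge0// exprn_ge0// divr_ge0// ltW. Qed.
Let X := 2 * K * N.
Let X_ge0 : 0 <= X. Proof. by rewrite !mulr_ge0// ltW. Qed.

(** The reciprocal of a sum: its product with each summand is at most 1, which gives all smallness
    conditions on [eps] at once. *)
Definition exponent_scale :=
  (1 + 8 / c + 28 ^+ 2 / c + 16 * X * (3 / c ^+ 2 + k3))^-1.
Local Notation e0 := exponent_scale.
Let c_ge0 : 0 <= c := ltW c_gt0.
Let t1 : 0 <= 8 / c. Proof. exact: divr_ge0. Qed.
Let t2 : 0 <= 28 ^+ 2 / c. Proof. by apply: divr_ge0 c_ge0; exact: sqr_ge0. Qed.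
Let t30 : 0 <= 3 / c ^+ 2. Proof. by rewrite divr_ge0// exprn_ge0. Qed.
Let t3 : 0 <= 16 * X * (3 / c ^+ 2 + k3).
Proof. by apply: mulr_ge0; [exact: mulr_ge0|exact: addr_ge0]. Qed.

Let den := 1 + 8 / c + 28 ^+ 2 / c + 16 * X * (3 / c ^+ 2 + k3).
Let den_gt0 : 0 < den. Proof. by rewrite /den; move: t1 t2 t3; lra. Qed.

Lemma exponent_scale_gt0 : 0 < e0. Proof. by rewrite invr_gt0. Qed.

Let le_den z : z <= den -> z * e0 <= 1.
Proof. by move=> zd; rewrite ler_pdivrMr// mul1r. Qed.

Let e0_le1 : e0 <= 1.
Proof. by rewrite -[e0]mul1r; apply: le_den; rewrite /den; move: t1 t2 t3; lra. Qed.
Let e0_c : 8 * e0 <= c.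
Proof.
have : 8 / c * e0 <= 1 by apply: le_den; rewrite /den; move: t1 t2 t3; lra.
by rewrite mulrAC ler_pdivrMr// mul1r.
Qed.
(** The requirement involves [8 * 16 * 6 = 768]; the summand [28 ^+ 2 / c] of the denominator covers
    it, as [28 ^+ 2 = 784]. *)
Let e0_B : 8 * (16 * (e0 * (6 / c))) <= 1.
Proof.
have h : 28 ^+ 2 / c * e0 <= 1 by apply: le_den; rewrite /den; move: t1 t2 t3; lra.
apply: le_trans h; rewrite (_ : 8 * (16 * (e0 * (6 / c))) = 8 * (16 * 6) * (e0 / c)); last by ring.
rewrite (_ : 28 ^+ 2 / c * e0 = 28 ^+ 2 * (e0 / c)); last by ring.
apply: ler_wpM2r; last by lra.
by rewrite divr_ge0// invr_ge0 ltW.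
Qed.
Let e0_X : 16 * (e0 * X * (3 / c ^+ 2 + k3)) <= 1.
Proof.
have : 16 * X * (3 / c ^+ 2 + k3) * e0 <= 1.
  by apply: le_den; rewrite /den; move: t1 t2 t3; lra.
rewrite (_ : _ * e0 = 16 * (e0 * X * (3 / c ^+ 2 + k3)))//.
by move: (3 / c ^+ 2 + k3) => z; ring.
Qed.

Let G := k2 ^+ 2 * Cs.
Let G_ge0 : 0 <= G. Proof. by rewrite mulr_ge0// sqr_ge0. Qed.
Definition variance_excess := 2 * Ks + G.
Local Notation Ka := variance_excess.
Let Ka_ge0 : 0 <= Ka. Proof. by rewrite addr_ge0// mulr_ge0. Qed.
(** The sum of all lower bounds required of the linear coefficient, so that each of them holds
    separately. *)
Definition crossover :=
  1 + 2 * Ka + k2 / e0 + (2 * Sg + Ka) / e0 + (2 * Sg + Ka) / k2.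
Local Notation KA := crossover.

Let e0_ge0 : 0 <= e0 := ltW exponent_scale_gt0.
Let S_ge0 : 0 <= 2 * Sg + Ka. Proof. by rewrite addr_ge0// mulr_ge0. Qed.
Let r1 : 0 <= k2 / e0. Proof. by rewrite divr_ge0// ltW. Qed.
Let r2 : 0 <= (2 * Sg + Ka) / e0. Proof. by rewrite divr_ge0. Qed.
Let r3 : 0 <= (2 * Sg + Ka) / k2. Proof. by rewrite divr_ge0// ltW. Qed.

Let KA_terms : [/\ 1 <= KA, 2 * Ka + 1 <= KA, k2 / e0 <= KA,
  (2 * Sg + Ka) / e0 <= KA & (2 * Sg + Ka) / k2 <= KA].
Proof.
have aux (y p q z : R) : 0 <= y -> 0 <= p -> 0 <= q -> 0 <= z ->
    [/\ 1 <= 1 + y + p + q + z, y + 1 <= 1 + y + p + q + z, p <= 1 + y + p + q + z,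
      q <= 1 + y + p + q + z & z <= 1 + y + p + q + z].
  by move=> y0 p0 q0 z0; split; lra.
by apply: aux => //; exact: mulr_ge0.
Qed.

Lemma crossover_ge1 : 1 <= KA. Proof. by case: KA_terms. Qed.

Let KA_gt0 : 0 < KA := lt_le_trans ltr01 crossover_ge1.

Let KA1 : k2 <= e0 * KA.
Proof.
by rewrite [leRHS]mulrC -ler_pdivrMr ?exponent_scale_gt0//; case: KA_terms.
Qed.
Let KA2 : 2 * Sg + Ka <= e0 * KA.
Proof.
by rewrite [leRHS]mulrC -ler_pdivrMr ?exponent_scale_gt0//; case: KA_terms.
Qed.
Let KA3 : 2 * Sg + Ka <= k2 * KA.
Proof. by rewrite [leRHS]mulrC -ler_pdivrMr//; case: KA_terms. Qed.
Let KA4 : 2 * Ka + 1 <= KA. Proof. by case: KA_terms. Qed.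

(** [theta = t / D] is the usual Bernstein tilt. Taking [eps] of order [eta / L] and [B = 6 * L / c]
    makes [eps * B] of order [eta], while [expR (- (c * B / 2)) = expR (- 3 * L)] pays for the
    square of the truncation bound [k2 * Ls]. The condition [theta * (k2 * Ls) <= eps] is what costs
    the product [L * Ls]. In the last clause, [3 * eta / 32] is the sum of [eta / 16] for the
    removed values and [eta / 64] for each of the two end points. *)
Lemma tuning eta L Ls t n sig2 K_A : 0 < eta <= 1 -> 1 <= L -> 1 <= Ls -> 0 < t ->
  0 <= n -> n * expR (- (2 * L)) <= 1 -> 0 <= sig2 -> sig2 <= Sg ->
  Ls ^+ 2 <= Cs * expR L -> KA <= K_A -> K_A * (L * Ls) <= eta * t ->
  let D := (1 + eta) * sig2 * n + K_A / eta * (L * Ls) * t in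
  exists theta a eps B : R,
  [/\ [/\ 0 < theta, theta * (k2 * Ls) <= eps, 0 <= a, a <= eps & 8 * eps <= c],
     0 <= B, a <= theta * (k2 * Ls),
     (forall sigt, sigt <= sig2 + Ks * expR (- (2 * L)) ->
       theta ^+ 2 * sigt * (2^-1 + 4 * eps * B * expR (2 * eps * B)) +
       (3 * a * eps / c ^+ 2 + 4 * (6 / (c / 4) ^+ 3) *
         (a * eps ^+ 2 + (theta * (k2 * Ls)) ^+ 2 * eps * expR (- (c * B / 2))))
       * (2 * K * N) <= a)
   & - (theta * t * (1 - 3 * eta / 32)) + a * n <= - (t ^+ 2 / (2 * D))].
Proof.
move=> eta01 L1 Ls1 t0 n0 nE s0 sS LsC KAK reg D.
have [eta0 eta1] := andP eta01.
have KA'0 : 0 < K_A by apply: lt_le_trans KAK.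
have L0 : 0 < L by apply: lt_le_trans L1.
have Ls0 : 0 < Ls by apply: lt_le_trans Ls1.
set E := expR (- (2 * L)) in nE *.
have E0 : 0 <= E by exact: expR_ge0.
have E1 : E <= 1 by rewrite /E -[leRHS]expR0 ler_expR; lra.
pose q := K_A / eta * (L * Ls).
have q0 : 0 < q by rewrite mulr_gt0 ?divr_gt0// mulr_gt0.
have D0 : 0 < D.
  rewrite /D; apply: ltr_wpDl; last by rewrite mulr_gt0.
  by rewrite mulr_ge0// mulr_ge0//; lra.
have qD : q * t <= D.
  rewrite /D lerDr mulr_ge0// mulr_ge0//; lra.
have [theta thE] : {z | z = t / D} by exists (t / D).
have th0 : 0 < theta by rewrite thE divr_gt0.
have thD : theta * D = t by rewrite thE divfK// gt_eqF.
have thq : theta * q <= 1.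
  by rewrite -(ler_pM2r t0) mul1r -[leRHS]thD -mulrA ler_wpM2l// ltW.
have qE : q = K_A * L * Ls / eta by rewrite /q; field; rewrite gt_eqF.
have th1 : theta * (K_A * (L * Ls)) <= eta.
  move: thq; rewrite qE mulrA ler_pdivrMr// mul1r; by rewrite -mulrA.
pose eps := e0 * eta / L.
have eps0 : 0 <= eps by rewrite divr_ge0 ?(ltW L0)// mulr_ge0// ltW.
(* Half of [theta ^+ 2] times the variance, enlarged by the factor [1 + eta / 2] and by an error of
   order [expR (- (2 * L))]. *)
pose a := theta ^+ 2 / 2 * ((1 + eta / 2) * sig2 + Ka * E).
have brk : (1 + eta / 2) * sig2 + Ka * E <= 2 * Sg + Ka.
  apply: lerD; last by rewrite ler_piMr.
  apply: ler_pM => //; lra.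
have brk0 : 0 <= (1 + eta / 2) * sig2 + Ka * E.
  by rewrite addr_ge0// mulr_ge0//; lra.
have a0 : 0 <= a by rewrite mulr_ge0// divr_ge0// sqr_ge0.
have thm : theta * (k2 * Ls) <= eps.
  rewrite /eps ler_pdivlMr//.
  apply: (@le_trans _ _ (theta * (e0 * K_A * (L * Ls)))).
    rewrite (_ : theta * (k2 * Ls) * L = theta * (k2 * (L * Ls))); last by ring.
    rewrite ler_wpM2l ?(ltW th0)// ler_wpM2r ?mulr_ge0 ?(ltW L0) ?(ltW Ls0)//.
    by rewrite (le_trans KA1)// ler_wpM2l.
  rewrite (_ : theta * (e0 * K_A * (L * Ls)) = e0 * (theta * (K_A * (L * Ls)))); last by ring.
  by rewrite ler_wpM2l.
have thK : theta * K_A <= eta / L.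
  rewrite ler_pdivlMr//; apply: le_trans th1.
  by rewrite -mulrA ler_wpM2l ?(ltW th0)// ler_wpM2l ?(ltW KA'0)// ler_peMr// ltW.
have thK1 : theta * K_A <= 1.
  by apply: (le_trans thK); rewrite ler_pdivrMr// mul1r (le_trans eta1).
have a_th (z : R) : 0 <= z -> 2 * Sg + Ka <= z * KA -> a <= theta * z.
  move=> z0 zK; rewrite /a.
  apply: (@le_trans _ _ (theta ^+ 2 / 2 * (z * K_A))).
    apply: ler_wpM2l; first by rewrite divr_ge0// sqr_ge0.
    by apply: (le_trans brk); apply: (le_trans zK); rewrite ler_wpM2l.
  rewrite (_ : theta ^+ 2 / 2 * (z * K_A) = theta * z * (theta * K_A / 2)); last by field.
  by rewrite ler_piMr ?mulr_ge0 ?(ltW th0)//; move: thK1; move: (theta * K_A) => y; lra.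
have a_eps : a <= eps.
  rewrite /a /eps -[leRHS]mulrA.
  apply: (@le_trans _ _ (theta ^+ 2 / 2 * (e0 * K_A))).
    apply: ler_wpM2l; first by rewrite divr_ge0// sqr_ge0.
    by apply: (le_trans brk); apply: (le_trans KA2); rewrite ler_wpM2l.
  rewrite (_ : theta ^+ 2 / 2 * (e0 * K_A) = e0 * (theta * K_A * (theta / 2))); last by field.
  rewrite ler_wpM2l//; apply: le_trans thK; rewrite ler_piMr//.
    by rewrite mulr_ge0// ltW.
  have : theta <= 1.
    apply: le_trans thK1; rewrite ler_peMr ?(ltW th0)//.
    by apply: le_trans KAK; exact: crossover_ge1.
  lra.
have eps_e0 : eps <= e0 * eta.
  by rewrite /eps ler_pdivrMr// ler_peMr// mulr_ge0// ltW.
have e0eta : e0 * eta <= e0 by rewrite ler_piMr.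
have eps1 : eps <= 1 by apply: (le_trans eps_e0); exact: le_trans e0eta e0_le1.
exists theta, a, eps, (6 / c * L); split=> //.
- split=> //; apply: (@le_trans _ _ (8 * e0)) => //.
  by rewrite ler_pM2l//; exact: le_trans eps_e0 e0eta.
- by rewrite mulr_ge0 ?(ltW L0)// divr_ge0.
- by apply: a_th; rewrite ?mulr_ge0 ?(ltW k2_gt0) ?(ltW Ls0)//; apply: (le_trans KA3);
    rewrite ler_wpM2r ?(ltW KA_gt0)// ler_peMr// ltW.
- move=> sigt st.
  have epsB : eps * (6 / c * L) = e0 * (6 / c) * eta.
    by rewrite /eps; field; rewrite !gt_eqF.
  have epsB1 : 8 * (16 * (eps * (6 / c * L))) <= eta.
    by rewrite epsB !mulrA ler_piMl ?(ltW eta0)// -!mulrA.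
  have epsB0 : 0 <= eps * (6 / c * L).
    by rewrite mulr_ge0// mulr_ge0 ?(ltW L0)// divr_ge0.
  rewrite -(mulrA 4 eps) -(mulrA 2 eps).
  set eB := eps * (6 / c * L) in epsB1 epsB0 *.
  have xB : expR (2 * eB) <= 2.
    by apply: expR_small; move: epsB1 eta1; lra.
  rewrite -/k3 -/X.
  have -> : - (c * (6 / c * L) / 2) = - (2 * L) - L by field; rewrite gt_eqF.
  rewrite expRB -/E.
  set Z := (theta * (k2 * Ls)) ^+ 2.
  have -> : (3 * a * eps / c ^+ 2 + k3 * (a * eps ^+ 2 + Z * eps * (E / expR L))) * X =
     (a * (eps * X * (3 / c ^+ 2 + k3 * eps))) + (Z / expR L) * E * (eps * X * k3).
    by field; rewrite !gt_eqF ?expR_gt0.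
  have epsX : 16 * (eps * X * (3 / c ^+ 2 + k3)) <= eta.
    apply: (@le_trans _ _ (16 * (e0 * eta * X * (3 / c ^+ 2 + k3)))).
      rewrite ler_pM2l// ler_wpM2r ?addr_ge0// ler_wpM2r//.
    rewrite (_ : 16 * (e0 * eta * X * (3 / c ^+ 2 + k3)) = eta * (16 * (e0 * X * (3 / c ^+ 2 + k3)))).
      by rewrite ler_piMr// ltW.
    by move: (3 / c ^+ 2 + k3) => z; ring.
  have eX0 : 0 <= eps * X by rewrite mulr_ge0.
  apply: (@budget eta _ sig2 sigt Ks G E _ a _ _ eta01 _ s0 Ks_ge0 G_ge0 E0 st).
  + exact: sqr_ge0.
  + by rewrite mulr_ge0 ?expR_ge0// mulr_ge0.
  + apply: (@le_trans _ _ (4 * eB * 2)).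
      by rewrite ler_wpM2l// mulr_ge0.
    by move: epsB1; lra.
  + by [].
  + rewrite ler_wpM2l// ler_pdivlMr// mulrC; apply: le_trans epsX.
    rewrite ler_pM2l// ler_wpM2l// lerD2l ler_piMr//.
  + have ZE : Z / expR L <= theta ^+ 2 * G.
      rewrite ler_pdivrMr ?expR_gt0// /Z exprMn -[leRHS]mulrA ler_wpM2l ?sqr_ge0//.
      by rewrite /G exprMn -[leRHS]mulrA ler_wpM2l ?sqr_ge0.
    have u1 : 16 * (eps * X * k3) <= 1.
      apply: le_trans eta1; apply: le_trans epsX.
      by rewrite ler_pM2l// ler_wpM2l// lerDr.
    have -> : theta ^+ 2 * (G * E) / 16 = theta ^+ 2 * G * E * 16^-1 by ring.
    apply: ler_pM.
    * by rewrite mulr_ge0// divr_ge0 ?expR_ge0// sqr_ge0.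
    * by rewrite mulr_ge0.
    * by rewrite ler_wpM2r.
    * by move: u1; lra.
- have -> : t ^+ 2 / (2 * D) = theta * t / 2.
    by rewrite thE; field; rewrite gt_eqF.
  (* After multiplication by [theta ^+ 2 / 2] the saved fraction [3 * eta / 16] becomes
     [3 * eta / 32] of [theta * t], the loss to be compensated; what remains is
     [- theta * t / 2]. *)
  have h : n * ((1 + eta / 2) * sig2 + Ka * E) <= (1 - 3 * eta / 16) * D.
    have h1 : n * (Ka * E) <= Ka by rewrite mulrCA ler_piMr.
    have h2 : Ka <= (1 - 3 * eta / 16) * (q * t).
      have qt : KA <= q * t.
        apply: (le_trans KAK).
        have -> : q * t = K_A * ((L * Ls) * (t / eta)) by rewrite /q; field; rewrite gt_eqF.
        rewrite ler_peMr ?(ltW KA'0)//.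
        have te : K_A * (L * Ls) <= t / eta.
          apply: (le_trans reg); rewrite ler_pdivlMr// mulrAC ler_piMl ?(ltW t0)//.
          by rewrite mulr_ile1// ltW.
        have LL : 1 <= L * Ls by rewrite mulr_ege1.
        rewrite mulr_ege1//; apply: le_trans te; rewrite mulr_ege1//.
        by apply: le_trans KAK; exact: crossover_ge1.
      move: (q * t) qt KA4 => z zK zA.
      have : 0 <= z * (1 - eta) by rewrite mulr_ge0//; move: Ka_ge0; lra.
      move: Ka_ge0; lra.
    have h3 : n * ((1 + eta / 2) * sig2) <= (1 - 3 * eta / 16) * ((1 + eta) * sig2 * n).
      rewrite -subr_ge0 (_ : _ - _ = n * sig2 * eta * (5 / 16 - 3 * eta / 16)); last by field.
      by rewrite !mulr_ge0 ?(ltW eta0)//; lra.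
    rewrite mulrDr /D mulrDr; apply: lerD => //; exact: le_trans h1 h2.
  have th20 : 0 <= theta ^+ 2 / 2 by rewrite divr_ge0// sqr_ge0.
  have := ler_wpM2l th20 h.
  have -> : theta ^+ 2 / 2 * (n * ((1 + eta / 2) * sig2 + Ka * E)) = a * n.
    by rewrite /a; ring.
  have -> : theta ^+ 2 / 2 * ((1 - 3 * eta / 16) * D) = theta * t / 2 * (1 - 3 * eta / 16).
    by rewrite -thD; field.
  move: (a * n) (theta * t) => y z yz.
  by rewrite -lerBrDl; lra.
Qed.

End tuning.

(** * Explicit constants *)

Section constants.
Variables (R : realType) (gam N M s k : R).

(** Chosen for [expR size_rate * gam = (1 + gam) / 2], halfway between [gam] and 1. With [c] this
    rate, [size_const] is then the solution [K] of [expR c * (1 + K * gam) = K]. *)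
Definition size_rate := ln ((1 + gam) / (2 * gam)).
Definition size_const := 2 * expR size_rate / (1 - gam).
(** The factor 2 accounts for recentring and [4 ^ s] for the truncation level [4 * L]. *)
Definition bound_rate := 2 * k * 4 `^ s.
Definition power_const := (2 * s) `^ s ^+ 2.
Definition variance_gap := 6 * centered_rate M s k ^+ 2 * M / (1 - gam).
Definition variance_cap := 2 * centered_rate M s k ^+ 2 * M / (1 - gam).
(** The second summand keeps the total mean of the removed values below [eta * t / 32]. *)
Definition linear_coef :=
  crossover size_rate size_const N variance_cap variance_gap power_const bound_rate
  + 32 * centered_rate M s k.
(** The largest rate at which [ln (2 * K * u)] may grow with [(eta * t) ^ alpha] at the end points,
    given the allowance [eta / 64] for each of them in [tuning]. *)
Definition edge_rate := size_rate / (bound_rate * 2) / 64.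
Definition visit_rate :=
  Num.min (1 / 2) (ln (2 / (1 + gam))) * ((32 * k)^-1 `^ (s + 1)^-1).
Definition extra_rate := Num.min edge_rate visit_rate.
(** Prefactors of the three exceptional events: a large removed part, a high final state, a high
    starting state. *)
Definition extra_const :=
  (1 + N / (1 - gam) + 2 * expR N) + ((1 + N / (1 - gam)) * (2 * size_const) + 2 * size_const).

Hypotheses (gam01 : 0 < gam < 1) (N_gt0 : 0 < N) (M_ge0 : 0 <= M) (k_gt0 : 0 < k).

Let gam0 : 0 < gam. Proof. by case/andP: gam01. Qed.
Let gam1 : 0 < 1 - gam. Proof. by case/andP: gam01 => _; rewrite subr_gt0. Qed.

Lemma size_rate_gt0 : 0 < size_rate.
Proof.
rewrite ln_gt0// ltr_pdivlMr ?mulr_gt0// mul1r mulr_natl mulr2n ltrD2r.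
by move: gam1; rewrite subr_gt0.
Qed.

Lemma size_const_gt0 : 0 < size_const.
Proof. by rewrite divr_gt0// mulr_gt0// expR_gt0. Qed.

Lemma bound_rate_gt0 : 0 < bound_rate.
Proof. by rewrite mulr_gt0 ?powR_gt0// mulr_gt0. Qed.

Lemma centered_rate_ge0 : 0 <= centered_rate M s k.
Proof. by rewrite mulr_ge0 ?addr_ge0// mulr_ge0 ?powR_ge0// ltW. Qed.

Lemma variance_gap_ge0 : 0 <= variance_gap.
Proof. by rewrite divr_ge0 ?(ltW gam1)// mulr_ge0// mulr_ge0// sqr_ge0. Qed.

Lemma variance_cap_ge0 : 0 <= variance_cap.
Proof. by rewrite divr_ge0 ?(ltW gam1)// mulr_ge0// mulr_ge0// sqr_ge0. Qed.

Lemma linear_coef_ge1 : 1 <= linear_coef.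
Proof.
apply: (@le_trans _ _ (crossover size_rate size_const N variance_cap variance_gap
    power_const bound_rate)).
  apply: crossover_ge1; [exact: size_rate_gt0|exact: size_const_gt0|done|
    exact: variance_cap_ge0|exact: variance_gap_ge0|exact: sqr_ge0|exact: bound_rate_gt0].
by rewrite lerDl mulr_ge0// centered_rate_ge0.
Qed.

Lemma edge_rate_gt0 : 0 < edge_rate.
Proof.
by rewrite divr_gt0// divr_gt0 ?size_rate_gt0// mulr_gt0// bound_rate_gt0.
Qed.

Lemma extra_rate_gt0 : 0 < extra_rate.
Proof.
rewrite lt_min edge_rate_gt0/= mulr_gt0//; last by rewrite powR_gt0// invr_gt0 mulr_gt0.
rewrite lt_min divr_gt0//= ln_gt0// ltr_pdivlMr ?addr_gt0// mul1r.
by move: gam1; lra.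
Qed.

End constants.

(** * The upper tail in the regime of large deviations [t] *)

Section one_sided.
Context d dO (T : measurableType d) (Omega : measurableType dO) (R : realType).
Variables (P : R.-pker T ~> T) (nu : probability T R) (C : set T) (delta : R).
Hypotheses (mC : measurable C) (delta_ge0 : 0 <= delta) (delta_le1 : delta <= 1)
  (small : small_set P C nu delta).
Local Notation Q := (residual mC delta_ge0 small).
Variables (u : T -> R) (gam N : R).
Hypotheses (mu : measurable_fun [set: T] u) (u_ge1 : forall x, 1 <= u x)
  (gam01 : 0 < gam < 1)
  (Qu : forall x, (\int[Q x]_y (u y)%:E <= (gam * u x)%:E)%E)
  (N_gt0 : 0 < N) (nu_u : (\int[nu]_x (u x)%:E <= N%:E)%E)
  (Pu : forall x, (\int[P x]_y (u y)%:E <= (gam * u x + N)%:E)%E).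
Variables (pi : probability T R) (M : R).
Hypotheses (piP : stationary P pi)
  (piu2 : (\int[pi]_x (sqr_weight u x)%:E <= M%:E)%E).
Variables (g : T -> R) (s k : R).
Hypotheses (mg : measurable_fun [set: T] g) (s_gt0 : 0 < s) (k_gt0 : 0 < k)
  (g_le : forall x, `|g x| <= k * ln (u x) `^ s).
Variables (x0 : T) (Q0 : probability Omega R) (X : nat -> Omega -> T).
Hypothesis chain : markov_chain P \d_x0 Q0 X.

Let k_ge0 : 0 <= k := ltW k_gt0.
Local Notation hc := (block_sum mC delta_ge0 small (measurable_centered pi mg)).
Let sig2 := limit_variance pi g hc.
Hypothesis sig2_ge0 : 0 <= sig2.

Let c := size_rate gam.
Let K := size_const gam.
Let k0 := centered_rate M s k.
Let k2 := bound_rate s k.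
Let rho := edge_rate gam s k.
Let Ks := variance_gap gam M s k.

Let gam0 : 0 < gam. Proof. by case/andP: gam01. Qed.
Let gam1 : 0 < 1 - gam. Proof. by case/andP: gam01 => _; rewrite subr_gt0. Qed.

Let u_gt0 x : 0 < u x. Proof. exact: lt_le_trans ltr01 (u_ge1 x). Qed.

Let ec : expR c * gam = (1 + gam) / 2.
Proof.
rewrite /c /size_rate lnK ?posrE ?divr_gt0 ?addr_gt0 ?mulr_gt0//.
by field; rewrite gt_eqF.
Qed.

Let c_gt0 : 0 < c := size_rate_gt0 gam01.

Let ec1 : 1 <= expR c. Proof. by rewrite -[leLHS]expR0 ler_expR ltW. Qed.

Let K_ge1 : 1 <= K.
Proof.
rewrite ler_pdivlMr// mul1r; move: ec1 gam0.
by move: (expR c) => z; lra.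
Qed.

Let K_gt0 : 0 < K := size_const_gt0 gam01.

Let cK : expR c * (delta + K * gam) <= K.
Proof.
have -> : expR c * (delta + K * gam) = expR c * delta + K * (expR c * gam) by ring.
rewrite ec -lerBrDr.
have -> : K - K * ((1 + gam) / 2) = expR c.
  by rewrite /K /size_const -/c; field; rewrite gt_eqF.
by rewrite ler_piMr// expR_ge0.
Qed.

Let k2_gt0 : 0 < k2 := bound_rate_gt0 s k_gt0.

Let wpi : weighted u pi.
Proof. exact: (weighted_sqr mu u_ge1 (le_lt_trans piu2 (ltry _))). Qed.

Let M_ge0 : 0 <= M.
Proof.
rewrite -lee_fin; apply: le_trans piu2; apply: integral_ge0 => x _.
by rewrite lee_fin sqr_ge0.
Qed.

Let k0_ge0 : 0 <= k0 := centered_rate_ge0 s M_ge0 k_gt0.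

Let Ks_ge0 : 0 <= Ks := variance_gap_ge0 s k gam01 M_ge0.

Let Sg_ge0 : 0 <= variance_cap gam M s k := variance_cap_ge0 s k gam01 M_ge0.

Let mX n : measurable_fun [set: Omega] (X n).
Proof. by case: chain. Qed.

Section regime.
Variables (n : nat) (eta t : R).
Hypotheses (eta01 : 0 < eta <= 1) (t_gt0 : 0 < t).
Let L := logn_e n : R.
Let Ls := L `^ s.
Let w := (eta * t) `^ (s + 1)^-1.
Hypothesis large : linear_coef gam N M s k * L `^ (s + 1) <= eta * t.

Let eta0 : 0 < eta. Proof. by case/andP: eta01. Qed.
Let et0 : 0 < eta * t. Proof. exact: mulr_gt0. Qed.

Let L_ge1 : 1 <= L.
Proof.
rewrite /L /logn_e -[leLHS]expRK ler_ln ?posrE ?expR_gt0//.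
  by rewrite le_max lexx orbT.
Qed.

Let L_gt0 : 0 < L := lt_le_trans ltr01 L_ge1.

Let n_L : n%:R <= expR L.
Proof.
rewrite /L /logn_e lnK; first by rewrite le_max lexx.
by rewrite posrE lt_max expR_gt0 orbT.
Qed.

Let Ls_ge1 : 1 <= Ls.
Proof. by rewrite -[leLHS](powRr0 L); apply: ler_powR => //; exact: ltW. Qed.

Let LLs : L `^ (s + 1) = L * Ls.
Proof. by rewrite powRD ?(gt_eqF L_gt0) ?implybT// powRr1 ?(ltW L_gt0)// mulrC. Qed.

Let s1 : s + 1 != 0. Proof. by rewrite gt_eqF// addr_gt0. Qed.

Let w_gt0 : 0 < w. Proof. exact: powR_gt0. Qed.

Let wE : w `^ (s + 1) = eta * t.
Proof. by rewrite /w -powRrM mulVf// powRr1// ltW. Qed.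

Let wEs : w * w `^ s = eta * t.
Proof. by rewrite -wE powRD ?(gt_eqF w_gt0) ?implybT// powRr1 ?(ltW w_gt0)// mulrC. Qed.

Let KA_ge1 : 1 <= linear_coef gam N M s k :=
  linear_coef_ge1 s gam01 N_gt0 M_ge0 k_gt0.

Let L_w : L <= w.
Proof.
have s10 : 0 < s + 1 by rewrite addr_gt0.
rewrite -[L](powRr1 (ltW L_gt0)) -(mulfV s1) powRrM.
apply: ge0_ler_powR; rewrite ?nnegrE ?invr_ge0 ?powR_ge0//; try exact: ltW.
by apply: le_trans large; rewrite ler_peMl// powR_ge0.
Qed.

Let Ls_w : Ls * w <= eta * t.
Proof.
rewrite -wEs mulrC ler_wpM2l ?(ltW w_gt0)//.
by apply: ge0_ler_powR; rewrite ?nnegrE//; exact: ltW.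
Qed.

(** At this level the truncation error per step is [expR (- (y / 2)) = expR (- (2 * L))], still at
    most 1 after multiplication by [n]; moreover [2 * L <= y], as [remainder_tail] demands. *)
Let y := 4 * L.
Let y_ge0 : 0 <= y. Proof. by rewrite mulr_ge0// ltW. Qed.
Let gt := truncated u pi g y.
Let mgt := measurable_truncated mu pi mg y.
Let m := k2 * Ls.
Let m_gt0 : 0 < m.
Proof. by rewrite mulr_gt0// (lt_le_trans ltr01). Qed.

Let gt_m x : `|gt x| <= m.
Proof.
apply: (le_trans (truncated_le mu u_ge1 pi mg s_gt0 k_ge0 g_le y_ge0 x)).
by rewrite /y powRM// ?(ltW L_gt0)// /m /k2 /bound_rate mulrA.
Qed.

Let rem (z : T) := ln (u z) `^ s * \1_[set x | y < ln (u x)] z.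
Let Rem w := \sum_(0 <= i < n) rem (X i w).
Let St w := \sum_(0 <= i < n) gt (X i w).

Let mrem : measurable_fun [set: T] rem.
Proof.
apply: measurable_funM.
  apply: (measurableT_comp (measurable_powR s)).
  exact: (measurableT_comp (@measurable_ln R) mu).
apply: measurable_indic; apply: measurable_event.
exact: (measurableT_comp (@measurable_ln R) mu).
Qed.

Let mRem : measurable_fun [set: Omega] Rem.
Proof. by apply: measurable_sum => i; exact: (measurableT_comp mrem (mX i)). Qed.

Let mSt : measurable_fun [set: Omega] St.
Proof. by apply: measurable_sum => i; exact: (measurableT_comp mgt (mX i)). Qed.

Let nexpL : n%:R * expR (- (2 * L)) <= 1.
Proof.
apply: (@le_trans _ _ (expR L * expR (- (2 * L)))); first by rewrite ler_wpM2r ?expR_ge0.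
by rewrite -expRD -[leRHS]expR0 ler_expR; move: L_gt0; lra.
Qed.

Let k0_et : k0 <= eta * t / 32.
Proof.
rewrite ler_pdivlMr//; apply: le_trans large.
rewrite -[leLHS]mulr1; apply: ler_pM => //.
- by rewrite mulr_ge0.
- rewrite mulrC /linear_coef lerDr.
  by rewrite (le_trans ler01)//; apply: crossover_ge1 => //; exact: sqr_ge0.
- by rewrite LLs mulr_ege1.
Qed.

Let sum_le v : additive_functional g X n v - n%:R * \int[pi]_x g x <=
  St v + k * Rem v + eta * t / 32.
Proof.
have -> : additive_functional g X n v - n%:R * \int[pi]_x g x =
    \sum_(0 <= i < n) centered pi g (X i v).
  rewrite /additive_functional /centered sumrB; congr (_ - _).
  by rewrite big_const_nat iter_addr addr0 subn0 mulr_natl.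
apply: (@le_trans _ _ (\sum_(0 <= i < n) (gt (X i v) + k * rem (X i v) +
    k0 * expR (- (y / 2))))).
  apply: ler_sum => i _.
  have H := centered_le_truncated mu u_ge1 piu2 mg s_gt0 k_ge0 g_le y (X i v).
  exact: H.
rewrite big_split/= [X in X + _]big_split/= /Rem mulr_sumr; apply: lerD; first exact: lexx.
rewrite big_const_nat iter_addr addr0 subn0 -[leLHS]mulr_natl mulrCA.
apply: le_trans k0_et; rewrite ler_piMr//.
have -> : y / 2 = 2 * L by rewrite /y; field.
exact: nexpL.
Qed.

(** Solves [k * v ^ (s + 1) = eta * t / 32], the share of [t] granted to the removed values. *)
Let v := w * ((32 * k)^-1 `^ (s + 1)^-1).

Let v_ge0 : 0 <= v. Proof. by rewrite mulr_ge0 ?powR_ge0. Qed.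

Let vE : v `^ (s + 1) = eta * t / (32 * k).
Proof.
have k320 : 0 <= (32 * k)^-1 by rewrite invr_ge0 mulr_ge0.
by rewrite /v powRM ?powR_ge0// wE -powRrM mulVf// powRr1.
Qed.

Let rem_tail : (Q0 [set w | (v `^ (s + 1) < Rem w)%R] <=
  ((1 + N / (1 - gam) + 2 * expR N) * u x0 * expR (- (visit_rate gam s k * w)))%:E)%E.
Proof.
have Ly : 2 * L <= y by rewrite /y ler_wpM2r ?(ltW L_gt0)// ler_nat.
apply: (le_trans (remainder_tail chain mu u_ge1 gam01 (ltW N_gt0) Pu s_gt0
  (ltW L_gt0) Ly n_L v_ge0)).
rewrite lee_fin.
have -> : visit_rate gam s k * w = Num.min (1 / 2) (ln (2 / (1 + gam))) * v.
  by rewrite /visit_rate /v -mulrA; congr (_ * _); rewrite mulrC.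
set c2 := Num.min _ _.
have h1 : expR (- (v / 2)) <= expR (- (c2 * v)).
  rewrite ler_expR lerN2 [leRHS]mulrC -div1r ler_wpM2r//.
  by rewrite /c2 ge_min lexx.
have h2 : expR (- (ln (2 / (1 + gam)) * v)) <= expR (- (c2 * v)).
  by rewrite ler_expR lerN2 ler_wpM2r// /c2 ge_min lexx orbT.
have Nq : 0 <= N / (1 - gam) by rewrite divr_ge0 ?(ltW gam1)// ltW.
have ux := u_ge1 x0.
have e1 : 0 <= expR N by exact: expR_ge0.
apply: (le_trans (lerD (ler_wpM2l _ h1) (ler_wpM2l _ h2))).
- by rewrite addr_ge0// ltW.
- by rewrite mulr_ge0// addr_ge0// ltW.
rewrite -mulrDl ler_wpM2r ?expR_ge0// !mulrDl mul1r; apply: lerD.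
  by rewrite lerD2l ler_peMr.
by rewrite !mul1r mulrDr mulr1 lerD2r ler_peMr.
Qed.

Let end_tail : (Q0 [set z | (rho * w < ln (2 * K * u (X n z)))%R] <=
  ((1 + N / (1 - gam)) * (2 * K) * u x0 * expR (- (rho * w)))%:E)%E.
Proof.
have K2 : 0 < 2 * K by rewrite mulr_gt0.
have -> : [set z | rho * w < ln (2 * K * u (X n z))] =
    [set z | rho * w - ln (2 * K) < ln (u (X n z))].
  have lnE z : ln (2 * K * u (X n z)) = ln (2 * K) + ln (u (X n z)).
    by rewrite lnM ?posrE.
  by apply/seteqP; split=> z /=; rewrite lnE ltrBlDl.
apply: (le_trans (chain_weight_tail chain mu u_ge1 gam01 (ltW N_gt0) Pu n _)).
rewrite lee_fin opprB expRD lnK ?posrE// mulrA ler_wpM2r ?expR_ge0//.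
have Nq : 0 <= N / (1 - gam) by rewrite divr_ge0 ?(ltW gam1)// ltW.
rewrite [leRHS]mulrAC ler_wpM2r ?(ltW K2)// mulrDl mul1r lerD2l.
by rewrite ler_peMr.
Qed.

(** The price of the unfinished blocks: it bounds the exponents of [block_exp_le] and [block_exp_ge]
    by a small part of [theta * t], using [Ls * w <= eta * t]. *)
Let edge (theta a x : R) : 0 <= theta -> 0 <= a -> a <= theta * m ->
  0 <= ln (2 * K * x) -> ln (2 * K * x) <= rho * w ->
  (theta * m + a) / c * ln (2 * K * x) <= theta * (eta * t) / 64.
Proof.
move=> th0 a0 am lx0 lx.
apply: (@le_trans _ _ (2 * (theta * m) / c * (rho * w))).
  apply: ler_pM => //.
    by rewrite divr_ge0 ?(ltW c_gt0)// addr_ge0// mulr_ge0// ltW.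
  by rewrite ler_wpM2r ?invr_ge0 ?(ltW c_gt0)//; move: am; lra.
have -> : 2 * (theta * m) / c * (rho * w) = theta * (Ls * w) / 64.
  by rewrite /rho /edge_rate -/c -/k2 /m; field; rewrite !gt_eqF.
by rewrite ler_wpM2r// ler_wpM2l.
Qed.

Let ln_ge0' x : 0 <= ln (2 * K * u x).
Proof.
apply: ln_ge0; rewrite -mulrA mulr_ege1//; first by rewrite ler1n.
by rewrite mulr_ege1.
Qed.

Let A := eta * t.
Let D := (1 + eta) * sig2 * n%:R + linear_coef gam N M s k / eta * (L * Ls) * t.

Let Ls_sqr : Ls ^+ 2 <= power_const s * expR L.
Proof.
have h := powR_le_expR s_gt0 (ltW L_gt0).
rewrite (_ : expR L = expR (L / 2) ^+ 2); last first.
  by rewrite expr2 -expRD; congr expR; field.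
by rewrite /power_const -exprMn ler_sqr// nnegrE ?mulr_ge0 ?expR_ge0 ?powR_ge0.
Qed.

Let sig2_le : sig2 <= variance_cap gam M s k.
Proof. exact: (limit_variance_le mu u_ge1 gam01 Qu piu2 mg s_gt0 k_ge0 g_le). Qed.

(** If neither the removed part nor the final state is exceptional, a deviation beyond [t] lifts the
    supermartingale above [expR lev]; Markov's inequality at this level gives the Bernstein term. *)
Let main : ln (2 * K * u x0) <= rho * w ->
  (Q0 [set z | (t < additive_functional g X n z - n%:R * \int[pi]_x g x)%R] <=
   ((1 + N / (1 - gam) + 2 * expR N) * u x0 * expR (- (visit_rate gam s k * w)) +
    ((1 + N / (1 - gam)) * (2 * K) * u x0 * expR (- (rho * w)) +
     expR (- (t ^+ 2 / (2 * D)))))%:E)%E.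
Proof.
move=> start.
have cross : crossover c K N (variance_cap gam M s k) Ks (power_const s) k2 <=
    linear_coef gam N M s k by rewrite lerDl mulr_ge0.
have reg : linear_coef gam N M s k * (L * Ls) <= eta * t by rewrite -LLs.
have [theta [a [eps [B [[th0 thm a0 a_eps eps_c] B0 am budget fin]]]]] :=
  tuning c_gt0 K_gt0 N_gt0 Sg_ge0 Ks_ge0 (sqr_ge0 _) k2_gt0 eta01 L_ge1 Ls_ge1 t_gt0
    (ler0n R n) nexpL sig2_ge0 sig2_le Ls_sqr cross reg.
pose U := block_exp mC delta_ge0 small mgt theta a.
have th0' := ltW th0.
have Ule x := block_exp_le mu u_ge1 gam01 Qu mgt m_gt0 gt_m c_gt0 K_ge1 cK th0' thm a0 a_eps eps_c x.
have Uge x := block_exp_ge mu u_ge1 gam01 Qu mgt m_gt0 gt_m c_gt0 K_ge1 cK th0' thm a0 a_eps eps_c x.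
have dU := dominated_block_exp mu u_ge1 gam01 Qu mgt m_gt0 gt_m c_gt0 K_ge1 cK th0' thm a0 a_eps eps_c.
have y2 : y / 2 = 2 * L by rewrite /y; field.
have sv := truncated_variance_le (mC := mC) (delta_ge0 := delta_ge0) (small := small) mu u_ge1 gam01 Qu piu2 mg s_gt0 k_ge0 g_le y.
rewrite y2 in sv.
have super x := block_exp_supermartingale (mg := mgt) mu u_ge1 gam01 Qu m_gt0 gt_m c_gt0 K_ge1 cK th0' thm
  a0 a_eps eps_c B0 piP wpi nu_u (truncated_mean0 mu u_ge1 piu2 mg s_gt0 k_ge0 g_le y) (budget _ sv) x.
have U0 x : 0 <= U x by apply: le_trans (Uge x); exact: expR_ge0.
have mU : measurable_fun [set: T] U by case: dU.
pose f x := theta * gt x - a.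
have mf : measurable_fun [set: T] f by apply: measurable_funB => //; exact: measurable_funM.
have sm := chain_supermartingale chain mf mU U0 super n.
rewrite (integral_dirac_start _ mU) in sm.
pose q := theta * (eta * t) / 64.
pose F z := expR (\sum_(0 <= i < n) f (X i z)) * U (X n z).
have mF : measurable_fun [set: Omega] F.
  apply: measurable_funM.
    apply: (measurableT_comp (@measurable_expR R)); apply: measurable_sum => i.
    exact: (measurableT_comp mf (mX i)).
  exact: (measurableT_comp mU (mX n)).
have F0 z : 0 <= F z by rewrite mulr_ge0// expR_ge0.
(* [t] is lowered by [eta * t / 32] for the removed values and as much for their mean; [q] is what
   the final state may cost. *)
pose lev := theta * (t * (1 - eta / 16)) - a * n%:R - q.
have mark := ge0_markov mF F0 sm (expR_gt0 lev).
have mB1 : measurable [set z | v `^ (s + 1) < Rem z] by exact: measurable_event.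
have mB2 : measurable [set z | rho * w < ln (2 * K * u (X n z))].
  apply: measurable_event; apply: (measurableT_comp (@measurable_ln R)).
  apply: measurable_funM => //; exact: (measurableT_comp mu (mX n)).
have mB3 : measurable [set z | expR lev < F z] by exact: measurable_event.
have mE : measurable [set z | t < additive_functional g X n z - n%:R * \int[pi]_x g x].
  apply: measurable_event; apply: measurable_funB => //.
  by apply: measurable_sum => i; exact: (measurableT_comp mg (mX i)).
have fin' : (Q0 [set z | (expR lev < F z)%R] <= (expR (- (t ^+ 2 / (2 * D))))%:E)%E.
  apply: (le_trans mark); rewrite lee_fin -expRN.
  have Uq : U x0 <= expR q.
    apply: (le_trans (Ule x0)); rewrite ler_expR.
    have := @edge theta 0 (u x0) th0' (lexx _) _ (ln_ge0' x0) start.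
    by rewrite addr0; apply; rewrite mulr_ge0// ltW.
  apply: (le_trans (ler_wpM2r (expR_ge0 _) Uq)); rewrite -expRD ler_expR.
  apply: le_trans fin; rewrite /lev /q.
  have -> : theta * (eta * t) / 64 - (theta * (t * (1 - eta / 16)) - a * n%:R -
    theta * (eta * t) / 64) = - (theta * t * (1 - 3 * eta / 32)) + a * n%:R by field.
  exact: lexx.
apply: (measure_le_add mE mB1 (measurableU _ _ mB2 mB3) _ rem_tail).
  move=> z /= tz; have [|Rz] := ltP (v `^ (s + 1)) (Rem z); first by left.
  right; have [|lz] := ltP (rho * w) (ln (2 * K * u (X n z))); first by left.
  right; rewrite /= /F.
  have Uz : expR (- q) <= U (X n z).
    apply: le_trans (Uge _); rewrite ler_expR lerN2.
    exact: (edge th0' a0 am (ln_ge0' _) lz).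
  have St_gt : t * (1 - eta / 16) < St z.
    have := lt_le_trans tz (sum_le z).
    rewrite vE in Rz.
    have : k * Rem z <= eta * t / 32.
      apply: (le_trans (ler_wpM2l k_ge0 Rz)).
      rewrite (_ : k * (eta * t / (32 * k)) = eta * t / 32)//.
      by field; rewrite gt_eqF.
    by move: (St z) (k * Rem z) => p r; lra.
  have -> : \sum_(0 <= i < n) f (X i z) = theta * St z - a * n%:R.
    rewrite sumrB mulr_sumr; congr (_ - _).
    by rewrite big_const_nat iter_addr addr0 subn0 mulr_natr.
  apply: (lt_le_trans _ (ler_wpM2l (expR_ge0 _) Uz)).
  rewrite -expRD ltr_expR /lev ltrD2r ltrD2r.
  by rewrite ltr_pM2l.
exact: (measure_le_add (measurableU _ _ mB2 mB3) mB2 mB3 (@subset_refl _ _) end_tail fin').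
Qed.

(** [main] asks for a moderate starting state. Otherwise [2 * K * u x0 * expR (- (rho * w))] is
    already at least 1 and the bound is trivial. *)
Lemma one_sided_large : (Q0 [set z |
    (t < additive_functional g X n z - n%:R * \int[pi]_x g x)%R] <=
  (expR (- (t ^+ 2 / (2 * ((1 + eta) * sig2 * n%:R +
      linear_coef gam N M s k / eta * L `^ (s + 1) * t)))) +
   extra_const gam N * u x0 * expR (- (extra_rate gam s k * w)))%:E)%E.
Proof.
rewrite LLs -/D.
have Nq : 0 <= N / (1 - gam) by rewrite divr_ge0 ?(ltW gam1)// ltW.
have ux := ltW (u_gt0 x0).
have ev : expR (- (visit_rate gam s k * w)) <= expR (- (extra_rate gam s k * w)).
  by rewrite ler_expR lerN2 ler_wpM2r ?(ltW w_gt0)// /extra_rate ge_min lexx orbT.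
have ee : expR (- (rho * w)) <= expR (- (extra_rate gam s k * w)).
  by rewrite ler_expR lerN2 ler_wpM2r ?(ltW w_gt0)// /extra_rate ge_min lexx.
have c1 : 0 <= (1 + N / (1 - gam) + 2 * expR N) * u x0.
  by rewrite mulr_ge0// !addr_ge0// mulr_ge0// expR_ge0.
have c2 : 0 <= (1 + N / (1 - gam)) * (2 * K) * u x0.
  by rewrite mulr_ge0// mulr_ge0 ?addr_ge0// mulr_ge0// ltW.
have c3 : 0 <= 2 * K * u x0 by rewrite mulr_ge0// mulr_ge0// ltW.
have e0 : 0 <= expR (- (extra_rate gam s k * w)) by exact: expR_ge0.
have -> : extra_const gam N * u x0 * expR (- (extra_rate gam s k * w)) =
    (1 + N / (1 - gam) + 2 * expR N) * u x0 * expR (- (extra_rate gam s k * w)) +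
    ((1 + N / (1 - gam)) * (2 * K) * u x0 * expR (- (extra_rate gam s k * w)) +
     2 * K * u x0 * expR (- (extra_rate gam s k * w))).
  by rewrite /extra_const -/K; ring.
have b1 := ler_wpM2l c1 ev; have b2 := ler_wpM2l c2 ee; have b3 := ler_wpM2l c3 ee.
have p1 := mulr_ge0 c1 e0; have p2 := mulr_ge0 c2 e0; have p3 := mulr_ge0 c3 e0.
have [start|start] := leP (ln (2 * K * u x0)) (rho * w).
  apply: (le_trans (main start)); rewrite lee_fin.
  move: b1 b2 p3; move: (_ * expR (- (visit_rate gam s k * w))) (_ * expR (- (rho * w))).
  move: (expR (- (t ^+ 2 / _))) (_ * expR _) (_ * expR _) (_ * expR _).
  by move=> a1 a2 a3 a4 a5 a6; lra.
apply: (@le_trans _ _ 1%E).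
  apply: probability_le1; apply: measurable_event; apply: measurable_funB => //.
  by apply: measurable_sum => i; exact: (measurableT_comp mg (mX i)).
rewrite lee_fin.
have b4 : 1 <= 2 * K * u x0 * expR (- (rho * w)).
  rewrite expRN ler_pdivlMr ?expR_gt0// mul1r.
  have p0 : 2 * K * u x0 \is Num.pos by rewrite posrE mulr_gt0// mulr_gt0.
  by rewrite -[leRHS](lnK p0) ler_expR ltW.
have := expR_ge0 (- (t ^+ 2 / (2 * D))).
move: (le_trans b4 b3) p1 p2.
move: (expR (- (t ^+ 2 / _))) (_ * expR _) (_ * expR _) (_ * expR _).
by move=> a1 a2 a3 a4; lra.
Qed.

End regime.
End one_sided.

(** * The two-sided bound for all [t] *)

Section two_sided.
Context d dO (T : measurableType d) (Omega : measurableType dO) (R : realType).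
Variables (P : R.-pker T ~> T) (nu : probability T R) (C : set T) (delta : R).
Hypotheses (mC : measurable C) (delta_ge0 : 0 <= delta) (delta_le1 : delta <= 1)
  (small : small_set P C nu delta).
Local Notation Q := (residual mC delta_ge0 small).
Variables (u : T -> R) (gam N : R).
Hypotheses (mu : measurable_fun [set: T] u) (u_ge1 : forall x, 1 <= u x)
  (gam01 : 0 < gam < 1)
  (Qu : forall x, (\int[Q x]_y (u y)%:E <= (gam * u x)%:E)%E)
  (N_gt0 : 0 < N) (nu_u : (\int[nu]_x (u x)%:E <= N%:E)%E)
  (Pu : forall x, (\int[P x]_y (u y)%:E <= (gam * u x + N)%:E)%E).
Variables (pi : probability T R) (M : R).
Hypotheses (piP : stationary P pi)
  (piu2 : (\int[pi]_x (sqr_weight u x)%:E <= M%:E)%E).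
Variables (g : T -> R) (s k : R).
Hypotheses (mg : measurable_fun [set: T] g) (s_gt0 : 0 < s) (k_gt0 : 0 < k)
  (g_le : forall x, `|g x| <= k * ln (u x) `^ s).
Local Notation hc mf := (block_sum mC delta_ge0 small (measurable_centered pi mf)).
Let sig2 := limit_variance pi g (hc mg).
Hypothesis sig2_ge0 : 0 <= sig2.

Let g' x := - g x.
Let mg' : measurable_fun [set: T] g'. Proof. exact: measurableT_comp. Qed.
Let g'_le x : `|g' x| <= k * ln (u x) `^ s. Proof. by rewrite normrN. Qed.
Let k_ge0 := ltW k_gt0.

Let wpi : weighted u pi.
Proof. exact: (weighted_sqr mu u_ge1 (le_lt_trans piu2 (ltry _))). Qed.

Let M_ge0 : 0 <= M.
Proof.
rewrite -lee_fin; apply: le_trans piu2; apply: integral_ge0 => x _.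
by rewrite lee_fin sqr_ge0.
Qed.

Let k0_ge0 : 0 <= centered_rate M s k.
Proof. by rewrite mulr_ge0 ?addr_ge0// mulr_ge0 ?powR_ge0. Qed.

Let dg : dominated u g.
Proof.
split=> //; exists (linear_rate s k) => x.
apply: (le_trans (linear_growth u_ge1 s_gt0 k_ge0 g_le x)).
rewrite ler_wpM2l ?mulr_ge0 ?powR_ge0//.
have ux : 0 < u x by exact: lt_le_trans ltr01 (u_ge1 x).
rewrite -[leRHS]lnK ?posrE// ler_expR.
by have := ln_ge0 (u_ge1 x); move: (ln (u x)) => z z0; lra.
Qed.

Let pi_opp : \int[pi]_x g' x = - \int[pi]_x g x.
Proof. exact: (dominated_RintegralN mu u_ge1 wpi dg). Qed.

Let centered_opp x : centered pi g' x = - centered pi g x.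
Proof. by rewrite /centered pi_opp opprB opprK addrC. Qed.

(** The lower tail is the upper tail of [- g]. Its block sum is the opposite one by uniqueness of
    residual fixed points, so the variance is the same. *)
Let limit_variance_opp : limit_variance pi g' (hc mg') = sig2.
Proof.
have cle := centered_le mu u_ge1 piu2 mg s_gt0 k_ge0 g_le.
have cle' := centered_le mu u_ge1 piu2 mg' s_gt0 k_ge0 g'_le.
have dh := dominated_block_sum mu u_ge1 gam01 Qu (measurable_centered pi mg) k0_ge0 cle.
have dh' := dominated_block_sum mu u_ge1 gam01 Qu (measurable_centered pi mg') k0_ge0 cle'.
have hopp x : hc mg' x = - hc mg x.
  pose D z := hc mg' z + hc mg z.
  have wQ z : weighted u (Q z) by exact: le_lt_trans (Qu z) (ltry _).
  have DQ z : D z = \int[Q z]_y D y.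
    rewrite (dominated_RintegralD mu u_ge1 (wQ z) dh' dh).
    have h1 := block_sumE mu u_ge1 gam01 Qu (measurable_centered pi mg) k0_ge0 cle z.
    have h2 := block_sumE mu u_ge1 gam01 Qu (measurable_centered pi mg') k0_ge0 cle' z.
    apply: (etrans (f_equal2 +%R h2 h1)).
    have aux (a i j : R) : - a + j + (a + i) = j + i by ring.
    rewrite centered_opp; exact: aux.
  have := Q_fixpoint_eq0 mu u_ge1 gam01 Qu (dominatedD dh' dh) DQ x.
  by move=> /eqP; rewrite addr_eq0 => /eqP.
rewrite /sig2 /limit_variance; apply: eq_Rintegral => x _ /=.
have -> : g' x - \int[pi]_y g' y = - (g x - \int[pi]_y g y) by exact: centered_opp.
rewrite hopp; have aux (a b : R) : 2 * - a * - b - (- a) ^+ 2 = 2 * a * b - a ^+ 2 by ring.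
exact: aux.
Qed.

Variables (x0 : T) (Q0 : probability Omega R) (X : nat -> Omega -> T).
Hypothesis chain : markov_chain P \d_x0 Q0 X.
Variables (n : nat) (eta t : R).
Hypotheses (eta01 : 0 < eta <= 1) (t_gt0 : 0 < t).
Let L := logn_e n : R.
Let w := (eta * t) `^ (s + 1)^-1.
Let KA := linear_coef gam N M s k.
Let bern := expR (- (t ^+ 2 / (2 * ((1 + eta) * sig2 * n%:R +
      KA / eta * L `^ (s + 1) * t)))).
Let S z := additive_functional g X n z - n%:R * \int[pi]_x g x.

Let mX i : measurable_fun [set: Omega] (X i).
Proof. by case: chain. Qed.

Let mS : measurable_fun [set: Omega] S.
Proof.
apply: measurable_funB => //.
by apply: measurable_sum => i; exact: (measurableT_comp mg (mX i)).
Qed.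

Let mabs : measurable [set z | t < `|S z|].
Proof. by apply: measurable_event; exact: measurableT_comp. Qed.

Let two_sided_large : KA * L `^ (s + 1) <= eta * t ->
  (Q0 [set z | (t < `|S z|)%R] <=
    (2 * bern + 2 * (extra_const gam N * u x0 * expR (- (extra_rate gam s k * w))))%:E)%E.
Proof.
move=> reg.
have b1 := one_sided_large delta_le1 mu u_ge1 gam01 Qu N_gt0 nu_u Pu piP piu2 s_gt0 k_gt0
  g_le chain sig2_ge0 eta01 t_gt0 reg.
have s0' : 0 <= limit_variance pi g' (hc mg') by rewrite limit_variance_opp.
have b2 := one_sided_large delta_le1 mu u_ge1 gam01 Qu N_gt0 nu_u Pu piP piu2 s_gt0 k_gt0
  g'_le chain s0' eta01 t_gt0 reg.
rewrite limit_variance_opp in b2.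
have -> : 2 * bern + 2 * (extra_const gam N * u x0 * expR (- (extra_rate gam s k * w))) =
  (bern + extra_const gam N * u x0 * expR (- (extra_rate gam s k * w))) +
  (bern + extra_const gam N * u x0 * expR (- (extra_rate gam s k * w))).
  by rewrite !mulr_natl !mulr2n addrACA.
apply: (measure_le_add mabs _ _ _ b1 b2).
- exact: measurable_event.
- apply: measurable_event; apply: measurable_funB => //.
  by apply: measurable_sum => i; exact: (measurableT_comp mg' (mX i)).
- move=> z /=; rewrite lter_normr => /orP[tS|tS]; [by left|right].
  rewrite /= pi_opp mulrN opprK (_ : additive_functional g' X n z = - additive_functional g X n z).
    by move: tS; rewrite /S opprB addrC.
  by rewrite /additive_functional sumrN.
Qed.

(** The prefactor, which grows with [u x0], is traded for a smaller rate inside the exponential,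
    depending on the starting point only logarithmically. *)
Lemma two_sided_bound : (Q0 [set z | (t < `|S z|)%R] <=
  (2 * expR (- (w * (extra_rate gam s k / (4 * (ln (Num.max 1 (extra_const gam N * u x0)) + 1)))))
   + 2 * bern)%:E)%E.
Proof.
set r := extra_rate gam s k; set y := ln _.
have y0 : 0 <= y by apply: ln_ge0; rewrite le_max lexx.
have bern0 : 0 <= bern by exact: expR_ge0.
have w0 : 0 <= w by exact: powR_ge0.
have p1 : (Q0 [set z | (t < `|S z|)%R] <= 1)%E by exact: probability_le1.
(* When [eta * t] is below the threshold, the linear term in the denominator keeps the Bernstein
   exponent below 1/2, hence [2 * bern >= 1]. *)
have [reg|reg] := leP (KA * L `^ (s + 1)) (eta * t); last first.
  have [eta0 eta1] := andP eta01.
  apply: (le_trans p1); rewrite lee_fin ler_wpDl// ?mulr_ge0 ?expR_ge0//.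
  set KL := KA * L `^ (s + 1) in reg.
  have KL0 : 0 < KL by apply: lt_trans reg; rewrite mulr_gt0.
  rewrite /bern (_ : KA / eta * L `^ (s + 1) * t = KL * t / eta); last by rewrite /KL; ring.
  have h : t ^+ 2 / (2 * ((1 + eta) * sig2 * n%:R + KL * t / eta)) <= 1 / 2.
    have D1 : 0 < KL * t / eta by rewrite divr_gt0// mulr_gt0.
    have D2 : 0 <= (1 + eta) * sig2 * n%:R by rewrite !mulr_ge0//; move: eta0; lra.
    rewrite ler_pdivrMr; last by rewrite mulr_gt0// ltr_wpDl.
    have : t ^+ 2 <= KL * t / eta.
      rewrite ler_pdivlMr// expr2 -mulrA [leRHS]mulrC ler_pM2l//.
      by rewrite mulrC ltW.
    by move: D2; move: (KL * t / eta) ((1 + eta) * sig2 * n%:R) (t ^+ 2) => a b c; lra.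
  have := expR_ge1Dx (- (t ^+ 2 / (2 * ((1 + eta) * sig2 * n%:R + KL * t / eta)))).
  by move: h; move: (t ^+ 2 / _) => z z1; move: (expR (- z)) => e; lra.
have l1 : 0 < 4 * (y + 1) by rewrite mulr_gt0// ltr_wpDl.
have e0 : 0 <= expR (- (w * (r / (4 * (y + 1))))) by exact: expR_ge0.
(* If [r * w < 2 * y], the first exponent is at most 1/2 and the bound exceeds 1. Otherwise half of
   [r * w] absorbs the prefactor, which is at most [expR y]. *)
have [rw|rw] := leP (2 * y) (r * w); last first.
  apply: (le_trans p1); rewrite lee_fin ler_wpDr// ?mulr_ge0//.
  have := expR_ge1Dx (- (w * (r / (4 * (y + 1))))).
  have : w * (r / (4 * (y + 1))) <= 1 / 2.
    rewrite mulrA ler_pdivrMr//; move: rw; rewrite mulrC; move: (r * w) => z; lra.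
  by move: (w * _) => z z1; move: (expR (- z)) => e; lra.
apply: (le_trans (two_sided_large reg)); rewrite lee_fin addrC lerD2r.
rewrite ler_pM2l//.
apply: (@le_trans _ _ (expR y * expR (- (r * w)))).
  rewrite ler_wpM2r ?expR_ge0// /y lnK ?le_max ?lexx ?orbT//.
  by rewrite posrE lt_max ltr01.
rewrite -expRD ler_expR.
have rw0 : 0 <= r * w by apply: le_trans rw; rewrite mulr_ge0.
have : w * (r / (4 * (y + 1))) <= r * w / 2.
  rewrite mulrA [w * r]mulrC ler_wpM2l// lef_pV2 ?posrE//.
  by move: y0; lra.
by move: rw; move: (r * w) (w * _) => p q; lra.
Qed.

End two_sided.

(** * Poisson equation for the full kernel *)

Section poisson_equation.
Context d (T : measurableType d) (R : realType).
Variables (P : R.-pker T ~> T) (nu : probability T R) (C : set T) (delta : R).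
Hypotheses (mC : measurable C) (delta_ge0 : 0 <= delta)
  (small : small_set P C nu delta).
Local Notation Q := (residual mC delta_ge0 small).
Variables (u : T -> R) (gam c : R).
Hypotheses (mu : measurable_fun [set: T] u) (u_ge1 : forall x, 1 <= u x)
  (gam01 : 0 < gam < 1)
  (Qu : forall x, (\int[Q x]_y (u y)%:E <= (gam * u x)%:E)%E)
  (wnu : weighted u nu)
  (Pu : forall x, (\int[P x]_y (u y)%:E <= (c * u x)%:E)%E).
Variables (pi : probability T R).
Hypotheses (piP : stationary P pi) (wpi : weighted u pi).

Let du := dominated_self mu u_ge1.
Let wQ x : weighted u (Q x).
Proof. exact: le_lt_trans (Qu x) (ltry _). Qed.

Let balance f : dominated u f -> \int[pi]_x f x =
  \int[pi]_x \int[Q x]_y f y + regeneration_rate C delta pi * \int[nu]_x f x.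
Proof.
move=> df; rewrite -(stationary_Rintegral piP mu u_ge1 wpi Pu df).
under eq_Rintegral do rewrite (P_splitting mu u_ge1 Qu _ wnu df) mulrC.
have dC : dominated u (fun x => delta * \1_C x).
  apply: dominatedZ; split; first exact: measurable_indic.
  exists 1 => x; rewrite mul1r (le_trans _ (u_ge1 x))// indicE.
  by case: (_ \in _); rewrite ?normr1 ?normr0.
rewrite (dominated_RintegralD mu u_ge1 wpi (dominatedQ mu u_ge1 Qu df) (dominatedZ _ dC)).
by rewrite (dominated_RintegralZ mu u_ge1 _ wpi dC) [X in _ + X]mulrC.
Qed.

Let pi_u : 1 <= \int[pi]_x u x.
Proof.
rewrite -[leLHS](probability_Rintegral_cst pi).
by apply: (le_dominated_Rintegral mu u_ge1 wpi) => //; exact: dominated_cst.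
Qed.

(** If [pi] never regenerated, it would satisfy [pi u <= gam * pi u], which contradicts
    [pi u >= 1]. *)
Let rate_neq0 : regeneration_rate C delta pi != 0.
Proof.
apply/eqP => r0; have := balance du; rewrite r0 mul0r addr0 => e.
have h : \int[pi]_x \int[Q x]_y u y <= \int[pi]_x (gam * u x).
  apply: (le_dominated_Rintegral mu u_ge1 wpi).
  - exact: (dominatedQ mu u_ge1 Qu du).
  - exact: dominatedZ.
  - by move=> x; rewrite -lee_fin -(dominated_EFin mu u_ge1 (wQ x) du).
rewrite (dominated_RintegralZ mu u_ge1 _ wpi du) -e in h.
have [gam0 gam1] := andP gam01; move: pi_u h; move: (\int[pi]_x u x) => I I1 I2.
have : 0 < (1 - gam) * I by rewrite mulr_gt0 ?subr_gt0// (lt_le_trans ltr01).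
lra.
Qed.

Variables (g : T -> R) (kap : R).
Hypotheses (mg : measurable_fun [set: T] g) (kap_ge0 : 0 <= kap)
  (g_le : forall x, `|g x| <= kap * u x) (pig : \int[pi]_x g x = 0).
Local Notation h := (block_sum mC delta_ge0 small mg).
Let dh := dominated_block_sum mu u_ge1 gam01 Qu mg kap_ge0 g_le.
Let dg : dominated u g. Proof. by split=> //; exists kap. Qed.

(** [h] solves the equation of the residual kernel; centring gives [nu h = 0], so the regeneration
    term that [P] adds vanishes. *)
Lemma block_sum_poisson_equation x : h x = g x + transition P h x.
Proof.
have hE z := block_sumE mu u_ge1 gam01 Qu mg kap_ge0 g_le z.
have nuh : \int[nu]_x h x = 0.
  have := balance dh.
  have -> : \int[pi]_x h x = \int[pi]_x \int[Q x]_y h y.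
    transitivity (\int[pi]_x (g x + \int[Q x]_y h y)).
      by apply: eq_Rintegral => z _; exact: hE.
    rewrite (dominated_RintegralD mu u_ge1 wpi dg (dominatedQ mu u_ge1 Qu dh)).
    by rewrite pig add0r.
  move=> /eqP; rewrite -subr_eq0 opprD addrA subrr add0r oppr_eq0 mulf_eq0.
  by rewrite (negPf rate_neq0)/= => /eqP.
apply: (etrans (hE x)); rewrite /transition.
by rewrite (P_splitting mu u_ge1 Qu x wnu dh) nuh mulr0 addr0.
Qed.

End poisson_equation.

(** * Nonnegativity of the asymptotic variance *)

Section asymptotic_variance_nonneg.
Context d dO (T : measurableType d) (Omega : measurableType dO) (R : realType).

Lemma asymptotic_variance_ge0 (Q : probability Omega R) (g : T -> R)
  (X : nat -> Omega -> T) (sigma2 : R) : asymptotic_variance Q g X sigma2 -> 0 <= sigma2.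
Proof.
move=> [+ _] => cv; rewrite -lee_fin.
apply: (cvge_ge _ cv); near=> n.
by rewrite mule_ge0 ?variance_ge0// lee_fin.
Unshelve. all: by end_near.
Qed.

End asymptotic_variance_nonneg.

(** * From the drift of [V] to a pure contraction of a small power *)

(** Jensen's inequality for a concave power on a measure of total mass [mass], through the tangent
    at the mean value [I / mass]. *)
Lemma powR_moment d (T : measurableType d) (R : realType)
    (m : {measure set T -> \bar R}) (V : T -> R) (mass I r : R) :
  measurable_fun [set: T] V -> (forall x, 1 <= V x) -> m [set: T] = mass%:E ->
  0 < mass -> 0 < I -> 0 <= r <= 1 -> (\int[m]_x (V x)%:E <= I%:E)%E ->
  (\int[m]_x (V x `^ r)%:E <= (mass * (I / mass) `^ r)%:E)%E.
Proof.
move=> mV V1 mm mass0 I0 r01 VI; have [r0 r1] := andP r01.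
pose a := I / mass.
have a0 : 0 < a by rewrite divr_gt0.
have V0 x : 0 < V x by exact: lt_le_trans ltr01 (V1 x).
have tangent x : V x `^ r <= a `^ r * (1 - r) + (a `^ r * (r / a)) * V x.
  have -> : V x `^ r = a `^ r * expR (r * ln (V x / a)).
    rewrite /powR !gt_eqF// -expRD -mulrDr; congr (expR (r * _)).
    by rewrite lnM ?posrE ?invr_gt0// lnV ?posrE//; ring.
  rewrite (_ : _ + _ = a `^ r * (1 - r + r * (V x / a))); last by ring.
  rewrite ler_wpM2l ?powR_ge0//.
  apply: (le_trans (expRM_le_convex _ r01)).
  by rewrite lnK ?posrE ?divr_gt0.
have c1 : 0 <= a `^ r * (1 - r) by rewrite mulr_ge0 ?powR_ge0 ?subr_ge0.
have c2 : 0 <= a `^ r * (r / a) by apply: mulr_ge0 (powR_ge0 _ _) _; exact: divr_ge0 r0 (ltW a0).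
apply: (@le_trans _ _ (\int[m]_x ((a `^ r * (1 - r))%:E + (a `^ r * (r / a))%:E * (V x)%:E))%E).
  apply: ge0_le_integral => //.
  - by move=> x _; rewrite lee_fin powR_ge0.
  - by apply/measurable_EFinP; exact: (measurableT_comp (measurable_powR r) mV).
  - by apply: emeasurable_funD => //; apply: emeasurable_funM => //; exact/measurable_EFinP.
  - by move=> x _; rewrite -EFinM -EFinD lee_fin.
have mEV : measurable_fun [set: T] (fun x => (V x)%:E) by exact/measurable_EFinP.
rewrite (@ge0_integralD _ _ _ m _ measurableT (cst (a `^ r * (1 - r))%:E)
  (fun x => (a `^ r * (r / a))%:E * (V x)%:E)%E)//; last 2 first.
- by move=> x _; rewrite -EFinM lee_fin mulr_ge0// ltW.
- by apply: emeasurable_funM.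
rewrite (@integral_cst _ _ _ m _ measurableT (a `^ r * (1 - r))%:E) mm.
have VE : (\int[m]_x ((a `^ r * (r / a))%:E * (V x)%:E) =
    (a `^ r * (r / a))%:E * \int[m]_x (V x)%:E)%E.
  by apply: ge0_integralZl_EFin => // x _; rewrite lee_fin ltW.
rewrite VE; apply: (@le_trans _ _ ((a `^ r * (1 - r) * mass)%:E + (a `^ r * (r / a))%:E * I%:E)%E).
  by rewrite EFinM leeD2l// lee_wpmul2l// lee_fin.
rewrite -EFinM -EFinD lee_fin -/a.
rewrite (_ : _ + _ = mass * a `^ r)//.
have -> : I = a * mass by rewrite /a divfK// gt_eqF.
by field; rewrite gt_eqF.
Qed.

Section drift_constants.
Variables (R : realType) (delta lambda b : R).
Hypotheses (delta_gt0 : 0 < delta) (lambda01 : 0 < lambda < 1) (b_ge0 : 0 <= b).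

(** A smaller [delta] still minorizes; the cap 1/2 leaves the residual kernel a positive mass on the
    small set. *)
Definition split_mass : R := Num.min delta (1 / 2).
(** Above this level half of [lambda * V] covers [b], so only the part of [C] below it has to
    regenerate. *)
Definition sublevel := 2 * b / lambda + 1.
Definition one_step_cap := sublevel + b.
(** The quotient of logarithms is the largest exponent at which the power of
    [one_step_cap / (1 - split_mass)] stays below [1 + split_mass / 2]. Halving it makes the
    contraction available for [u ^+ 2] as well as for [u]. *)
Definition weight_power :=
  Num.min 1 (ln (1 + split_mass / 2) / ln (one_step_cap / (1 - split_mass))) / 2.
Definition weight_rate := Num.max (1 - split_mass / 2) ((1 - lambda / 2) `^ weight_power).
Definition weight_cap := one_step_cap / split_mass.
Definition weight_moment := weight_cap / (1 - weight_rate).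

Lemma split_mass_gt0 : 0 < split_mass.
Proof. by rewrite lt_min delta_gt0 divr_gt0. Qed.

Lemma split_mass_le : split_mass <= 1 / 2.
Proof. by rewrite ge_min lexx orbT. Qed.

Lemma sublevel_ge1 : 1 <= sublevel.
Proof.
by case/andP: lambda01 => l0 _; rewrite lerDr divr_ge0 ?(ltW l0)// mulr_ge0.
Qed.

Lemma one_step_cap_ge1 : 1 <= one_step_cap.
Proof. by rewrite (le_trans sublevel_ge1)// lerDl. Qed.

Let m1 : 0 < 1 - split_mass.
Proof. by have := split_mass_le; lra. Qed.

Let cap_gt0 : 0 < one_step_cap := lt_le_trans ltr01 one_step_cap_ge1.

Let ratio_gt1 : 1 < one_step_cap / (1 - split_mass).
Proof.
rewrite ltr_pdivlMr// mul1r; have := one_step_cap_ge1; have := split_mass_gt0.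
lra.
Qed.

Let ln_half_gt0 : 0 < ln (1 + split_mass / 2).
Proof. by rewrite ln_gt0// ltrDl divr_gt0// split_mass_gt0. Qed.

Lemma weight_power_gt0 : 0 < weight_power.
Proof. by rewrite divr_gt0// lt_min ltr01/= divr_gt0// ln_gt0. Qed.

Lemma weight_power_le : weight_power * 2 <= 1.
Proof. by rewrite divfK ?gt_eqF// ge_min lexx. Qed.

Lemma powR_ratio_le r : 0 <= r -> r <= weight_power * 2 ->
  (one_step_cap / (1 - split_mass)) `^ r <= 1 + split_mass / 2.
Proof.
move=> r0 rp; have ln0 := ln_gt0 ratio_gt1.
have c0 := lt_trans ltr01 ratio_gt1.
rewrite /powR gt_eqF// -[leRHS]lnK; last first.
  by rewrite posrE addr_gt0// divr_gt0// split_mass_gt0.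
rewrite ler_expR -ler_pdivlMr//; apply: (le_trans rp).
by rewrite divfK ?gt_eqF// ge_min lexx orbT.
Qed.

Lemma weight_rate_gt0 : 0 < weight_rate.
Proof. by rewrite lt_max; apply/orP; left; have := split_mass_le; lra. Qed.

Lemma weight_rate_lt1 : weight_rate < 1.
Proof.
have [l0 l1] := andP lambda01.
rewrite gt_max; apply/andP; split; first by have := split_mass_gt0; lra.
have l2 : 0 < 1 - lambda / 2 by lra.
rewrite /powR gt_eqF// -[ltRHS]expR0 ltr_expR pmulr_rlt0 ?weight_power_gt0//.
by rewrite ln_lt0// l2/=; lra.
Qed.

Lemma weight_cap_ge1 : 1 <= weight_cap.
Proof.
rewrite ler_pdivlMr ?split_mass_gt0// mul1r.
by have := one_step_cap_ge1; have := split_mass_le; lra.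
Qed.

End drift_constants.

Section drift_reduction.
Context d (T : measurableType d) (R : realType).
Variables (V : T -> R) (delta lambda b : R).
Hypotheses (mV : measurable_fun [set: T] V) (V_ge1 : forall x, 1 <= V x)
  (delta_gt0 : 0 < delta) (lambda01 : 0 < lambda < 1) (b_ge0 : 0 <= b).
Variables (P : R.-pker T ~> T) (pi nu : probability T R) (C : set T).
Hypotheses (piP : stationary P pi) (mC : measurable C)
  (small : small_set P C nu delta) (drift : geometric_drift P V C lambda b).

Local Notation eps := (split_mass delta).
Local Notation R0 := (sublevel lambda b).
Local Notation B0 := (one_step_cap lambda b).
Local Notation q := (weight_power delta lambda b).
Local Notation gam := (weight_rate delta lambda b).
Local Notation N := (weight_cap delta lambda b).

Let e0 : 0 < eps := split_mass_gt0 delta_gt0.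
Let e2 : eps <= 1 / 2 := split_mass_le delta.
Let q0 : 0 < q := weight_power_gt0 delta_gt0 lambda01 b_ge0.
Let q1 : q * 2 <= 1 := weight_power_le delta lambda b.
Let V_gt0 x : 0 < V x. Proof. exact: lt_le_trans ltr01 (V_ge1 x). Qed.
Let V_ge0 x : 0 <= V x. Proof. exact: ltW. Qed.
Let B0_gt0 : 0 < B0 := lt_le_trans ltr01 (one_step_cap_ge1 lambda01 b_ge0).
Let l0 : 0 < lambda. Proof. by case/andP: lambda01. Qed.
Let l1 : lambda < 1. Proof. by case/andP: lambda01. Qed.

(** On this part of [C] one transition brings [V] to a mean of at most [one_step_cap], a bound in
    [lambda] and [b] alone; the constants can therefore be fixed before [C]. *)
Definition sublevel_set : set T := C `&` [set x | V x <= R0].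
Local Notation D := sublevel_set.

Lemma measurable_sublevel_set : measurable D.
Proof.
apply: measurableI => //; rewrite -[X in measurable X]setTI.
have -> : [set x | V x <= R0] = V @^-1` `]-oo, R0].
  by apply/seteqP; split=> x /=; rewrite in_itv.
exact: mV.
Qed.

Let mEV : measurable_fun [set: T] (EFin \o V).
Proof. exact/measurable_EFinP. Qed.
Let EV0 x : (0 <= (EFin \o V) x)%E. Proof. by rewrite lee_fin. Qed.

Let PV x : (\int[P x]_y (V y)%:E <= ((1 - lambda) * V x + b * \1_C x)%:E)%E.
Proof.
have := drift x; rewrite leeBlDr// -EFinD => h; apply: (le_trans h).
by rewrite lee_fin; lra.
Qed.

Let indC x : (\1_C x : R) <= 1.
Proof. by rewrite indicE; case: (_ \in _). Qed.

Let PV_off x : ~ D x -> (\int[P x]_y (V y)%:E <= ((1 - lambda / 2) * V x)%:E)%E.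
Proof.
move=> nDx; apply: (le_trans (PV x)); rewrite lee_fin.
have lV : 0 <= lambda * V x by rewrite mulr_ge0// ltW.
have [Cx|nCx] := pselect (C x); last first.
  by rewrite indicE memNset// mulr0; lra.
have : R0 < V x by rewrite ltNge; apply/negP => VR; apply: nDx.
rewrite /sublevel => VR.
have : b <= lambda / 2 * V x.
  rewrite mulrAC ler_pdivlMr// mulrC [leRHS]mulrC -ler_pdivrMr//.
  by apply: ltW; apply: le_lt_trans VR; rewrite lerDl.
have := ler_wpM2l b_ge0 (indC x); rewrite mulr1.
by move: (b * _) (lambda * V x) => z y; lra.
Qed.

Let small' : small_set P D nu eps.
Proof.
move=> x [Cx _] B mB; apply: le_trans (small Cx mB).
by rewrite lee_wpmul2r// lee_fin ge_min lexx.
Qed.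

Definition sublevel_small := small'.
Local Notation mD := measurable_sublevel_set.
Local Notation Q := (residual mD (ltW e0) sublevel_small).

Let splitting f x : measurable_fun [set: T] f -> (forall y, (0 <= f y)%E) ->
  (\int[P x]_y f y = \int[Q x]_y f y + (eps * \1_D x)%:E * \int[nu]_y f y)%E.
Proof. by move=> mf f0; rewrite (ge0_integral_splitting mD (ltW e0) small' x mf f0). Qed.

Let Q_le_P f x : measurable_fun [set: T] f -> (forall y, (0 <= f y)%E) ->
  (\int[Q x]_y f y <= \int[P x]_y f y)%E.
Proof.
move=> mf f0; rewrite (splitting x mf f0) leeDl// mule_ge0//.
  by rewrite lee_fin mulr_ge0// ltW.
by apply: integral_ge0 => y _; exact: f0.
Qed.

Let PV_on x : D x -> (\int[P x]_y (V y)%:E <= B0%:E)%E.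
Proof.
move=> [Cx /= VR]; apply: (le_trans (PV x)); rewrite lee_fin.
have := ler_wpM2l b_ge0 (indC x); rewrite mulr1 /one_step_cap.
have : 0 <= lambda * V x by rewrite mulr_ge0// ltW.
by move: VR; move: (b * _) => z VR lV; rewrite mulrBl; lra.
Qed.

(* If [D] were empty, the drift inequality would force [pi V] to be null. *)
Let D_neq0 : D !=set0.
Proof.
apply/set0P; apply/negP => /eqP D0.
have PVall x : (\int[P x]_y (V y)%:E <= ((1 - lambda / 2) * V x + 0)%:E)%E.
  by rewrite addr0; apply: PV_off; rewrite D0.
have l01 : 0 <= 1 - lambda / 2 < 1 by apply/andP; split; move: l0 l1; lra.
have := stationary_moment_le piP mV V_ge0 l01 (lexx 0) PVall.
rewrite mul0r; apply/negP; rewrite -ltNge.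
apply: (@lt_le_trans _ _ 1%E) => //.
have <- : (\int[pi]_x 1 = 1)%E.
  rewrite (@integral_cst _ _ _ pi _ measurableT 1%:E) mul1e.
  exact: probability_setT.
apply: ge0_le_integral => //.
by move=> x _; rewrite lee_fin.
Qed.

(** A transition from a point of [D] gives [V] a mean of at most [B0], and [nu] contributes to it
    with weight [eps]. *)
Let nuV : (\int[nu]_x (V x)%:E <= N%:E)%E.
Proof.
have [x Dx] := D_neq0.
have := PV_on Dx; rewrite (splitting x mEV EV0) indicE mem_set// mulr1 => h.
have Q0 : (0 <= \int[Q x]_y (V y)%:E)%E by apply: integral_ge0 => y _; rewrite lee_fin.
have I0 : (0 <= \int[nu]_y (V y)%:E)%E by apply: integral_ge0 => y _; rewrite lee_fin.
have {h} h : (eps%:E * \int[nu]_y (V y)%:E <= B0%:E)%E.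
  by apply: le_trans h; rewrite leeDr.
have fI : (\int[nu]_y (V y)%:E)%E \is a fin_num.
  rewrite ge0_fin_numE//; apply: contraLR h; rewrite -leNgt leye_eq => /eqP ->.
  by rewrite gt0_muley ?lte_fin// -ltNge ltry.
rewrite -(fineK fI) -EFinM lee_fin in h; rewrite -(fineK fI) lee_fin.
by rewrite ler_pdivlMr// mulrC.
Qed.

Let mVr r : measurable_fun [set: T] (fun x => V x `^ r).
Proof. exact: (measurableT_comp (measurable_powR r) mV). Qed.

Let Vr0 r x : 0 <= V x `^ r. Proof. exact: powR_ge0. Qed.
Let Vr1 r x : 0 <= r -> 1 <= V x `^ r.
Proof. by move=> r0; rewrite -[leLHS](powRr0 (V x)); exact: ler_powR. Qed.

(** On [D] the residual kernel has mass [1 - eps], and Jensen's inequality bounds the integral by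
    [(1 - eps) * (1 + eps / 2)]. Off [D] the drift has no additive constant, and Jensen's inequality
    yields the factor [(1 - lambda / 2) ^ r]. *)
Let QVr r x : q <= r -> r <= q * 2 ->
  (\int[Q x]_y (V y `^ r)%:E <= (gam * V x `^ r)%:E)%E.
Proof.
move=> qr rq; have r0 : 0 <= r by rewrite (le_trans (ltW q0)).
have r01 : 0 <= r <= 1 by rewrite r0 (le_trans rq).
have mEVr : measurable_fun [set: T] (fun y => (V y `^ r)%:E) by exact/measurable_EFinP.
have [Dx|nDx] := pselect (D x).
  have mass : Q x [set: T] = (1 - eps)%:E.
    by rewrite residualT indicE mem_set// mulr1.
  have m0 : 0 < 1 - eps by move: e2; lra.
  have QV : (\int[Q x]_y (V y)%:E <= B0%:E)%E.
    exact: le_trans (Q_le_P x mEV EV0) (PV_on Dx).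
  apply: (le_trans (powR_moment mV V_ge1 mass m0 B0_gt0 r01 QV)); rewrite lee_fin.
  have h := powR_ratio_le delta_gt0 lambda01 b_ge0 r0 rq.
  apply: (@le_trans _ _ ((1 - eps) * (1 + eps / 2))); first by rewrite ler_pM2l.
  apply: (@le_trans _ _ gam).
    rewrite le_max; apply/orP; left; rewrite -subr_ge0.
    have -> : 1 - eps / 2 - (1 - eps) * (1 + eps / 2) = eps ^+ 2 / 2 by field.
    by rewrite divr_ge0// sqr_ge0.
  by rewrite ler_peMr ?Vr1// ltW// weight_rate_gt0.
have I0 : 0 < (1 - lambda / 2) * V x by rewrite mulr_gt0//; move: l1; lra.
apply: (le_trans (Q_le_P x mEVr (fun y => _))); first by move=> y; rewrite lee_fin.
have mass : P x [set: T] = 1%:E by exact: prob_kernel.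
have H := powR_moment mV V_ge1 mass ltr01 I0 r01 (PV_off nDx).
apply: (le_trans H).
rewrite lee_fin mul1r divr1 powRM//; last by move: l1; lra.
rewrite ler_wpM2r// le_max; apply/orP; right.
by apply: ger_powR => //; apply/andP; split; move: l0 l1; lra.
Qed.

Definition drift_weight x := V x `^ q.
Local Notation u := drift_weight.

Lemma measurable_drift_weight : measurable_fun [set: T] u.
Proof. exact: mVr. Qed.

Lemma drift_weight_ge1 x : 1 <= u x.
Proof. by apply: Vr1; exact: ltW. Qed.

Let u2E x : sqr_weight u x = V x `^ (q * 2).
Proof. by rewrite /sqr_weight -powR_mulrn ?powR_ge0// -powRrM. Qed.

Lemma residual_drift_weight x : (\int[Q x]_y (u y)%:E <= (gam * u x)%:E)%E.
Proof. by apply: QVr; move: q0; lra. Qed.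

Let nuVr r : 0 <= r -> r <= 1 -> (\int[nu]_x (V x `^ r)%:E <= N%:E)%E.
Proof.
move=> r0 r1; apply: le_trans nuV; apply: ge0_le_integral => //.
- by move=> x _; rewrite lee_fin.
- by apply/measurable_EFinP.
- by move=> x _; rewrite lee_fin; exact: ler1_powR.
Qed.

Lemma nu_drift_weight : (\int[nu]_x (u x)%:E <= N%:E)%E.
Proof. by apply: nuVr; move: q0 q1; lra. Qed.

Let N_ge0 : 0 <= N.
Proof. by rewrite (le_trans ler01)// weight_cap_ge1. Qed.

Let PVr r x : q <= r -> r <= q * 2 ->
  (\int[P x]_y (V y `^ r)%:E <= (gam * V x `^ r + N)%:E)%E.
Proof.
move=> qr rq.
have r0 : 0 <= r by rewrite (le_trans (ltW q0)).
have mEVr : measurable_fun [set: T] (fun y => (V y `^ r)%:E) by exact/measurable_EFinP.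
have I0 : (0 <= \int[nu]_y (V y `^ r)%:E)%E.
  by apply: integral_ge0 => y _; rewrite lee_fin.
have EVr0 y : (0 <= (V y `^ r)%:E)%E by rewrite lee_fin.
rewrite (splitting x mEVr EVr0).
rewrite EFinD; apply: leeD; first exact: QVr.
apply: le_trans (nuVr r0 (le_trans rq q1)).
rewrite -[leRHS]mul1e lee_wpmul2r// lee_fin.
rewrite indicE; case: (_ \in _); rewrite ?mulr1 ?mulr0//.
by move: e2; lra.
Qed.

Lemma transition_drift_weight x : (\int[P x]_y (u y)%:E <= (gam * u x + N)%:E)%E.
Proof. by apply: PVr; move: q0; lra. Qed.

Lemma transition_drift_weight_off x : ~ D x -> (\int[P x]_y (u y)%:E <= (gam * u x)%:E)%E.
Proof.
move=> nDx.
have mEu : measurable_fun [set: T] (fun y => (u y)%:E).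
  by apply/measurable_EFinP; exact: measurable_drift_weight.
have Eu0 y : (0 <= (u y)%:E)%E by rewrite lee_fin; exact: Vr0.
rewrite (splitting x mEu Eu0) indicE memNset// mulr0 mul0e adde0.
exact: residual_drift_weight.
Qed.

Lemma stationary_drift_weight :
  (\int[pi]_x (sqr_weight u x)%:E <= (weight_moment delta lambda b)%:E)%E.
Proof.
have g01 : 0 <= gam < 1.
  by rewrite (ltW (weight_rate_gt0 _ _ _))//= weight_rate_lt1.
apply: (stationary_moment_le piP _ _ g01 N_ge0).
- exact: (measurable_sqr_weight measurable_drift_weight).
- by move=> x; rewrite sqr_ge0.
- move=> x; rewrite u2E.
  under eq_integral do rewrite u2E.
  by apply: PVr => //; move: q0; lra.
Qed.

End drift_reduction.

(** * Assembly of the theorem *)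

Theorem theorem1 (R : realType) (d : measure_display) (T : measurableType d)
    (hT : countably_generated T)
    (V : T -> R) (mV : measurable_fun [set: T] V) (V_ge1 : forall x, 1 <= V x)
    (delta lambda b kappa s : R)
    (delta_gt0 : 0 < delta) (lambda01 : 0 < lambda < 1) (b_ge0 : 0 <= b)
    (kappa_ge0 : 0 <= kappa) (s_gt0 : 0 < s) :
  let alpha := (s + 1)^-1 in
  exists (C0 A2 A3 : R) (A1 A4 : R -> R),
    (* [A1] is applied to the value of [V] at the starting point. *)
    [/\ [/\ 0 < C0, 0 < A2 & 0 < A3],
        forall v, 0 < A1 v,
        forall eta, 0 < eta <= 1 -> 0 < A4 eta,
        exists c c' : R, [/\ 0 < c, 0 < c' &
          \forall eta \near (0 : R)^'+, c / eta <= A4 eta <= c' / eta]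
      & forall (P : R.-pker T ~> T) (pi nu : probability T R) (C : set T)
          (g : T -> R)
          (dO : measure_display) (Omega : measurableType dO)
          (X : nat -> Omega -> T)
          (Pr : probability T R -> probability Omega R),
        markov_family P X Pr ->
        harris_recurrent X Pr ->
        unique_stationary P pi ->
        measurable C -> (0 < pi C)%E -> (0 < nu C)%E ->
        small_set P C nu delta ->
        has_ubound (V @` C) ->
        geometric_drift P V C lambda b ->
        measurable_fun [set: T] g ->
        (forall x, `|g x| <= kappa * ln (V x) `^ s) ->
        exists sigma2 : R,
          asymptotic_variance (Pr pi) g X sigma2 /\
          forall (x : T) (eta t : R) (n : nat),
            0 < eta <= 1 -> 0 < t -> (1 <= n)%N ->
            (Pr \d_x
               [set w | (t < `|additive_functional g X n w
                               - n%:R * \int[pi]_y g y|)%R]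
             <= (2 * expR (- ((t * eta) `^ alpha / A1 (V x) `^ alpha))
                 + C0 * expR (- ((t * eta) `^ alpha / A2 `^ alpha))
                 + expR 8 * expR (- ((eta * t) `^ alpha / A3 `^ alpha))
                 + 2 `^ (1 + eta / (2 + eta))
                   * expR (- (t ^+ 2
                       / (2 * ((1 + eta) * sigma2 * n%:R
                               + A4 eta * logn_e n `^ alpha^-1 * t))))
                )%:E)%E].
Proof.
move=> alpha.
have s1 : 0 < s + 1 by rewrite addr_gt0.
have q0 := weight_power_gt0 delta_gt0 lambda01 b_ge0.
have e0 := split_mass_gt0 delta_gt0; have e2 := split_mass_le delta.
have gm0 := weight_rate_gt0 delta lambda b.
have gm1 := weight_rate_lt1 delta_gt0 lambda01 b_ge0.
have N1 := weight_cap_ge1 delta_gt0 lambda01 b_ge0.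
set q := weight_power delta lambda b in q0.
set gam := weight_rate delta lambda b in gm0 gm1.
set N := weight_cap delta lambda b in N1.
pose M := weight_moment delta lambda b.
have gam01 : 0 < gam < 1 by rewrite gm0 gm1.
have N0 : 0 < N by exact: lt_le_trans ltr01 N1.
have M0 : 0 <= M by rewrite divr_ge0 ?(ltW N0)// subr_ge0 ltW.
(* Converts the growth condition to [u], for which [ln u = q * ln V]; [kappa + 1] in place of
   [kappa] keeps [k] positive. *)
pose k := (kappa + 1) * q^-1 `^ s.
have k0 : 0 < k by rewrite mulr_gt0 ?ltr_wpDl// powR_gt0// invr_gt0.
pose r := extra_rate gam s k; pose Ce := extra_const gam N.
pose KA := linear_coef gam N M s k.
have r0 : 0 < r by exact: extra_rate_gt0.
have KA0 : 0 < KA by apply: (lt_le_trans ltr01); exact: linear_coef_ge1.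
(* The inverse of the rate in [two_sided_bound], where [u x = V x ^ q]. The bound involves
   [A1 ^ alpha], hence the power [s + 1] in the witness. *)
pose base v := 4 * (ln (Num.max 1 (Ce * v `^ q)) + 1) / r.
have base0 v : 0 < base v.
  rewrite divr_gt0// mulr_gt0// ltr_wpDl// ln_ge0// le_max lexx//.
(* The stretched exponential tail is carried entirely by the first summand, whose constant depends
   on [V] at the starting point; the value 1 then suffices for [C0], [A2] and [A3]. *)
exists 1, 1, 1, (fun v => base v `^ (s + 1)), (fun eta => KA / eta).
split.
- by [].
- by move=> v; exact: powR_gt0.
- by move=> eta /andP[eta0 _]; rewrite divr_gt0.
- by exists KA, KA; split=> //; near=> eta; rewrite lexx.
move=> P pi nu C g dO Omega X Pr fam _ [piP _] mC _ nuC small _ drift mg g_le.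
pose u := drift_weight V delta lambda b.
have mu : measurable_fun [set: T] u := measurable_drift_weight delta lambda b mV.
have u1 x : 1 <= u x := drift_weight_ge1 V_ge1 delta_gt0 lambda01 b_ge0 x.
pose D := sublevel_set V lambda b C.
have mD : measurable D := measurable_sublevel_set lambda b mV mC.
have Qu := residual_drift_weight mV V_ge1 delta_gt0 lambda01 b_ge0 mC small drift.
have nu_u := nu_drift_weight mV V_ge1 delta_gt0 lambda01 b_ge0 piP mC small drift.
have Pu := transition_drift_weight mV V_ge1 delta_gt0 lambda01 b_ge0 piP mC small drift.
have Poff := transition_drift_weight_off mV V_ge1 delta_gt0 lambda01 b_ge0 mC small drift.
have piu2 := stationary_drift_weight mV V_ge1 delta_gt0 lambda01 b_ge0 piP mC small drift.
have kg x : `|g x| <= k * ln (u x) `^ s.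
  have V0 : 0 < V x by exact: lt_le_trans ltr01 (V_ge1 x).
  have lV : 0 <= ln (V x) by exact: ln_ge0.
  have -> : ln (u x) = q * ln (V x) by rewrite /u /drift_weight ln_powR.
  have qs : q^-1 `^ s * q `^ s = 1.
    by rewrite -powRM ?invr_ge0 ?(ltW q0)// mulVf ?gt_eqF// powR1.
  rewrite powRM ?(ltW q0)// /k -mulrA (mulrA (q^-1 `^ s)) qs mul1r.
  by apply: (le_trans (g_le x)); rewrite ler_wpM2r ?powR_ge0// lerDl.
have wpi2 : weighted (sqr_weight u) pi by exact: le_lt_trans piu2 (ltry _).
have wpi : weighted u pi by exact: (weighted_sqr mu u1 wpi2).
have wnu : weighted u nu by exact: le_lt_trans nu_u (ltry _).
have Pu' x : (\int[P x]_y (u y)%:E <= ((gam + N) * u x)%:E)%E.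
  by apply: (le_trans (Pu x)); rewrite lee_fin mulrDl lerD2l ler_peMr// ltW.
have c0 := centered_rate_ge0 s M0 k0.
have cle := centered_le mu u1 piu2 mg s_gt0 (ltW k0) kg.
have cmean := centered_mean0 mu u1 piu2 mg s_gt0 (ltW k0) kg.
have dh := dominated_block_sum mu u1 gam01 Qu (measurable_centered pi mg) c0 cle.
have hE := block_sum_poisson_equation mu u1 gam01 Qu wnu Pu' piP wpi (measurable_centered pi mg) c0 cle cmean.
set h := block_sum _ _ _ _ in dh hE.
have dc : dominated u (centered pi g).
  by split; [exact: measurable_centered|exists (centered_rate M s k) => x; exact: cle].
have dg : dominated u g.
  have := dominatedD dc (dominated_cst u1 (\int[pi]_x g x)).
  by congr dominated; apply/funext => x; rewrite /centered subrK.
have smallC : small_set P C nu (split_mass delta).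
  move=> x Cx B mB; apply: le_trans (small x Cx B mB).
  by rewrite lee_wpmul2r// lee_fin ge_min lexx.
have e1 : split_mass delta <= 1 by apply: (le_trans e2); lra.
(* The contraction uses [C] as small set and [D] as the set off which the drift of [u] has no
   additive constant. *)
have mix := transition_mean_to0 mC mD (@subIsetl _ _ _) e0 e1 smallC nuC mu u1 gam01
  (ltW N0) Pu Poff wnu wpi2 dh dc cmean.
have av := asymptotic_variance_limit (fam pi) piP mu u1 wpi2 Pu' dg dh hE mix.
exists (limit_variance pi g h); split=> // x eta t n eta01 t0 n1.
have s2 := asymptotic_variance_ge0 av.
have e1' : split_mass delta <= 1 := e1.
have H := two_sided_bound e1' mu u1 gam01 Qu N0 nu_u Pu piP piu2 s_gt0 k0 kg s2
  (fam \d_x) n eta01 t0.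
apply: (le_trans H); rewrite lee_fin.
have [eta0 eta1] := andP eta01.
have -> : (base (V x) `^ (s + 1)) `^ alpha = base (V x).
  by rewrite -powRrM /alpha mulfV ?gt_eqF// powRr1// ltW.
rewrite /alpha invrK (mulrC t eta) -/alpha !powR1 !mul1r !divr1.
set w := (eta * t) `^ alpha.
have -> : w * (extra_rate gam s k / (4 * (ln (Num.max 1 (extra_const gam N * u x)) + 1))) =
    w / base (V x) by rewrite /base invf_div.
set bern := expR (- (t ^+ 2 / _)).
(* The union of the two tails gives the Bernstein term a factor 2, below the one claimed. *)
have two : 2 <= 2 `^ (1 + eta / (2 + eta)) :> R.
  rewrite -[leLHS]powRr1//; apply: ler_powR; first by rewrite ler1n.
  by rewrite lerDl divr_ge0 ?(ltW eta0)// addr_ge0// ltW.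
have b2 : 2 * bern <= 2 `^ (1 + eta / (2 + eta)) * bern by rewrite ler_wpM2r ?expR_ge0.
have e8 : 0 <= expR 8 * expR (- w) by rewrite mulr_ge0 ?expR_ge0.
have ew := expR_ge0 (- w).
apply: lerD b2; rewrite -addrA lerDl addr_ge0//.
Unshelve. all: by end_near.
Qed.
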